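(* Let $1<p<\infty$, $0<\gamma<p$, $\lambda_\pm>0$, and let $u\in W^{1,p}(\Omega)$ be a local minimizer of $\mathcal{J}$. Then $F'_\gamma(u)\in L^1_{\mathrm{loc}}(\Omega)$, where $$F'_\gamma(u):=\gamma\left[\lambda_+u^{\gamma-1}\chi_{\{u>0\}}-\lambda_-(-u)^{\gamma-1}\chi_{\{u<0\}}\right].$$
   Context: $\Omega\subset\mathbb{R}^N$ is open and bounded with Lipschitz boundary. The functional is $$\mathcal{J}[u]:=\int_\Omega \frac{|\nabla u|^p}{p}+F_\gamma(u)\,dx,\qquad F_\gamma(u):=\lambda_+(u_+)^\gamma+\lambda_-(u_-)^\gamma,\qquad u_\pm:=\max\{\pm u,0\}.$$ A function $u\in W^{1,p}(\Omega)$ is a local minimizer of $\mathcal{J}$ if $\mathcal{J}[u]\le\mathcal{J}[u+\varphi]$ for every open $\Omega'\Subset\Omega$ and every $\varphi\in W^{1,p}_0(\Omega')$ (extended by zero). $F'_\gamma(u)$ is understood to be $0$ on $\{u=0\}$. *)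

(* Defs.v *)
From HB Require Import structures.
From mathcomp Require Import all_boot all_order all_algebra.
From mathcomp Require Import all_classical all_reals all_analysis.

Set Implicit Arguments.
Unset Strict Implicit.
Unset Printing Implicit Defensive.
Import Order.TTheory GRing.Theory Num.Theory.
Import numFieldNormedType.Exports.

Local Open Scope classical_set_scope.
Local Open Scope ring_scope.

(* The sigma-algebra on R^n generated by the coordinates, as the library does
   for n.-tuple; it is the Borel sigma-algebra of R^n. *)
Definition rV_display : measure_display. Proof. exact: default_measure_display. Qed.

Section measurable_rV.
Context {R : realType} (n : nat).

Let coors : 'I_n -> 'rV[R]_n -> R := fun i x => x ord0 i.

Let rV_set0 : g_sigma_preimage coors set0.
Proof. exact: sigma_algebra0. Qed.

Let rV_setC A : g_sigma_preimage coors A -> g_sigma_preimage coors (~` A).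
Proof. exact: sigma_algebraC. Qed.

Let rV_bigcup (F : _^nat) : (forall i, g_sigma_preimage coors (F i)) ->
  g_sigma_preimage coors (\bigcup_i (F i)).
Proof. exact: sigma_algebra_bigcup. Qed.

HB.instance Definition _ := @isMeasurable.Build rV_display
  'rV[R]_n (g_sigma_preimage coors) rV_set0 rV_setC rV_bigcup.

End measurable_rV.

Section lebesgue_rV.
Context {R : realType}.
Local Open Scope ereal_scope.

Lemma measurable_coor n (i : 'I_n) :
  measurable_fun [set: 'rV[R]_n] (fun x : 'rV[R]_n => x ord0 i).
Proof.
move=> _ Y mY; rewrite setTI; apply: sub_sigma_algebra.
rewrite -bigcup_seq/=; exists i; first by rewrite /= mem_index_enum.
by exists Y => //; rewrite setTI.
Qed.

Lemma measurable_fun_rVP d (T : measurableType d) n (f : T -> 'rV[R]_n) :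
  (forall i, measurable_fun [set: T] (fun x => f x ord0 i)) ->
  measurable_fun [set: T] f.
Proof.
move=> mf.
apply: (@measurability _ _ _ _ _ f
  (\big[setU/set0]_(i < n) preimage_set_system setT
     (fun x : 'rV[R]_n => x ord0 i) measurable)) => //.
move=> _ [A] + <-; rewrite -bigcup_seq => -[i /= _ [B mB <-]].
rewrite !setTI; have := mf i measurableT B mB.
by rewrite setTI.
Qed.

Definition rV_cons n (x : R * 'rV[R]_n) : 'rV[R]_n.+1 :=
  row_mx (x.1%:M : 'rV[R]_1) x.2.

Definition rV_uncons n (x : 'rV[R]_n.+1) : R * 'rV[R]_n :=
  (x ord0 ord0, \row_j x ord0 (lift ord0 j)).

Lemma rV_cons0 n (x : R * 'rV[R]_n) : rV_cons x ord0 ord0 = x.1.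
Proof.
rewrite /rV_cons; have -> : ord0 = lshift n (ord0 : 'I_1) by exact/val_inj.
by rewrite (row_mxEl (x.1%:M : 'rV_1) x.2) mxE eqxx mulr1n.
Qed.

Lemma rV_consS n (x : R * 'rV[R]_n) j :
  rV_cons x ord0 (lift ord0 j) = x.2 ord0 j.
Proof.
rewrite /rV_cons; have -> : lift ord0 j = rshift 1 j by exact/val_inj.
by rewrite (row_mxEr (x.1%:M : 'rV_1) x.2).
Qed.

Lemma rV_consK n : cancel (@rV_cons n) (@rV_uncons n).
Proof.
move=> [t y]; rewrite /rV_uncons rV_cons0; congr pair.
by apply/rowP => j; rewrite mxE rV_consS.
Qed.

Lemma measurable_rV_cons n : measurable_fun [set: R * 'rV[R]_n] (@rV_cons n).
Proof.
apply: measurable_fun_rVP => i; case: (unliftP ord0 i) => [j ->|->].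
  under eq_fun do rewrite rV_consS.
  apply: (@measurableT_comp _ _ _ _ _ _ (fun y : 'rV[R]_n => y ord0 j)) => //.
  exact: measurable_coor.
by under eq_fun do rewrite rV_cons0; exact: measurable_fst.
Qed.

Lemma measurable_rV_uncons n :
  measurable_fun [set: 'rV[R]_n.+1] (@rV_uncons n).
Proof.
apply: measurable_fun_pair; first exact: measurable_coor.
apply: measurable_fun_rVP => j; under eq_fun do rewrite mxE.
exact: measurable_coor.
Qed.

HB.instance Definition _ n := @isMeasurableFun.Build _ _ _ _
  (@rV_cons n) (@measurable_rV_cons n).

Section step.
Variables (n : nat) (m : {sigma_finite_measure set 'rV[R]_n -> \bar R}).

Definition lebesgue_rV_step : set 'rV[R]_n.+1 -> \bar R :=
  pushforward (@lebesgue_measure R \x m) (@rV_cons n).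

Let lm := measure_function_pushforward__canonical__measure_function_Measure
  (@lebesgue_measure R \x m) (@measurable_rV_cons n).

HB.instance Definition _ := isMeasure.Build _ _ _ lebesgue_rV_step
  (@measure0 _ _ _ lm) (@measure_ge0 _ _ _ lm)
  (@measure_semi_sigma_additive _ _ _ lm).

Let lebesgue_rV_step_sigma_finite : sigma_finite setT lebesgue_rV_step.
Proof.
have /sigma_finiteP[F [TF ndF mF]] := sigma_finiteT (@lebesgue_measure R).
have /sigma_finiteP[G [TG ndG mG]] := sigma_finiteT m.
exists (fun k => @rV_uncons n @^-1` (F k `*` G k)).
  apply/esym; rewrite -subTset => x _.
  have [k _ Fk] : (\bigcup_k F k) (rV_uncons x).1 by rewrite -TF.
  have [l _ Gl] : (\bigcup_k G k) (rV_uncons x).2 by rewrite -TG.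
  exists (maxn k l) => //; split.
  - by move: Fk; exact/subsetPset/ndF/leq_maxl.
  - by move: Gl; exact/subsetPset/ndG/leq_maxr.
move=> k; have [mFk Fkoo] := mF k; have [mGk Gkoo] := mG k; split.
  rewrite -[X in measurable X]setTI; apply: measurable_rV_uncons => //.
  exact: measurableX.
rewrite /lebesgue_rV_step /pushforward -comp_preimage.
rewrite (_ : _ \o _ = id) ?preimage_id.
  by rewrite product_measure1E// lte_mul_pinfty// ge0_fin_numE.
by apply/funext => x /=; rewrite rV_consK.
Qed.

HB.instance Definition _ := Measure_isSigmaFinite.Build _ _ _ lebesgue_rV_step
  lebesgue_rV_step_sigma_finite.

End step.

Fixpoint lebesgue_rV n : {sigma_finite_measure set 'rV[R]_n -> \bar R} :=
  match n with
  | 0%N => \d_ (0%R : 'rV[R]_0)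
  | n.+1 => lebesgue_rV_step (lebesgue_rV n)
  end.

Lemma lebesgue_rV_box n (a b : 'rV[R]_n) :
  (forall i, (a ord0 i <= b ord0 i)%R) ->
  lebesgue_rV n [set x | forall i, x ord0 i \in `]a ord0 i, b ord0 i]] =
    (\prod_(i < n) (b ord0 i - a ord0 i))%:E.
Proof.
elim: n a b => [|n IHn] a b ab /=.
  by rewrite big_ord0 diracE mem_set// => -[].
rewrite /lebesgue_rV_step /pushforward /=.
set tl := fun c : 'rV[R]_n.+1 => (\row_j c ord0 (lift ord0 j))%R : 'rV[R]_n.
pose B : set 'rV[R]_n :=
  [set x | forall i, x ord0 i \in `]tl a ord0 i, tl b ord0 i]].
transitivity ((@lebesgue_measure R \x lebesgue_rV n)
    (`]a ord0 ord0, b ord0 ord0]%classic `*` B)).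
  congr (product_measure1 _ _ _); apply/seteqP; split => -[t y] /=.
    move=> h; split; first by have := h ord0; rewrite rV_cons0.
    by move=> j; have := h (lift ord0 j); rewrite rV_consS !mxE.
  move=> [ht hy] i; case: (unliftP ord0 i) => [j ->|->].
    by rewrite rV_consS; have := hy j; rewrite !mxE.
  by rewrite rV_cons0.
rewrite product_measure1E//; last first.
  rewrite (_ : B = \big[setI/setT]_(i < n)
    ((fun x : 'rV[R]_n => x ord0 i) @^-1` `]tl a ord0 i, tl b ord0 i]%classic)).
    by apply: bigsetI_measurable => i _; rewrite -[X in measurable X]setTI;
      exact: measurable_coor.
  by rewrite -bigcap_seq; apply/seteqP; split => x /= h i; 
    [move=> _; exact: h|apply: h; rewrite /= mem_index_enum].
rewrite IHn; last by move=> i; rewrite !mxE.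
rewrite [X in X * _](@lebesgue_measure_itv R `]a ord0 ord0, b ord0 ord0]%R)/=.
rewrite big_ord_recl EFinM lte_fin.
under [in LHS]eq_bigr do rewrite !mxE.
have := ab ord0; rewrite le_eqVlt => /predU1P[->|->]; last by rewrite -EFinB.
by rewrite ltxx subrr !mul0e.
Qed.

End lebesgue_rV.

(* Elements of L^1_loc, L^p and W^{1,p} on Omega are represented by Borel
   functions on R^N; only their values on Omega matter. *)
Section sobolev.
Context {R : realType} {N : nat}.
Local Notation E := 'rV[R]_N.
Local Notation mu := (@lebesgue_rV R N).
Implicit Types (Omega : set E) (u f phi : E -> R) (G : E -> E) (p : R).

(* The norm that the library puts on row vectors is the maximum norm. *)
Definition enorm (v : E) : R := Num.sqrt (\sum_i v ord0 i ^+ 2).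

Definition basis (i : 'I_N) : E := delta_mx ord0 i.

Definition partial (i : 'I_N) f : E -> R := fun x => 'D_(basis i) f x.

(* foldr partial f s ranges over the iterated partial derivatives of f. *)
Definition smooth f : Prop := forall s : seq 'I_N,
  continuous (foldr partial f s) /\
  forall (i : 'I_N) (x : E), derivable (foldr partial f s) x (basis i).

Definition test_function Omega f : Prop :=
  [/\ smooth f, compact (closure [set x | f x != 0]) &
      closure [set x | f x != 0] `<=` Omega].

Definition L1loc Omega f : Prop := measurable_fun Omega f /\
  forall K, K `<=` Omega -> compact K -> mu.-integrable K (EFin \o f).

Definition Lp Omega p f : Prop :=
  measurable_fun Omega f /\ finite_norm mu p%:E (f \_ Omega).

Definition is_weak_gradient Omega u G : Prop :=
  L1loc Omega u /\
  forall i : 'I_N, L1loc Omega (fun x => G x ord0 i) /\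
    forall phi, test_function Omega phi ->
      \int[mu]_(x in Omega) (u x * partial i phi x) =
      - \int[mu]_(x in Omega) (G x ord0 i * phi x).

(* Weak gradients are unique up to null sets; one of them is selected, which
   does not affect integrals. The value is junk if there is none. *)
Definition weak_gradient Omega u : E -> E :=
  xget (fun=> 0) [set G | is_weak_gradient Omega u G].

Definition W1p Omega p u : Prop :=
  Lp Omega p u /\
  exists G, is_weak_gradient Omega u G /\
    forall i : 'I_N, Lp Omega p (fun x => G x ord0 i).

Definition W1p_norm Omega p u : \bar R :=
  ((\int[mu]_(x in Omega)
     (`|u x| `^ p + enorm (weak_gradient Omega u x) `^ p)%R%:E) `^ p^-1)%E.

Definition W1p0 Omega p u : Prop :=
  W1p Omega p u /\
  forall e : R, 0 < e -> exists2 phi, test_function Omega phi &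
    (W1p_norm Omega p (u \- phi)%R < e%:E)%E.

(* Near each boundary point, after an orthogonal change of coordinates, the
   domain is the set of points lying strictly above the graph of a Lipschitz
   function of the other N - 1 coordinates. *)
Definition lipschitz_boundary Omega : Prop :=
  forall x0 : E, (closure Omega `\` Omega^°) x0 ->
  exists (Q : 'M[R]_N) (i : 'I_N) (g : 'rV[R]_N.-1 -> R),
    [/\ Q *m Q^T = 1%:M, lipschitz g &
      \forall x \near x0,
        Omega x <-> g (col' i (x *m Q)) < (x *m Q) ord0 i].

Definition compactly_contained (Omega' Omega : set E) : Prop :=
  compact (closure Omega') /\ closure Omega' `<=` Omega.

Definition Fgamma (gam lamp lamm t : R) : R :=
  lamp * Num.max t 0 `^ gam + lamm * Num.max (- t) 0 `^ gam.

Definition Fgamma' (gam lamp lamm t : R) : R :=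
  gam * (lamp * (t `^ (gam - 1)) * \1_[set s | 0 < s] t -
         lamm * ((- t) `^ (gam - 1)) * \1_[set s | s < 0] t).

Definition energy Omega p gam lamp lamm u : \bar R :=
  (\int[mu]_(x in Omega)
    (enorm (weak_gradient Omega u x) `^ p / p + Fgamma gam lamp lamm (u x))%R%:E)%E.

Definition local_minimizer Omega p gam lamp lamm u : Prop :=
  W1p Omega p u /\
  forall (Omega' : set E) phi,
    open Omega' -> compactly_contained Omega' Omega -> W1p0 Omega' p phi ->
    (energy Omega p gam lamp lamm u <=
     energy Omega p gam lamp lamm (u \+ (phi \_ Omega'))%R)%E.

End sobolev.

(* Main.v *)
(* If 1 <= gam, then |F'(u)| <= C (1 + |u|^p) and the claim is immediate. Let
   gam < 1. Let Z be a smooth odd approximation of the sign function that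
   vanishes on [-d, d], phi a smooth cutoff supported in a ball, and v a
   mollification of u; the competitor is u - eps phi Z(v). As F is concave on
   each half-line and Z(u) has the sign of u,
     F(u) - F(u - eps phi Z(u)) >= eps phi |Z(u)| |F'(u)|,
   and replacing Z(u) by Z(v) costs at most a multiple of |u - v|^gam. The
   gradient of the competitor is
     (1 - s) grad u + s (grad u - grad v) - eps Z(v) grad phi,
   where s = eps phi Z'(v) lies in [0, 1] for small eps, so that convexity of
   |.|^p bounds its p-th power by
     |grad u|^p + eps ((|grad u| + M)^p + 1) + C |grad u - grad v|^p.
   Minimality, division by eps and v -> u in W^{1,p} then bound the integral of
   phi |Z(u)| |F'(u)| independently of d, and d -> 0 by monotone convergence.
   Since only the smooth v is composed with Z, no chain rule for Sobolev
   functions is involved. *)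

Require Import Defs.
From HB Require Import structures.
From mathcomp Require Import all_boot all_order all_algebra.
From mathcomp Require Import all_classical all_reals all_analysis.
From mathcomp Require Import measurable_realfun.
From mathcomp Require Import ring lra.
Import Order.TTheory GRing.Theory Num.Theory.
Import numFieldNormedType.Exports.
Local Open Scope classical_set_scope.
Local Open Scope ring_scope.

Set Implicit Arguments.
Unset Strict Implicit.
Unset Printing Implicit Defensive.

(** * Translation invariance of Lebesgue measure *)

(** The energy is written with a weak gradient selected by choice, so comparing two energies
    requires that weak gradients agree almost everywhere. This uniqueness and the smooth
    approximation of [u] both come from mollification, which rests on the continuity of translations
    in L^1; hence the first half of the development. L^1 closeness is enough for [u - v], since
    [|u - v|^gam] lies below an affine function of [|u - v|] with arbitrarily small constant term;
    only the gradients need L^p. The final constant is free of [d] because the terms of order [eps]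
    contain only [grad u] and the bound [M] of [grad phi], while the large factor Z' of order
    [1 / d] is neutralized by the choice of [eps]. The condition [eps <= d] keeps [u - eps phi Z(u)]
    on the same side of 0 as [u], where concavity applies. *)

Lemma lebesgue_measure_translate (R : realType) (a : R) (A : set R) :
  measurable A ->
  lebesgue_measure ((fun x => x + a) @^-1` A) = lebesgue_measure A.
Proof.
move=> mA.
suff H : pushforward lebesgue_measure ((fun x => x + a) : _ -> measurableTypeR R) A
    = lebesgue_measure A by [].
apply/esym/lebesgue_measure_unique => //=; first exact: measurable_funD.
move=> _ _ [[x y] _ <-]; rewrite /pushforward.
rewrite (_ : _ @^-1` _ = `]x - a, y - a]%classic); last first.
  by apply/seteqP; split=> z /=; rewrite !in_itv /= ltrBlDr lerBrDr.
rewrite !lebesgue_measure_itv /=.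
by rewrite !lte_fin ltrD2r; case: ifP => // _; rewrite -!EFinB; congr (_%:E); ring.
Qed.

Lemma ge0_integral_lebesgue_translate (R : realType) (a : R) (g : R -> \bar R) :
  measurable_fun setT g -> (forall t, 0 <= g t)%E ->
  (\int[@lebesgue_measure R]_t g (t + a)%R = \int[@lebesgue_measure R]_t g t)%E.
Proof.
move=> mg g0; pose phi : measurableTypeR R -> measurableTypeR R := fun x => x + a.
have mphi : measurable_fun setT phi by exact: measurable_funD.
have := @ge0_integral_pushforward _ _ _ _ R phi mphi lebesgue_measure setT g.
rewrite preimage_setT => <- //.
by apply: eq_measure_integral => A mA _; exact: lebesgue_measure_translate.
Qed.

Section lebesgue_rV_translation.
Context {R : realType}.

Lemma measurable_fun_addrV n (h : 'rV[R]_n) :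
  measurable_fun [set: 'rV[R]_n] (fun x => x + h).
Proof.
apply: measurable_fun_rVP => i.
under eq_fun do rewrite mxE.
by apply: measurable_funD => //; exact: measurable_coor.
Qed.

(** Induction on the dimension: a section of the translated set is a translate of a section of the
    set, so the induction hypothesis handles the last coordinates, and invariance of the outer
    one-dimensional integral handles the first one. *)
Lemma lebesgue_rV_translate n (h : 'rV[R]_n) (A : set 'rV[R]_n) :
  measurable A ->
  lebesgue_rV n ((fun x => x + h) @^-1` A) = lebesgue_rV n A.
Proof.
elim: n h A => [|n IHn] h A mA /=.
  by congr (dirac _ _); apply/seteqP; split => x /=;
    rewrite (_ : x + h = x)//; apply/rowP => -[].
rewrite /lebesgue_rV_step /pushforward.
have mB : measurable (@rV_cons R n @^-1` A).
  by rewrite -[X in measurable X]setTI; exact: measurable_rV_cons.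
set B := rV_cons (n:=n) @^-1` A in mB *.
have -> : rV_cons (n:=n) @^-1` ((fun x => x + h) @^-1` A) =
    (fun z : R * 'rV[R]_n => (z.1 + h ord0 ord0, z.2 + (rV_uncons h).2)) @^-1` B.
  apply/seteqP; split => -[t y] /=; rewrite /B /=; congr A.
    apply/rowP => i; case: (unliftP ord0 i) => [j ->|->].
      by rewrite mxE !rV_consS !mxE.
    by rewrite mxE !rV_cons0.
  apply/esym/rowP => i; case: (unliftP ord0 i) => [j ->|->].
    by rewrite mxE !rV_consS !mxE.
  by rewrite mxE !rV_cons0.
set a := h ord0 ord0; set b := (rV_uncons h).2.
rewrite /product_measure1 /=.
pose g t := lebesgue_rV n (xsection B t).
have mg : measurable_fun setT g by exact: measurable_fun_xsection.
transitivity (\int[@lebesgue_measure R]_t g (t + a)%R)%E.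
  apply: eq_integral => t _ /=; rewrite /g -(IHn b (xsection B (t + a))); last exact: measurable_xsection.
  by congr (lebesgue_rV n _); apply/seteqP; split => y; rewrite /xsection /= !inE.
exact: ge0_integral_lebesgue_translate.
Qed.

Lemma ge0_integral_translate n (h : 'rV[R]_n) (f : 'rV[R]_n -> \bar R) :
  measurable_fun setT f -> (forall x, 0 <= f x)%E ->
  (\int[lebesgue_rV n]_x f (x + h)%R = \int[lebesgue_rV n]_x f x)%E.
Proof.
move=> mf f0; have ma := measurable_fun_addrV h.
transitivity (\int[lebesgue_rV n]_(t in ((fun x => x + h) @^-1` setT)%R) (f \o (fun x => (x + h)%R)) t)%E.
  by rewrite preimage_setT.
rewrite -(ge0_integral_pushforward ma) //.
apply: eq_measure_integral => A' mA' _.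
exact: lebesgue_rV_translate.
Qed.

Lemma integral_translate n (h : 'rV[R]_n) (f : 'rV[R]_n -> \bar R) :
  measurable_fun setT f ->
  (\int[lebesgue_rV n]_x f (x + h)%R = \int[lebesgue_rV n]_x f x)%E.
Proof.
move=> mf; rewrite integralE [RHS]integralE.
rewrite -(@ge0_integral_translate n h (f ^\+)%E) //; last exact: measurable_funepos.
rewrite -(@ge0_integral_translate n h (f ^\-)%E) //; last exact: measurable_funeneg.
by congr (_ - _)%E; apply: eq_integral => x _; rewrite ?funeposE ?funenegE.
Qed.

Lemma Rintegral_translate n (h : 'rV[R]_n) (f : 'rV[R]_n -> R) :
  measurable_fun setT f ->
  \int[lebesgue_rV n]_x f (x + h)%R = \int[lebesgue_rV n]_x f x.
Proof.
move=> mf; rewrite /Rintegral (@integral_translate n h (EFin \o f)) //.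
exact/measurable_EFinP.
Qed.

End lebesgue_rV_translation.

(** * Borel sets, null sets and measures of balls in R^n *)

Section rV_topology.
Context {R : realType} {n : nat}.
Local Notation E := 'rV[R]_n.
Implicit Types (x y : E) (A U : set E).

Lemma ball_rVP (x y : E) (e : R) : 0 < e ->
  ball x e y <-> forall i, `|x ord0 i - y ord0 i| < e.
Proof.
move=> e0; split => [[_ h] i|h]; first exact: h.
by split => // i j; rewrite ord1; exact: h.
Qed.

(** Cubes with rational centre and radius [1 / (k + 1)]: a base of the topology indexed by a
    countable type, measurable because each cube is a finite intersection of coordinate
    preimages. *)
Definition ratbox (z : 'rV[rat]_n * nat) : set E :=
  \bigcap_(i in [set: 'I_n]) ((fun x : E => x ord0 i) @^-1`
    (ball (ratr (z.1 ord0 i) : R) (z.2.+1%:R^-1) : set R)).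

Lemma measurable_ratbox z : measurable (ratbox z).
Proof.
apply: fin_bigcap_measurable => // i _.
rewrite -[X in measurable X]setTI; apply: measurable_coor => //.
exact: measurable_ball.
Qed.

Lemma ratbox_ball x e : 0 < e -> exists2 z, ratbox z x & ratbox z `<=` ball x e.
Proof.
move=> e0.
have [k ke] : exists k : nat, k.+1%:R^-1 < e / 2.
  exists (Num.truncn (2 / e)).
  rewrite -[ltRHS]invrK invf_div ltf_pV2 ?posrE ?ltr0n ?divr_gt0 //.
  exact: truncnS_gt.
have /(_ _)/cid qx i : exists q : rat, `|x ord0 i - ratr q| < k.+1%:R^-1.
  have /rat_in_itvoo[q] : x ord0 i - k.+1%:R^-1 < x ord0 i + k.+1%:R^-1.
    by rewrite ltrD2l gtrN // invr_gt0 ltr0n.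
  by rewrite in_itv /= -ltr_distl distrC => qx; exists q.
exists (\row_i sval (qx i), k).
  by move=> i _ /=; rewrite mxE /ball /= distrC; exact: (svalP (qx i)).
move=> y By /=; apply/ball_rVP => // i.
have := By i I; rewrite /= mxE /ball /= => yi.
have := svalP (qx i); move: yi; set q := ratr _ => h1 h2.
rewrite (_ : x ord0 i - _ = (x ord0 i - q) + (q - y ord0 i)); last by ring.
by rewrite (le_lt_trans (ler_normD _ _))// (splitr e) ltrD // (lt_trans _ ke).
Qed.

Lemma rV_open_measurable (U : set E) : open U -> measurable U.
Proof.
move=> oU.
rewrite (_ : U = \bigcup_(z in [set z | ratbox z `<=` U]) ratbox z); last first.
  apply/seteqP; split => [x Ux|x [z /= zU /zU]//].
  have /nbhs_ballP[e /= e0 eU] : nbhs x U by exact: open_nbhs_nbhs.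
  by have [z zx ze] := ratbox_ball x e0; exists z => //= y /ze/eU.
rewrite bigcup_mkcond; apply: countable_bigcupT_measurable => [|z].
  exact: countableP.
by case: ifP => // _; exact: measurable_ratbox.
Qed.

(** A Lindelöf argument: every point of [A] lies in a cube of the countable base whose trace on [A]
    is null, so [A] is covered by countably many null sets. *)
Lemma negligible_local (A : set E) :
  (forall x, A x -> exists2 e, 0 < e & (lebesgue_rV n).-negligible (A `&` ball x e)) ->
  (lebesgue_rV n).-negligible A.
Proof.
move=> hA.
pose P z := (lebesgue_rV n).-negligible (A `&` ratbox z).
pose F z : set E := if `[< P z >] then A `&` ratbox z else set0.
apply: (@negligibleS _ _ _ _ (\bigcup_z F z)).
  move=> x Ax; have [e e0 xe] := hA _ Ax; have [z zx ze] := ratbox_ball x e0.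
  exists z => //; rewrite /F ifT //; apply/asboolP.
  by apply: negligibleS xe; exact: setIS.
have [f] : exists f : nat -> option ('rV[rat]_n * nat), forall z, exists k, f k = Some z.
  by exists (@unpickle _) => z; exists (pickle z); exact: pickleK.
move=> fz; pose G k := if f k is Some z then F z else set0.
apply: (@negligibleS _ _ _ _ (\bigcup_k G k)).
  by move=> x [z _ Fz]; have [k kz] := fz z; exists k => //; rewrite /G kz.
apply: negligible_bigcup => k; rewrite /G; case: (f k) => [z|]; last exact: negligible_set0.
by rewrite /F; case: asboolP => // _; exact: negligible_set0.
Qed.

Lemma rV_closed_measurable (U : set E) : closed U -> measurable U.
Proof.
by move=> cU; rewrite -(setCK U); apply: measurableC; apply: rV_open_measurable; exact: closed_openC.
Qed.

Lemma rV_compact_measurable (U : set E) : compact U -> measurable U.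
Proof.
by move=> /(compact_closed (@norm_hausdorff _ _)); exact: rV_closed_measurable.
Qed.

Lemma rV_continuous_measurable (f : E -> R) : continuous f -> measurable_fun setT f.
Proof.
move=> cf; apply: (measurability _ (RGenOInfty.measurableE R)) => //.
move=> _ [_ [a ->] <-]; rewrite setTI.
apply: rV_open_measurable; move/continuousP : cf; apply; rewrite set_itvE; exact: open_gt.
Qed.

(** Open sets are stable under intersection, so this presentation of the sigma-algebra permits
    Dynkin induction starting from open sets. *)
Lemma rV_measurable_open : @measurable _ E = <<s open >>.
Proof.
apply/seteqP; split; last first.
  apply: smallest_sub; first exact: sigma_algebra_measurable.
  exact: rV_open_measurable.
apply: smallest_sub; first exact: smallest_sigma_algebra.
move=> A; rewrite -bigcup_seq /= => -[i /= _ [B mB <-]].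
rewrite setTI.
pose T := g_sigma_algebraType (@open E).
pose f : T -> R := fun x : E => x ord0 i.
suff mf : measurable_fun [set: T] f by have := mf measurableT B mB; rewrite setTI.
apply: (measurability _ (RGenOInfty.measurableE R)) => //.
move=> _ [_ [a ->] <-]; rewrite setTI.
apply: sub_sigma_algebra.
have /continuousP : continuous (fun x : E => x ord0 i) by exact: coord_continuous.
apply; rewrite set_itvE; exact: open_gt.
Qed.

Lemma rV_ball_set0 (x : E) r : r <= 0 -> ball x r = set0.
Proof.
move=> r0; apply/seteqP; split => // y; rewrite -ball_normE /=.
by move=> /(le_lt_trans (normr_ge0 _)); rewrite ltNge r0.
Qed.

Lemma rV_ball_measurable (x : E) r : measurable (ball x r).
Proof.
have [r0|r0] := leP r 0; first by rewrite rV_ball_set0.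
by apply: rV_open_measurable; exact: ball_open.
Qed.

Lemma lebesgue_rV_ball_lty (x : E) r : (lebesgue_rV n (ball x r) < +oo)%E.
Proof.
have [r0|r0] := leP r 0; first by rewrite rV_ball_set0 ?measure0.
pose a : E := \row_i (x ord0 i - r); pose b : E := \row_i (x ord0 i + r).
have ab i : a ord0 i <= b ord0 i by rewrite !mxE lerD2l; lra.
apply: (@le_lt_trans _ _ (lebesgue_rV n [set x | forall i, x ord0 i \in `]a ord0 i, b ord0 i]])); last by rewrite lebesgue_rV_box // ltry.
apply: le_measure; rewrite ?inE.
- exact: rV_ball_measurable.
- rewrite [X in measurable X](_ : _ = \bigcap_(i in [set: 'I_n]) ((fun x : E => x ord0 i) @^-1` `]a ord0 i, b ord0 i]%classic)).
    apply: fin_bigcap_measurable => // i _.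
    by rewrite -[X in measurable X]setTI; exact: measurable_coor.
  by apply/seteqP; split => y /= h i; [move=> _; exact: h | exact: (h i I)].
- move=> y /(ball_rVP _ _ r0) h i; have := h i; rewrite !mxE in_itv /= ltr_distlC.
  by move=> /andP[-> /ltW ->].
Qed.

Lemma lebesgue_rV_bounded_lty A : bounded_set A -> measurable A ->
  (lebesgue_rV n A < +oo)%E.
Proof.
move=> [M [Mr hM]] mA.
(* [bounded_set] gives a bound only for numbers above [M], hence [M + 1]; the open ball needs a
   strict inequality, hence [M + 2]. *)
apply: le_lt_trans (lebesgue_rV_ball_lty 0 (M + 2)).
apply: le_measure; rewrite ?inE //; first exact: rV_ball_measurable.
move=> y Ay; rewrite -ball_normE /= sub0r normrN.
by rewrite (@le_lt_trans _ _ (M + 1)) // ?hM // ?ltrDl // ltrD2l; lra.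
Qed.

Lemma lebesgue_rV_compact_lty A : compact A -> (lebesgue_rV n A < +oo)%E.
Proof.
by move=> cA; apply: lebesgue_rV_bounded_lty; [exact: compact_bounded|exact: rV_compact_measurable].
Qed.

End rV_topology.

(** * Continuity of translations in L^1 *)

Import HBSimple.

Section translation_continuity.
Context {R : realType} {n : nat}.
Local Notation E := 'rV[R]_n.
Local Notation mu := (@lebesgue_rV R n).
Implicit Types (f g : E -> R) (U Q A : set E).

Definition L1_dist f g : \bar R := (\int[mu]_x `|f x - g x|%:E)%E.

Definition translation_continuous f : Prop :=
  forall e : R, 0 < e -> exists2 d : R, 0 < d & forall h : E, `|h| < d ->
    (L1_dist (fun x => (f (x + h))%R) f <= e%:E)%E.

Lemma measurable_fun_translate f (h : E) :
  measurable_fun setT f -> measurable_fun setT (fun x : E => f (x + h)).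
Proof.
by move=> mf; apply: (measurableT_comp mf); exact: measurable_fun_addrV.
Qed.

Lemma measurable_dist f g : measurable_fun setT f -> measurable_fun setT g ->
  measurable_fun setT (fun x => `|f x - g x|%:E).
Proof.
move=> mf mg; apply/measurable_EFinP.
by apply: measurableT_comp => //; exact: measurable_funB.
Qed.

Lemma L1_dist_triangle f g k : measurable_fun setT f -> measurable_fun setT g ->
  measurable_fun setT k -> (L1_dist f k <= L1_dist f g + L1_dist g k)%E.
Proof.
move=> mf mg mk; rewrite /L1_dist -ge0_integralD //; do ?exact: measurable_dist.
apply: ge0_le_integral => //; first exact: measurable_dist.
  by apply: emeasurable_funD; exact: measurable_dist.
by move=> x _; rewrite -EFinD lee_fin ler_distD.
Qed.

Lemma L1_distC f g : L1_dist f g = L1_dist g f.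
Proof. by apply: eq_integral => x _; rewrite distrC. Qed.

Lemma L1_dist_translate f g (h : E) : measurable_fun setT f -> measurable_fun setT g ->
  L1_dist (fun x => (f (x + h))%R) (fun x => (g (x + h))%R) = L1_dist f g.
Proof.
move=> mf mg; rewrite /L1_dist.
rewrite -(@ge0_integral_translate _ _ h (fun x => `|f x - g x|%:E)) //.
exact: measurable_dist.
Qed.

(** An [e / 3] argument: translations are isometries for [L1_dist], so the property passes to limits
    in mean. *)
Lemma translation_continuous_closed f : measurable_fun setT f ->
  (forall e : R, 0 < e -> exists g, [/\ measurable_fun setT g,
     translation_continuous g & (L1_dist f g <= e%:E)%E]) ->
  translation_continuous f.
Proof.
move=> mf H e e0.
have e3 : 0 < e / 3 by rewrite divr_gt0.
have [g [mg tg fg]] := H _ e3; have [d d0 hd] := tg _ e3; exists d => // h hh.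
have mfh := measurable_fun_translate h mf.
have mgh := measurable_fun_translate h mg.
rewrite (le_trans (L1_dist_triangle mfh mgh mf)) // L1_dist_translate //.
rewrite (_ : e%:E = (e / 3)%:E + ((e / 3)%:E + (e / 3)%:E))%E; last first.
  by rewrite -!EFinD; congr (_%:E); field.
apply: leeD => //; rewrite (le_trans (L1_dist_triangle mgh mg mf)) //.
by apply: leeD; [exact: hd | rewrite L1_distC].
Qed.

Lemma translation_continuousD f g : measurable_fun setT f -> measurable_fun setT g ->
  translation_continuous f -> translation_continuous g ->
  translation_continuous (fun x : E => f x + g x).
Proof.
move=> mf mg tf tg e e0; have e2 : 0 < e / 2 by rewrite divr_gt0.
have [d d0 fd] := tf _ e2; have [d' d'0 gd] := tg _ e2.
exists (Num.min d d'); first by rewrite lt_min d0.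
move=> h; rewrite lt_min => /andP[hd hd'].
rewrite (splitr e) EFinD (le_trans _ (leeD (fd _ hd) (gd _ hd'))) //.
have mfh := measurable_fun_translate h mf.
have mgh := measurable_fun_translate h mg.
rewrite /L1_dist -ge0_integralD //; do ?exact: measurable_dist.
apply: ge0_le_integral => //.
- by apply: measurable_dist; exact: measurable_funD.
- by apply: emeasurable_funD; exact: measurable_dist.
- by move=> x _; rewrite -EFinD lee_fin opprD addrACA ler_normD.
Qed.

Lemma translation_continuousZ (c : R) f : measurable_fun setT f ->
  translation_continuous f -> translation_continuous (fun x : E => c * f x).
Proof.
move=> mf tf e e0; have c0 : 0 < `|c| + 1 by rewrite ltr_pwDr.
have [d d0 fd] := tf _ (divr_gt0 e0 c0); exists d => // h hd.
have mfh := measurable_fun_translate h mf.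
have := fd _ hd => /(@lee_wpmul2l _ (`|c| + 1)%:E).
rewrite -EFinM mulrC divfK ?gt_eqF // => /(_ _)/(le_trans _); apply; last by rewrite lee_fin ltW.
rewrite /L1_dist -ge0_integralZl //; last exact: measurable_dist.
apply: ge0_le_integral => //.
- by apply: measurable_dist; exact: measurable_funM.
- by apply: emeasurable_funM => //; exact: measurable_dist.
- move=> x _; rewrite -EFinM lee_fin -mulrBr normrM ler_wpM2r // lerDl //.
Qed.

Lemma translation_continuousB f g : measurable_fun setT f -> measurable_fun setT g ->
  translation_continuous f -> translation_continuous g ->
  translation_continuous (fun x : E => f x - g x).
Proof.
move=> mf mg tf tg; under eq_fun do rewrite -[- g _]mulN1r.
apply: translation_continuousD => //; first exact: measurable_funM.
exact: translation_continuousZ.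
Qed.

(** A shift shorter than [1 / (k + 1)] can change the indicator only if [x] or its translate lies in
    [U] at distance less than [1 / (k + 1)] from the complement. These layers [U \ V k] decrease to
    the empty set because [U] is open, so their measure tends to 0. *)
Lemma translation_continuous_open U : open U -> (mu U < +oo)%E ->
  translation_continuous (\1_U).
Proof.
move=> oU Ufin e e0.
pose V k : set E := ~` \bigcup_(y in ~` U) ball y k.+1%:R^-1.
have oC k : open (\bigcup_(y in ~` U) ball y (k.+1%:R^-1 : R)).
  by apply: bigcup_open => y _; apply: ball_open; rewrite invr_gt0 ltr0n.
have mUV k : measurable (U `\` V k).
  apply: measurableD; first exact: rV_open_measurable.
  by apply: measurableC; exact: rV_open_measurable.
have cvg0 : (mu \o (fun k => U `\` V k)) k @[k --> \oo] --> mu (\bigcap_k (U `\` V k)).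
  apply: nonincreasing_cvg_mu => //.
  - apply: le_lt_trans Ufin; apply: le_measure; rewrite ?inE //.
    exact: rV_open_measurable.
  - exact: bigcap_measurable.
  - move=> i j ij; apply/subsetPset => x [Ux nVj]; split => // Vi; apply: nVj.
    move=> [y nUy yx]; apply: Vi; exists y => //; apply: le_ball yx.
    by rewrite lef_pV2 ?posrE ?ltr0n // ler_nat ltnS.
have V0 : \bigcap_k (U `\` V k) = set0.
  apply/seteqP; split => // x h.
  have [Ux _] := h 0%N I.
  have /nbhs_ballP[r /= r0 rU] : nbhs x U by exact: open_nbhs_nbhs.
  have [k kr] : exists k : nat, k.+1%:R^-1 < r.
    exists (Num.truncn r^-1).
    by rewrite -[ltRHS]invrK ltf_pV2 ?posrE ?ltr0n ?invr_gt0 // truncnS_gt.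
  have [_] := h k I; apply => -[y nUy yx]; apply: nUy; apply: rU.
  by apply: ball_sym; apply: le_ball yx; exact: ltW.
rewrite V0 measure0 in cvg0.
have e2 : 0 < e / 2 by rewrite divr_gt0.
have [k _ hk] : \forall k \near \oo, (mu (U `\` V k) < (e / 2)%:E)%E.
  by apply: (cvg0 [set x | (x < (e / 2)%:E)%E]); apply: open_nbhs_nbhs; split; [exact: open_ereal_lt_ereal | rewrite /= lte_fin].
exists (k.+1%:R^-1); first by rewrite invr_gt0 ltr0n.
move=> h hh; have {}hk := hk k (leqnn k).
pose W := U `\` V k.
have mW : measurable_fun setT (\1_W : E -> R) by apply: measurable_indic; exact: mUV.
have mU : measurable_fun setT (\1_U : E -> R).
  by apply: measurable_indic; exact: rV_open_measurable.
have key x : `|\1_U (x + h) - \1_U x| <= \1_W (x + h) + \1_W x :> R.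
  rewrite !indicE; case: (boolP (x + h \in U)) => [|]; rewrite ?inE => Uxh;
    case: (boolP (x \in U)) => [|]; rewrite ?inE => Ux.
  - by rewrite subrr normr0 addr_ge0.
  - rewrite subr0 normr1 (_ : (x + h \in W) = true) ?lerDl //.
    apply/mem_set; split => //; apply; exists x => //.
      by move: Ux; rewrite notin_setE.
    by rewrite -ball_normE /= opprD addrA subrr sub0r normrN.
  - rewrite sub0r normrN normr1 (_ : (x \in W) = true) ?lerDr //.
    apply/mem_set; split => //; apply; exists (x + h).
      by move: Uxh; rewrite notin_setE.
    by rewrite -ball_normE /= addrC addKr.
  - by rewrite subrr normr0 addr_ge0.
apply: (@le_trans _ _ (\int[mu]_x ((\1_W (x + h)%R)%:E + (\1_W x)%:E))%E).
  apply: ge0_le_integral => //.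
  - by apply: measurable_dist => //; exact: measurable_fun_translate.
  - apply: emeasurable_funD; apply/measurable_EFinP => //; exact: measurable_fun_translate.
  - by move=> x _; rewrite lee_fin.
have mWE : measurable_fun setT (EFin \o (\1_W : E -> R)) by exact/measurable_EFinP.
rewrite ge0_integralD //; last by apply/measurable_EFinP; exact: measurable_fun_translate.
rewrite (@ge0_integral_translate _ _ h (EFin \o \1_W)) //=.
rewrite integral_indic //; last exact: mUV.
by rewrite setIT (splitr e) EFinD; apply: leeD; exact: ltW.
Qed.

(** Dynkin induction on [A]. Intersecting with [Q] keeps all measures finite, so that complements
    become differences of indicators, and countable disjoint unions become L^1 limits of finite
    ones. *)
Lemma translation_continuous_indic Q A : open Q -> (mu Q < +oo)%E ->
  measurable A -> translation_continuous (\1_(A `&` Q)).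
Proof.
move=> oQ Qfin; rewrite [X in X A]rV_measurable_open.
have mQ := rV_open_measurable oQ.
have mi B : measurable B -> measurable_fun setT (\1_(B `&` Q) : E -> R).
  by move=> mB; apply: measurable_indic; exact: measurableI.
move: A; apply: (dynkin_induction rV_measurable_open) => //.
- by move=> A B oA oB; exact: openI.
- by rewrite setTI; exact: translation_continuous_open.
- move=> A oA; apply: translation_continuous_open; first exact: openI.
  apply: le_lt_trans Qfin; apply: le_measure; rewrite ?inE //.
  by apply: measurableI => //; exact: rV_open_measurable.
- move=> A mA tA.
  rewrite (_ : \1_(~` A `&` Q) = fun x : E => \1_Q x - \1_(A `&` Q) x :> R); last first.
    apply/funext => x; rewrite !indicE !in_setI in_setC.
    by case: (x \in A); case: (x \in Q); rewrite /= ?subrr ?subr0.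
  apply: translation_continuousB.
  + exact: measurable_indic.
  + exact: mi.
  + exact: translation_continuous_open.
  + exact: tA.
- move=> F mF tF PF.
  have mbF : measurable (\bigcup_k F k) by exact: bigcupT_measurable.
  apply: translation_continuous_closed; first exact: mi.
  move=> e e0.
  pose A k := \bigcup_(i in `I_k) F i.
  have mA k : measurable (A k) by exact: bigcup_measurable.
  have tA k : translation_continuous (\1_(A k `&` Q)).
    elim: k => [|k IHk].
      rewrite /A II0 bigcup_set0 set0I => d d0; exists d => // h _.
      by rewrite /L1_dist integral0_eq ?lee_fin ?ltW // => x _; rewrite !indicE !in_set0 subrr normr0.
    rewrite (_ : \1_(A k.+1 `&` Q) = fun x : E => \1_(A k `&` Q) x + \1_(F k `&` Q) x :> R).
      by apply: translation_continuousD => //; exact: mi.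
    apply/funext => x.
    have AS : A k.+1 = A k `|` F k by rewrite /A IIS bigcup_setU bigcup_set1.
    have Ak : x \in A k -> x \in F k -> False.
      rewrite !inE => -[i /= ik Fi] Fk.
      have := tF i k I I; move=> /(_ (ex_intro _ x (conj Fi Fk))) ik'.
      by rewrite ik' ltnn in ik.
    rewrite !indicE !in_setI AS in_setU; move: Ak.
    by case: (x \in A k); case: (x \in F k) => //=; do ?[by move=> /(_ isT isT)];
      case: (x \in Q) => //= _; rewrite ?addr0 ?add0r.
  (* [D k] is the part of the union not yet reached by the first [k] sets; its measure is the L^1
     error of the finite union. *)
  pose D k := (\bigcup_k F k `&` Q) `\` A k.
  have mD k : measurable (D k) by apply: measurableD => //; exact: measurableI.
  have cvg0 : (mu \o D) k @[k --> \oo] --> mu (\bigcap_k D k).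
    apply: nonincreasing_cvg_mu => //.
    - apply: le_lt_trans Qfin; apply: le_measure; rewrite ?inE //.
      by move=> x [[]].
    - exact: bigcap_measurable.
    - move=> i j ij; apply/subsetPset => x [Ux nA]; split => // -[l /= li Fl].
      by apply: nA; exists l => //=; exact: leq_trans ij.
  have D0 : \bigcap_k D k = set0.
    apply/seteqP; split => // x h; have [[[k _ Fk] _] _] := h 0%N I.
    by have [_] := h k.+1 I; apply; exists k => /=.
  rewrite D0 measure0 in cvg0.
  have [k _ /(_ k (leqnn k)) hk] : \forall k \near \oo, (mu (D k) < e%:E)%E.
    by apply: (cvg0 [set x | (x < e%:E)%E]); apply: open_nbhs_nbhs; split; [exact: open_ereal_lt_ereal | rewrite /= lte_fin].
  exists (\1_(A k `&` Q)); split => //; first exact: mi.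
  apply: le_trans (ltW hk).
  rewrite -[D k]setIT -integral_indic //; apply: ge0_le_integral => //.
  - by apply: measurable_dist; exact: mi.
  - by apply/measurable_EFinP; exact: measurable_indic.
  - move=> x _; rewrite lee_fin !indicE /D in_setD !in_setI.
    have : x \in A k -> x \in \bigcup_k F k.
      by rewrite !inE => -[i _ Fi]; exists i.
    by case: (x \in A k); case: (x \in Q); case: (x \in \bigcup_k F k) => //=;
      rewrite ?subrr ?subr0 ?normr0 ?normr1 //; move=> /(_ isT).
Qed.

Lemma translation_continuous_integrable Q f : open Q -> (mu Q < +oo)%E ->
  mu.-integrable Q (EFin \o f) -> translation_continuous (f \_ Q).
Proof.
move=> oQ Qfin intf; have mQ := rV_open_measurable oQ.
have mr g : measurable_fun Q g -> measurable_fun setT (g \_ Q).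
  by move=> mg; apply/(measurable_restrictT _ _).1.
have mf : measurable_fun Q f by apply/measurable_EFinP; exact: measurable_int intf.
have [g [intg _ gf]] := approximation_sfun_integrable mQ intf.
apply: translation_continuous_closed; first exact: mr.
move=> e e0.
have [k _ /(_ k (leqnn k)) hk] : \forall k \near \oo, (\int[mu]_(z in Q) `|(f z)%:E - (g k z)%:E| < e%:E)%E.
  by apply: (gf [set x | (x < e%:E)%E]); apply: open_nbhs_nbhs; split; [exact: open_ereal_lt_ereal | rewrite /= lte_fin].
exists (g k \_ Q); split; first by apply: mr; exact: measurable_funTS.
- rewrite (_ : _ \_ _ = fun x => \sum_(y \in range (g k)) y * \1_((g k @^-1` [set y]) `&` Q) x); last first.
    apply/funext => x; rewrite patchE; case: ifPn => xQ.
      rewrite fimfunE; apply: eq_fsbigr => y _.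
      by rewrite !indicE in_setI xQ andbT.
    rewrite fsbig1 // => y _; rewrite indicE in_setI (negbTE xQ) andbF mulr0 //.
  have finr : finite_set (range (g k)) by exact: fimfunP.
  rewrite [X in translation_continuous X](_ : _ = fun x : E =>
    \sum_(y <- finmap.enum_fset (fset_set (range (g k)))) y * \1_((g k @^-1` [set y]) `&` Q) x); last first.
    by apply/funext => x; rewrite fsbig_finite.
  elim: (finmap.enum_fset _) => [|y l IH].
    rewrite [X in translation_continuous X](_ : _ = fun=> 0); last by apply/funext => x; rewrite big_nil.
    move=> d d0; exists d => // h _.
    by rewrite /L1_dist integral0_eq ?lee_fin ?ltW // => x _; rewrite subrr normr0.
  rewrite [X in translation_continuous X](_ : _ = fun x : E => y * \1_(g k @^-1` [set y] `&` Q) x + \sum_(z <- l) z * \1_(g k @^-1` [set z] `&` Q) x); last first.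
    by apply/funext => x; rewrite big_cons.
  have my z : measurable (g k @^-1` [set z]) by exact: measurable_sfunP.
  have mi z : measurable_fun setT (\1_(g k @^-1` [set z] `&` Q) : E -> R).
    by apply: measurable_indic; exact: measurableI.
  apply: translation_continuousD.
  + exact: measurable_funM.
  + by apply: measurable_sum => z; exact: measurable_funM.
  + by apply: translation_continuousZ => //; exact: translation_continuous_indic.
  + exact: IH.
- apply: le_trans (ltW hk); rewrite /L1_dist [leRHS]integral_mkcond.
  rewrite le_eqVlt; apply/orP; left; apply/eqP; apply: eq_integral => x _.
  by rewrite !patchE; case: ifP => _ //; rewrite subrr normr0.
Qed.

End translation_continuity.

(** * Smooth functions and cutoffs *)

Section flat_function.
Context {R : realType}.
Implicit Types (x t : R) (k : nat).

(* The exponent [k] makes the family closed under differentiation up to linear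
   combinations. *)
Definition flat k x : R := if 0 < x then x^-1 ^+ k * expR (- x^-1) else 0.

Lemma flat_gt0E k x : 0 < x -> flat k x = x^-1 ^+ k * expR (- x^-1).
Proof. by rewrite /flat => ->. Qed.

Lemma flat_le0E k x : x <= 0 -> flat k x = 0.
Proof. by rewrite /flat ltNge => ->. Qed.

Lemma flat_ge0 k x : 0 <= flat k x.
Proof.
rewrite /flat; case: ifP => // x0.
by rewrite mulr_ge0 ?expR_ge0 // exprn_ge0 // invr_ge0 ltW.
Qed.

Lemma flat_gt0 k x : 0 < x -> 0 < flat k x.
Proof. by move=> x0; rewrite flat_gt0E // mulr_gt0 ?expR_gt0 // exprn_gt0 // invr_gt0. Qed.

Lemma flat0_le1 x : flat 0 x <= 1.
Proof.
rewrite /flat; case: ifP => // x0; rewrite expr0 mul1r expR_le1 oppr_le0.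
by rewrite invr_ge0 ltW.
Qed.

Lemma expR_ge_pow (m : nat) t : 0 <= t -> (t / m.+1%:R) ^+ m.+1 <= expR t.
Proof.
move=> t0; rewrite -[in leRHS](@divfK _ m.+1%:R _ t) ?pnatr_eq0 // expRM_natr.
rewrite lerXn2r ?nnegrE ?expR_ge0 ?divr_ge0 //.
by apply: le_trans (expR_ge1Dx _); rewrite lerDr.
Qed.

(** The exponential of [1 / x] dominates the power [k + 2] of [1 / x], which leaves two powers of
    [x] to spare. A quadratic bound is all that differentiability at 0, with derivative 0,
    requires. *)
Lemma flat_le_sqr k x : flat k x <= k.+2%:R ^+ k.+2 * x ^+ 2.
Proof.
rewrite /flat; case: ifP => x0; last by apply: mulr_ge0; [exact: exprn_ge0|exact: sqr_ge0].
have xi : 0 <= x^-1 by rewrite invr_ge0 ltW.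
have := expR_ge_pow k.+1 xi => h.
rewrite expRN ler_pdivrMr ?expR_gt0 //.
apply: (@le_trans _ _ (k.+2%:R ^+ k.+2 * x ^+ 2 * (x^-1 / k.+2%:R) ^+ k.+2)); last first.
  by rewrite ler_wpM2l //; apply: mulr_ge0; [exact: exprn_ge0|exact: sqr_ge0].
have xn0 : x != 0 by rewrite gt_eqF.
have kn0 : k.+2%:R != 0 :> R by rewrite pnatr_eq0.
rewrite (_ : _ * _ * _ = x^-1 ^+ k) // expr_div_n mulrA mulrAC.
rewrite (mulrC (_ ^+ _)) mulfK ?expf_neq0 // -[in LHS](addn2 k) exprD.
by rewrite mulrC -mulrA -exprMn mulVf // expr1n mulr1.
Qed.

Lemma is_derive0_sqr (f : R -> R) (C : R) : (forall h, `|f h| <= C * h ^+ 2) ->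
  is_derive (0 : R) 1 f 0.
Proof.
move=> fC.
have f0 : f 0 = 0.
  by apply/eqP; rewrite -normr_eq0 eq_le normr_ge0 andbT (le_trans (fC _)) // expr0n mulr0.
have C0 : 0 <= C by have := fC 1; rewrite expr1n mulr1; apply: le_trans.
have cv : h^-1 *: ((f \o shift 0) (h *: (1 : R)) - f 0) @[h --> 0^'] --> (0 : R).
  apply/cvgrPdist_le => e e0.
  near=> h.
  have hn0 : h != 0 by near: h; exact: nbhs_dnbhs_neq.
  rewrite sub0r normrN f0 subr0 /= addr0 [h *: 1]mulr1 /GRing.scale /= normrM normfV.
  rewrite ler_pdivrMl ?normr_gt0 // (le_trans (fC _)) //.
  rewrite -real_normK ?num_real // expr2 mulrA [leRHS]mulrC ler_wpM2r //.
  apply: (@le_trans _ _ ((C + 1) * `|h|)); first by rewrite ler_wpM2r // lerDl.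
  rewrite -ler_pdivlMl ?ltr_pwDr //.
  near: h; apply: dnbhs0_le; rewrite mulr_gt0 // invr_gt0 ltr_pwDr //.
by apply: DeriveDef; [apply/cvg_ex; exists 0 | exact: cvg_lim cv].
Unshelve. all: by end_near. Qed.

Lemma is_derive_flat k x :
  is_derive x 1 (flat k) (flat k.+2 x - k%:R * flat k.+1 x).
Proof.
have [x0|x0|<-] := ltgtP 0 x.
- pose g (y : R) := y^-1.
  have dg : is_derive x 1 g (- x ^- 2).
    apply: DeriveDef.
      by apply: (@derivableV _ _ id) => //; rewrite gt_eqF.
    by rewrite (@deriveV _ _ id) ?gt_eqF // derive_id /GRing.scale /= mulr1.
  have de : is_derive x 1 (expR \o (- g)) (expR (- g x) * x ^- 2).
    by apply: is_derive1_comp; apply: is_derive_eq (is_deriveN dg) _; rewrite opprK.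
  apply: (@near_eq_is_derive _ _ _ ((g ^+ k) * (expR \o (- g)))).
    near=> y; rewrite flat_gt0E /=; last by near: y; exact: lt_nbhsr.
    by rewrite /GRing.mul /= /g exprfctE.
  apply: is_derive_eq (is_deriveM (is_deriveX k dg) de) _.
  rewrite /GRing.scale /= exprfctE !flat_gt0E // /g.
  case: k => [|k]; first by rewrite !expr0 -exprVn; ring.
  by rewrite -exprVn !exprS /=; ring.
- rewrite !flat_le0E ?(ltW x0) // mulr0 subr0.
  apply: (@near_eq_is_derive _ _ _ (cst 0)).
    near=> y; rewrite flat_le0E //=; apply: ltW; near: y.
    exact: lt_nbhsl.
- rewrite !flat_le0E // mulr0 subr0.
  apply: (@is_derive0_sqr _ (k.+2%:R ^+ k.+2)) => h.
  by rewrite ger0_norm ?flat_ge0 // flat_le_sqr.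
Unshelve. all: by end_near. Qed.

Lemma continuous_flat k : continuous (flat k).
Proof.
move=> x; apply: differentiable_continuous; apply/derivable1_diffP.
by have [] := is_derive_flat k x.
Qed.

(** [flat 2] is the derivative of [flat 0], so 4 is a Lipschitz constant of [flat 0]. It comes from
    [(t / 2)^2 <= exp t] at [t = 1 / x]. *)
Lemma flat2_le4 x : flat 2 x <= 4.
Proof.
rewrite /flat; case: ifP => x0 //.
have xi : 0 <= x^-1 by rewrite invr_ge0 ltW.
rewrite expRN ler_pdivrMr ?expR_gt0 //.
by have := expR_ge_pow 1 xi; rewrite expr_div_n ler_pdivrMr ?exprn_gt0 // -natrX mulrC.
Qed.

Lemma flat0_homo : {homo flat 0 : x y / x <= y}.
Proof.
move=> x y xy; rewrite /flat; case: ifP => x0; last by case: ifP => // _; rewrite expr0 mul1r expR_ge0.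
have y0 := lt_le_trans x0 xy; rewrite y0 !expr0 !mul1r ler_expR lerN2.
by rewrite lef_pV2 // posrE.
Qed.

End flat_function.

Section smooth_functions.
Context {R : realType} {N : nat}.
Local Notation E := 'rV[R]_N.
Implicit Types (f g : E -> R) (x : E) (i : 'I_N).

Lemma foldr_partial_rcons i f (s : seq 'I_N) :
  foldr partial (partial i f) s = foldr partial f (rcons s i).
Proof. by rewrite foldr_rcons. Qed.

Lemma smooth_continuous f : smooth f -> continuous f.
Proof. by move=> /(_ [::])[]. Qed.

Lemma smooth_derivable f i x : smooth f -> derivable f x (Defs.basis i).
Proof. by move=> /(_ [::])[_]; exact. Qed.

Lemma smooth_partial f i : smooth f -> smooth (partial i f).
Proof. by move=> sf s; rewrite foldr_partial_rcons; exact: sf. Qed.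

(* The closure of a class of functions under sums and products is made of
   smooth functions as soon as it contains the partial derivatives of the
   members of the class. *)
Inductive alg_closure (C : (E -> R) -> Prop) : (E -> R) -> Prop :=
| alg_gen f : C f -> alg_closure C f
| algD f g : alg_closure C f -> alg_closure C g -> alg_closure C (f + g)
| algM f g : alg_closure C f -> alg_closure C g -> alg_closure C (f * g).

Lemma smooth_alg (C : (E -> R) -> Prop) :
  (forall f, C f -> continuous f /\ forall i,
    (forall x, derivable f x (Defs.basis i)) /\ alg_closure C (partial i f)) ->
  forall f, alg_closure C f -> smooth f.
Proof.
move=> HC.
have step f : alg_closure C f -> continuous f /\ forall i,
    (forall x, derivable f x (Defs.basis i)) /\ alg_closure C (partial i f).
  elim => {f} [f|f g af [cf df] ag [cg dg]|f g af [cf df] ag [cg dg]].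
  - exact: HC.
  - split => [x|i]; first by apply: continuousD; [exact: cf|exact: cg].
    have [dfi afi] := df i; have [dgi agi] := dg i.
    split=> [x|]; first exact: derivableD.
    rewrite (_ : partial i _ = partial i f + partial i g); first exact: algD.
    by apply/funext => x; rewrite /partial deriveD.
  - split => [x|i]; first by apply: continuousM; [exact: cf|exact: cg].
    have [dfi afi] := df i; have [dgi agi] := dg i.
    split=> [x|]; first exact: derivableM.
    rewrite (_ : partial i _ = f * partial i g + g * partial i f).
      by apply: algD; exact: algM.
    by apply/funext => x; rewrite /partial deriveM.
move=> f af s.
have {af} : alg_closure C (foldr partial f s).
  by elim: s => //= i s /step[_ /(_ i)[]].
by move=> /step[cf df]; split => // i x; have [] := df i.
Qed.

Lemma smooth_gen f : smooth f -> continuous f /\ forall i,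
    (forall x, derivable f x (Defs.basis i)) /\ alg_closure smooth (partial i f).
Proof.
move=> sf; split; first exact: smooth_continuous.
move=> i; split; first by move=> x; exact: smooth_derivable.
by apply: alg_gen; exact: smooth_partial.
Qed.

Lemma smoothD f g : smooth f -> smooth g -> smooth (f + g).
Proof. by move=> sf sg; apply: (smooth_alg smooth_gen); apply: algD; exact: alg_gen. Qed.

Lemma smoothM f g : smooth f -> smooth g -> smooth (f * g).
Proof. by move=> sf sg; apply: (smooth_alg smooth_gen); apply: algM; exact: alg_gen. Qed.

Lemma smooth_cst (c : R) : smooth (cst c : E -> R).
Proof.
suff H s : exists c', foldr partial (cst c : E -> R) s = cst c'.
  move=> s; have [c' ->] := H s; split=> [x|i x]; first exact: cst_continuous.
  exact: derivable_cst.
elim: s => [|i s [c' /= ->]]; first by exists c.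
by exists 0; apply/funext => x; rewrite /partial derive_cst.
Qed.

Lemma smoothN f : smooth f -> smooth (- f).
Proof.
move=> sf; rewrite (_ : - f = cst (-1) * f); last by apply/funext => x; rewrite /GRing.opp /GRing.mul /= mulN1r.
by apply: smoothM => //; exact: smooth_cst.
Qed.

Lemma smooth_coor j : smooth (fun x : E => x ord0 j).
Proof.
pose C (f : E -> R) := f = (fun x => x ord0 j) \/ exists c, f = cst c.
have D x i : is_derive x (Defs.basis i) (fun x : E => x ord0 j) ((i == j)%:R : R).
  apply: DeriveDef.
    by apply: diff_derivable; exact: differentiable_coord.
  rewrite deriveE; last exact: differentiable_coord.
  have l : linear (fun x : E => x ord0 j : R) by move=> a u v; rewrite !mxE.
  pose L := GRing.isLinear.Build _ _ _ _ _ l.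
  pose F : {linear E -> R} := HB.pack (fun x : E => x ord0 j : R) L.
  rewrite (@diff_lin _ _ _ F) /=; last exact: coord_continuous.
  by rewrite /Defs.basis mxE eqxx eq_sym.
apply: (@smooth_alg C); last by apply: alg_gen; left.
move=> f [->|[c ->]].
- split => [|i]; first exact: coord_continuous.
  split=> [x|]; first by have [] := D x i.
  apply: alg_gen; right; exists (i == j)%:R; apply/funext => x.
  by rewrite /partial; have [_ ->] := D x i.
- split => [|i]; first by move=> x; exact: cst_continuous.
  split => [x|]; first exact: derivable_cst.
  by apply: alg_gen; right; exists 0; apply/funext => x; rewrite /partial derive_cst.
Qed.

(** Only the derivative of [f] in the direction [v] is assumed to exist, so the chain rule is
    applied to the restriction of [f] to the line through [x]. *)
Lemma is_derive_comp1 (g : R -> R) f x v (dg df : R) :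
  is_derive (f x) 1 g dg -> is_derive x v f df -> is_derive x v (g \o f) (dg * df).
Proof.
move=> Dg [df1 df2].
pose F h := f (h *: v + x).
have eD (k : E -> R) : 'D_v k x = 'D_1 (fun h : R => k (h *: v + x)) 0.
  rewrite /derive; apply: (f_equal (fun F : R -> R => lim (F t @[t --> 0^']))); apply/funext => h /=.
  by rewrite addr0 scale0r add0r [h *: 1]mulr1.
have DF : is_derive (0 : R) 1 F df.
  by apply: DeriveDef; [exact: (derivable1P _ _ _).1 | rewrite /F -eD].
have Dc : is_derive (0 : R) 1 (g \o F) (dg * df).
  by apply: is_derive1_comp; rewrite /F scale0r add0r.
have [d1 d2] := Dc; apply: DeriveDef; first exact/derivable1P.
by rewrite eD.
Qed.

Lemma partial_flat k f i x : smooth f -> partial i (flat k \o f) x =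
  (flat k.+2 (f x) - k%:R * flat k.+1 (f x)) * partial i f x.
Proof.
move=> sf; rewrite /partial; have [_ ->//] := is_derive_comp1 (is_derive_flat k (f x)) (derivableP (smooth_derivable (i := i) (x := x) sf)).
Qed.

Lemma smooth_flat k f : smooth f -> smooth (flat k \o f).
Proof.
move=> sf.
(* One derivative of [flat k \o f] involves the indices [k + 1] and [k + 2] and the smooth factor
   [partial i f], so the class must contain all indices and all smooth functions. *)
pose C (h : E -> R) := smooth h \/ exists k, h = flat k \o f.
apply: (@smooth_alg C); last by apply: alg_gen; right; exists k.
move=> h [sh|[{}k ->]].
  split; first exact: smooth_continuous.
  move=> i; split; first by move=> x; exact: smooth_derivable.
  by apply: alg_gen; left; exact: smooth_partial.
split => [x|i].
  apply: continuous_comp; [exact: smooth_continuous|exact: continuous_flat].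
split => [x|].
  by have [] := is_derive_comp1 (is_derive_flat k (f x)) (derivableP (smooth_derivable (i := i) (x := x) sf)).
rewrite (_ : partial i _ = (flat k.+2 \o f + cst (- k%:R) * (flat k.+1 \o f)) * partial i f).
  apply: algM; last by apply: alg_gen; left; exact: smooth_partial.
  apply: algD; first by apply: alg_gen; right; exists k.+2.
  by apply: algM; [apply: alg_gen; left; exact: smooth_cst|apply: alg_gen; right; exists k.+1].
by apply/funext => x; rewrite partial_flat // /GRing.mul /GRing.add /= mulNr.
Qed.

Lemma smooth_prod (I : Type) (s : seq I) (F : I -> E -> R) :
  (forall j, smooth (F j)) -> smooth (fun x => \prod_(j <- s) F j x).
Proof.
move=> sF; elim: s => [|j s IH].
  by under eq_fun do rewrite big_nil; exact: smooth_cst.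
by under eq_fun do rewrite big_cons; exact: smoothM.
Qed.

Lemma partialM f g i x : smooth f -> smooth g ->
  partial i (f * g) x = f x * partial i g x + g x * partial i f x.
Proof. by move=> sf sg; rewrite /partial deriveM //; exact: smooth_derivable. Qed.

Lemma partial_near_eq f g i x : (\near x, f x = g x) -> partial i f x = partial i g x.
Proof. by move=> fg; rewrite /partial; exact: near_eq_derive. Qed.

Lemma partial_translate f i (h x : E) :
  partial i (fun y => f (y + h)) x = partial i f (x + h).
Proof.
rewrite /partial /derive; apply: (f_equal (fun F : R -> R => lim (F t @[t --> 0^']))); apply/funext => t /=.
by rewrite addrA.
Qed.

Lemma smooth_translate f (h : E) : smooth f -> smooth (fun y => f (y + h)).
Proof.
pose C (k : E -> R) := exists2 f, smooth f & k = (fun y => f (y + h)).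
move=> sf; apply: (@smooth_alg C); last by apply: alg_gen; exists f.
move=> _ [{sf}f sf ->]; split=> [x|i].
  apply: continuous_comp; last exact: smooth_continuous.
  by apply: (@continuousD _ _ _ id (cst h)); [exact: cvg_id|exact: cst_continuous].
split => [x|].
  have := smooth_derivable (i := i) (x := x + h) sf; rewrite /derivable.
  by under eq_fun do rewrite /= addrA.
apply: alg_gen; exists (partial i f); first exact: smooth_partial.
by apply/funext => x; rewrite partial_translate.
Qed.

(** The factors of index [i] are both positive exactly when the [i]-th coordinate is at distance
    less than [r] from that of [x0]; a product over coordinates thus fits the balls of the maximum
    norm. *)
Definition bump (x0 : E) (r : R) : E -> R :=
  fun x => \prod_(i < N) (flat 0 (r - (x ord0 i - x0 ord0 i)) * flat 0 (r + (x ord0 i - x0 ord0 i))).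

Lemma smooth_bump x0 r : smooth (bump x0 r).
Proof.
apply: smooth_prod => i.
have sx : smooth (fun x : E => x ord0 i - x0 ord0 i).
  by apply: smoothD; [exact: smooth_coor|exact: smooth_cst].
apply: smoothM.
  by apply: (@smooth_flat 0 (fun x : E => r - (x ord0 i - x0 ord0 i))); apply: smoothD; [exact: smooth_cst|exact: smoothN].
by apply: (@smooth_flat 0 (fun x : E => r + (x ord0 i - x0 ord0 i))); apply: smoothD => //; exact: smooth_cst.
Qed.

Lemma bump_ge0 x0 r x : 0 <= bump x0 r x.
Proof. by apply: prodr_ge0 => i _; rewrite mulr_ge0 // flat_ge0. Qed.

Lemma bump_le1 x0 r x : bump x0 r x <= 1.
Proof.
apply: prodr_ile1 => i _.
by rewrite mulr_ge0 ?flat_ge0 // mulr_ile1 ?flat_ge0 ?flat0_le1.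
Qed.

Lemma bump_ge (x0 : E) (r : R) x : 0 < r -> ball x0 (r / 2) x ->
  (flat 0 (r / 2) ^+ 2) ^+ N <= bump x0 r x.
Proof.
move=> r0 /(ball_rVP _ _ (divr_gt0 r0 (ltr0Sn _ 1))) xr.
rewrite -[in leLHS](card_ord N) -prodr_const; apply: ler_prod => i _.
rewrite exprn_ge0 ?flat_ge0 //= expr2.
have := xr i; rewrite ltr_norml => /andP[h1 h2].
by apply: ler_pM; rewrite ?flat_ge0 //; apply: flat0_homo; lra.
Qed.

Lemma bump_out x0 r x : 0 < r -> ~ ball x0 r x -> bump x0 r x = 0.
Proof.
move=> r0 nb; apply/eqP/negPn/negP => b0; apply: nb.
apply/ball_rVP => // i.
have : flat 0 (r - (x ord0 i - x0 ord0 i)) * flat 0 (r + (x ord0 i - x0 ord0 i)) != 0.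
  by apply: contra b0 => /eqP b0; rewrite /bump (bigD1 i) //= b0 mul0r.
rewrite mulf_eq0 negb_or => /andP[h1 h2].
have k1 : 0 < r - (x ord0 i - x0 ord0 i).
  by rewrite ltNge; apply: contra h1 => h1; rewrite flat_le0E.
have k2 : 0 < r + (x ord0 i - x0 ord0 i).
  by rewrite ltNge; apply: contra h2 => h2; rewrite flat_le0E.
by rewrite ltr_norml; apply/andP; split; lra.
Qed.

End smooth_functions.

(** * Integration by parts and mollification *)

Section bounded_support.
Context {R : realType} {N : nat}.
Local Notation E := 'rV[R]_N.
Local Notation mu := (@lebesgue_rV R N).
Implicit Types (f g : E -> R) (x : E) (i : 'I_N).

(** An explicit radius replaces compactness of the support: it survives translations and partial
    derivatives by simple enlargement. *)
Definition bounded_support f : Prop :=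
  exists2 r : R, 0 < r & forall x : E, r <= `|x| -> f x = 0.

Lemma compact_closed_ball x (r : R) : compact (closed_ball x r).
Proof.
have [r0|r0] := ltP 0 r; last by rewrite closed_ball0 //; exact: compact0.
apply: bounded_closed_compact; last exact: closed_ball_closed.
exists (`|x| + r); split; first exact: num_real.
move=> M hM y; rewrite closed_ballE // /closed_ball_ /= => xy.
rewrite (le_trans _ (ltW hM)) // -[y](subKr x) (le_trans (ler_normB _ _)) //.
by rewrite lerD2l.
Qed.

Lemma bounded_support_bounded f : continuous f -> bounded_support f ->
  exists2 M : R, 0 < M & forall x, `|f x| <= M.
Proof.
move=> cf [r r0 fr].
have /compact_bounded[M [_ HM]] : compact (f @` (closed_ball 0 r)).
  by apply: continuous_compact; [exact: continuous_subspaceT|exact: compact_closed_ball].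
exists (`|M| + 1); first by rewrite ltr_pwDr.
move=> x; have [rx|rx] := leP r `|x|; first by rewrite fr // normr0 addr_ge0.
apply: (HM (`|M| + 1)); first by rewrite (le_lt_trans (ler_norm _)) // ltrDl.
exists x => //; rewrite closed_ballE // /closed_ball_ /= sub0r normrN; exact: ltW.
Qed.

Lemma partial_vanish f i x : (\near x, f x = 0) -> partial i f x = 0.
Proof.
move=> f0; rewrite (@partial_near_eq _ _ _ (cst 0)) //.
by rewrite /partial derive_cst.
Qed.

Lemma bounded_support_partial f i : bounded_support f -> bounded_support (partial i f).
Proof.
move=> [r r0 fr]; exists (r + 1); first by rewrite ltr_pwDr // ltW.
move=> x rx; apply: partial_vanish.
have : nbhs x (ball x 1) by exact: nbhsx_ballx.
apply: filterS => y; rewrite -ball_normE /= => xy; apply: fr.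
have := ler_distD y x 0; rewrite !subr0 => h; lra.
Qed.

Lemma bounded_supportMl f (g : E -> R) : bounded_support f -> bounded_support (f * g).
Proof.
move=> [r r0 fr]; exists r => // x h1.
by rewrite /GRing.mul /= fr // mul0r.
Qed.

Lemma bounded_supportMr f (g : E -> R) : bounded_support g -> bounded_support (f * g).
Proof. by move=> bg; rewrite mulrC; exact: bounded_supportMl. Qed.

Lemma bounded_support_translate f (h : E) : bounded_support f ->
  bounded_support (fun x => f (x + h)).
Proof.
move=> [r r0 fr]; exists (r + `|h|); first by rewrite ltr_pwDl.
move=> x rx; apply: fr.
have := ler_normB (x + h) h; rewrite addrK => h1; lra.
Qed.

Lemma bounded_support_integrable f : continuous f -> bounded_support f ->
  mu.-integrable setT (EFin \o f).
Proof.
move=> cf bf; have [M M0 fM] := bounded_support_bounded cf bf.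
have [r r0 fr] := bf.
have mb := rV_ball_measurable (0 : E) r.
have -> : EFin \o f = (EFin \o f) \_ (ball 0 r).
  apply/funext => x; rewrite patchE; case: ifPn => // /negP xr; rewrite /= fr //.
  by rewrite leNgt; apply/negP => h; apply: xr; rewrite inE -ball_normE /= sub0r normrN.
apply/(integrable_mkcond _ mb).
apply: measurable_bounded_integrable => //.
- exact: lebesgue_rV_ball_lty.
- by apply: measurable_funTS; exact: rV_continuous_measurable.
- exists M; split; first exact: num_real.
  by move=> K MK x _; exact: le_trans (fM x) (ltW MK).
Qed.

Lemma derive_line f i x (t : R) :
  'D_1 (fun t : R => f (x + t *: Defs.basis i)) t = partial i f (x + t *: Defs.basis i).
Proof.
rewrite /partial /derive; apply: (f_equal (fun F : R -> R => lim (F t @[t --> 0^']))); apply/funext => h /=.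
by rewrite [h *: 1]mulr1 scalerDl addrCA.
Qed.

Lemma derivable_line_at f i x (t : R) : derivable f (x + t *: Defs.basis i) (Defs.basis i) ->
  derivable (fun t : R => f (x + t *: Defs.basis i)) t 1.
Proof.
rewrite /derivable.
have -> // : (fun h : R => h^-1 *: (((fun t0 : R => f (x + t0 *: Defs.basis i)) \o shift t) (h *: 1) - f (x + t *: Defs.basis i)))
  = (fun h : R => h^-1 *: ((f \o shift (x + t *: Defs.basis i)) (h *: Defs.basis i) - f (x + t *: Defs.basis i))).
by apply/funext => k; rewrite /= [k *: 1]mulr1 scalerDl addrCA.
Qed.

Lemma norm_basis_le1 i : `|Defs.basis i : E| <= 1.
Proof.
rewrite /Num.norm /= mx_normrE; apply: bigmax_le => // -[a b] _ /=.
by rewrite mxE; case: (_ && _); rewrite ?normr1 ?normr0.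
Qed.

(* The integral of a translate does not depend on the translation, and its
   derivative is the integral of the partial derivative. *)
Lemma integral_partial f i : smooth f -> bounded_support f ->
  \int[mu]_x partial i f x = 0.
Proof.
move=> sf bf.
have bp := bounded_support_partial i bf.
have sp := smooth_partial i sf.
have [M M0 fM] := bounded_support_bounded (smooth_continuous sp) bp.
have [r r0 fr] := bp.
(* The parameter [t] stays in []-1, 1[] and basis vectors have norm at most 1, so all the translates
   of [partial i f] vanish outside this ball and [M * \1_B] dominates them. *)
pose B : set E := ball (0 : E) (r + 1).
have mB : measurable B by exact: rV_ball_measurable.
pose F (t : R) (y : E) := f (y + t *: Defs.basis i).
have intF t : mu.-integrable setT (EFin \o F t).
  apply: bounded_support_integrable.
    exact: (smooth_continuous (smooth_translate (t *: Defs.basis i) sf)).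
  exact: bounded_support_translate.
have H := @differentiation_under_integral R _ _ mu F setT measurableT 0 (-1) 1 _ _ _
  (fun y => M * \1_B y) _ _ _.
transitivity (\int[mu]_y partial1of2 F 0 y).
  by apply: eq_Rintegral => y _; rewrite partial1of2E /F derive_line scale0r addr0.
rewrite -H.
- have -> : (fun t => \int[mu]_y F t y) = cst (\int[mu]_y f y).
    apply/funext => t; rewrite /F Rintegral_translate //.
    exact: (rV_continuous_measurable (smooth_continuous sf)).
  by rewrite derive1_cst.
- by rewrite /= in_itv /=; apply/andP; split; lra.
- by move=> t _; exact: intF.
- move=> t y _ _; apply: derivable_line_at; exact: smooth_derivable.
- by move=> y; rewrite mulr_ge0 // ltW.
- rewrite (_ : EFin \o _ = (EFin \o cst M) \_ B); last first.
    by apply/funext => y; rewrite patchE /= indicE; case: ifP; rewrite ?mulr1 ?mulr0.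
  apply/(integrable_mkcond _ mB).
  apply: measurable_bounded_integrable => //.
    exact: lebesgue_rV_ball_lty.
  by exists M; split; [exact: num_real|move=> K MK y _ /=; rewrite ger0_norm ?ltW].
- move=> t y; rewrite /= in_itv /= => /andP[t1 t2] _.
  rewrite partial1of2E /F derive_line.
  have -> : \1_B y = ((y : E) \in B)%:R :> R by [].
  case: (boolP ((y : E) \in B)) => yB.
    by rewrite mulr1.
  rewrite fr ?normr0 ?mulr0 //.
  have : r + 1 <= `|y|.
    rewrite leNgt; apply: contra yB => yB; rewrite inE /B -ball_normE /= sub0r normrN.
    exact: yB.
  have : `|t *: (Defs.basis i : E)| <= 1.
    rewrite normrZ mulr_ile1 ?norm_basis_le1 // ler_norml; apply/andP; split; exact: ltW.
  have := ler_normB (y + t *: Defs.basis i) (t *: Defs.basis i); rewrite addrK; lra.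
Qed.

Lemma integral_by_parts f g i : smooth f -> smooth g -> bounded_support g ->
  \int[mu]_x (f x * partial i g x) = - \int[mu]_x (partial i f x * g x).
Proof.
move=> sf sg bg.
have sfg := smoothM sf sg.
have sgi := smooth_partial i sg; have sfi := smooth_partial i sf.
have I1 : mu.-integrable setT (EFin \o (f * partial i g)).
  apply: bounded_support_integrable; first exact: smooth_continuous (smoothM sf sgi).
  by apply: bounded_supportMr; exact: bounded_support_partial.
have I2 : mu.-integrable setT (EFin \o (partial i f * g)).
  apply: bounded_support_integrable; first exact: smooth_continuous (smoothM sfi sg).
  exact: bounded_supportMr.
have := integral_partial i sfg (bounded_supportMr f bg).
rewrite (_ : \int[mu]_x _ = \int[mu]_x ((f * partial i g) x + (partial i f * g) x)).
  by rewrite RintegralD // => /eqP; rewrite addr_eq0 => /eqP.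
apply: eq_Rintegral => x _; rewrite partialM // /GRing.mul /=; congr (_ + _).
exact: mulrC.
Qed.

End bounded_support.

(** * Convolution with smooth kernels *)

Section convolution.
Context {R : realType} {N : nat}.
Local Notation E := 'rV[R]_N.
Local Notation mu := (@lebesgue_rV R N).
Implicit Types (f g K : E -> R) (x : E) (i : 'I_N).

(** The kernel is reflected compared with the usual convolution: [fun y => K (y - x)] is then a
    plain translate of [K] and can serve as a test function. The price is a minus sign in
    [is_derive_conv]. *)
Definition conv K f : E -> R := fun x => \int[mu]_y (K (y - x) * f y).

Lemma integrable_measurable f : mu.-integrable setT (EFin \o f) -> measurable_fun setT f.
Proof. by move=> /measurable_int /measurable_EFinP. Qed.

Lemma integrable_bounded_mul K f : continuous K -> bounded_support K ->
  mu.-integrable setT (EFin \o f) -> mu.-integrable setT (EFin \o (fun y => K y * f y)).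
Proof.
move=> cK bK intf; have [M M0 KM] := bounded_support_bounded cK bK.
rewrite (_ : EFin \o _ = (EFin \o K) \* (EFin \o f))%E; last by apply/funext => y /=; rewrite EFinM.
apply: integrableMr => //; first exact: rV_continuous_measurable.
exists M; split; first exact: num_real.
by move=> L ML y _; exact: le_trans (KM y) (ltW ML).
Qed.

Lemma integrable_conv K f x : smooth K -> bounded_support K ->
  mu.-integrable setT (EFin \o f) ->
  mu.-integrable setT (EFin \o (fun y => K (y - x) * f y)).
Proof.
move=> sK bK intf; apply: (@integrable_bounded_mul (fun y => K (y - x))) => //.
  exact: (smooth_continuous (smooth_translate (- x) sK)).
exact: (bounded_support_translate (- x) bK).
Qed.

Lemma le_Rintegral_dist (f g : E -> R) :
  mu.-integrable setT (EFin \o f) -> mu.-integrable setT (EFin \o g) ->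
  (`|\int[mu]_x f x - \int[mu]_x g x|%:E <= L1_dist f g)%E.
Proof.
move=> intf intg; rewrite -RintegralB //.
have intB : mu.-integrable setT (EFin \o (fun x => f x - g x)).
  by rewrite (_ : EFin \o _ = (EFin \o f) \- (EFin \o g))%E //; exact: integrableB.
rewrite EFin_normr_Rintegral // /L1_dist.
apply: le_trans (le_abse_integral _ _ _) _ => //.
exact: measurable_int intB.
Qed.

Lemma integrable_translate f (h : E) : mu.-integrable setT (EFin \o f) ->
  mu.-integrable setT (EFin \o (fun x => f (x + h))).
Proof.
move=> /integrableP[mf foo]; apply/integrableP.
have mf' : measurable_fun setT f by apply/measurable_EFinP.
split; first by apply/measurable_EFinP; exact: measurable_fun_translate.
rewrite (@ge0_integral_translate _ _ h (fun x => `|(f x)%:E|%E)) //.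
exact: measurableT_comp.
Qed.

(** A change of variables moves the increment [h = x' - x] from the kernel to [f]; the difference is
    then at most the supremum of [K] times the L^1 distance between [f] and its translate. *)
Lemma continuous_conv K f : smooth K -> bounded_support K ->
  mu.-integrable setT (EFin \o f) -> translation_continuous f ->
  continuous (conv K f).
Proof.
move=> sK bK intf tf x.
have cK := smooth_continuous sK.
have [M M0 KM] := bounded_support_bounded cK bK.
have mf := integrable_measurable intf.
move=> s /(nbhs_ballP (conv K f x))[e /= e0 es].
have e20 : 0 < e / 2 by rewrite divr_gt0.
have [d d0 fd] := tf _ (divr_gt0 e20 M0).
apply/nbhs_ballP; exists d => //= x' xx'.
apply: es; rewrite -ball_normE /=; apply: (@le_lt_trans _ _ (e / 2)); last by rewrite ltr_pdivrMr // ltr_pMr // ltr1n.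
pose h := x' - x; have hd : `|h| < d by rewrite distrC; move: xx'; rewrite -ball_normE.
have mKf : measurable_fun setT (fun y : E => K (y - x') * f y).
  by apply: integrable_measurable; exact: integrable_conv.
have eK : conv K f x' = \int[mu]_y (K (y - x) * f (y + h)).
  rewrite /conv -(Rintegral_translate h mKf); apply: eq_Rintegral => y _.
  by congr (K _ * _); rewrite /h addrA addrAC addrK.
rewrite distrC -lee_fin eK.
apply: le_trans (le_Rintegral_dist _ _) _.
- rewrite (_ : (fun y => _) = (fun y => (fun z => K (z - x') * f z) (y + h))).
    by apply: (@integrable_translate (fun z => K (z - x') * f z)); exact: integrable_conv.
  by apply/funext => y; congr (K _ * _); rewrite /h addrA addrAC addrK.
- exact: integrable_conv.
have mKx : measurable_fun setT (fun y : E => K (y - x)).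
  by apply: (@measurable_fun_translate _ _ K (- x)); exact: rV_continuous_measurable.
have mfh := measurable_fun_translate h mf.
apply: (@le_trans _ _ (M%:E * L1_dist (fun y => (f (y + h))%R) f)%E).
  rewrite /L1_dist -ge0_integralZl //; first last.
  - by rewrite lee_fin ltW.
  - exact: measurable_dist.
  apply: ge0_le_integral => //.
  - by apply: measurable_dist; exact: measurable_funM.
  - by apply: emeasurable_funM => //; exact: measurable_dist.
  - by move=> y _; rewrite -EFinM lee_fin -mulrBr normrM ler_wpM2r.
rewrite (_ : e / 2 = M * (e / 2 / M)); last by rewrite [RHS]mulrC divfK ?gt_eqF.
by rewrite EFinM lee_wpmul2l ?fd // lee_fin ltW.
Qed.

(** The derivative falls on the kernel only, so differentiation under the integral needs no
    regularity of [f]: the bound is [M * |f|] with [M] bounding [partial i K]. *)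
Lemma is_derive_conv K f i x : smooth K -> bounded_support K ->
  mu.-integrable setT (EFin \o f) ->
  is_derive x (Defs.basis i) (conv K f) (conv (- partial i K) f x).
Proof.
move=> sK bK intf.
have sp := smooth_partial i sK; have bp := bounded_support_partial i bK.
have [M M0 KM] := bounded_support_bounded (smooth_continuous sp) bp.
have mf := integrable_measurable intf.
pose b : E := Defs.basis i.
pose F (t : R) (y : E) := K (y - x - t *: b) * f y.
have D (t : R) (y : E) : is_derive t 1 (fun s : R => K (y - x - s *: b)) (- partial i K (y - x - t *: b)).
  have D1 : is_derive (- t) 1 (fun s : R => K (y - x + s *: b)) (partial i K (y - x - t *: b)).
    rewrite -scaleNr -derive_line; apply: derivableP.
    by apply: derivable_line_at; exact: smooth_derivable.
  have D2 := @is_derive1_comp R _ -%R t _ _ D1 (is_deriveNid t 1).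
  rewrite mulrN1 in D2.
  rewrite (_ : (fun s : R => K (y - x - s *: b)) = (fun s => K (y - x + s *: b)) \o -%R) //.
  by apply/funext => s /=; rewrite scaleNr.
have DF (t : R) (y : E) : is_derive t 1 (F ^~ y) (- partial i K (y - x - t *: b) * f y).
  rewrite (_ : F ^~ y = (fun s : R => K (y - x - s *: b)) * cst (f y)) //.
  apply: is_derive_eq (is_deriveM (D t y) (is_derive_cst (f y) t 1)) _.
  by rewrite scaler0 add0r /GRing.scale /= mulrC.
have H1 : `]-1, 1[%classic (0 : R) by rewrite /= in_itv /=; apply/andP; split; lra.
have H2 t : `]-1, 1[%classic t -> mu.-integrable setT (EFin \o F t).
  move=> _; rewrite (_ : F t = fun y => K (y - (x + t *: b)) * f y); first exact: integrable_conv.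
  by apply/funext => y; rewrite /F opprD addrA.
have H3 t y : `]-1, 1[%classic t -> [set: E] y -> derivable (F ^~ y) t 1.
  by move=> _ _; have [] := DF t y.
have H4 (y : E) : 0 <= M * `|f y| by rewrite mulr_ge0 // ltW.
have H5 : mu.-integrable setT (EFin \o (fun y => M * `|f y|)).
  rewrite (_ : EFin \o _ = (fun y => M%:E * ((EFin \o (fun y => `|f y|)%R) y))%E); last first.
    by apply/funext => y /=; rewrite EFinM.
  by apply: integrableZl => //; exact: integrable_norm.
have H6 t y : `]-1, 1[%classic t -> [set: E] y -> `|partial1of2 F t y| <= M * `|f y|.
  move=> _ _; rewrite partial1of2E; have [_ ->] := DF t y.
  by rewrite mulNr normrN normrM ler_wpM2r.
have A := @derivable_under_integral R _ _ mu F setT measurableT 0 (-1) 1 H1 H2 H3 _ H4 H5 H6.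
have B := @differentiation_under_integral R _ _ mu F setT measurableT 0 (-1) 1 H1 H2 H3 _ H4 H5 H6.
have eF : (fun t : R => \int[mu]_y F t y) = (fun t : R => conv K f (x + t *: b)).
  apply/funext => t; apply: eq_Rintegral => y _; rewrite /F; congr (K _ * _).
  by rewrite opprD addrA.
rewrite eF in A B; apply: DeriveDef.
  by apply/derivable1P; under eq_fun do rewrite addrC.
have := derive_line (conv K f) i x 0; rewrite scale0r addr0 /partial => <-.
rewrite -derive1E B; apply: eq_Rintegral => y _.
by rewrite partial1of2E; have [_ ->] := DF 0 y; rewrite scale0r subr0.
Qed.

Lemma smooth_conv K f : smooth K -> bounded_support K ->
  mu.-integrable setT (EFin \o f) -> translation_continuous f ->
  smooth (conv K f).
Proof.
move=> sK bK intf tf.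
(* For fixed [f], convolutions with all admissible kernels form a class stable under [partial i],
   which replaces [K] by [- partial i K]. *)
pose C (k : E -> R) := exists K, [/\ smooth K, bounded_support K & k = conv K f].
apply: (@smooth_alg _ _ C); last by apply: alg_gen; exists K.
move=> _ [{sK bK}K [sK bK ->]]; split; first exact: continuous_conv.
move=> i; split; first by move=> x; have [] := is_derive_conv i x sK bK intf.
apply: alg_gen; exists (- partial i K); split.
- by apply: smoothN; exact: smooth_partial.
- have [r r0 h] := bounded_support_partial i bK; exists r => // x rx.
  by rewrite /GRing.opp /= h // oppr0.
- by apply/funext => x; rewrite /partial; have [_ ->] := is_derive_conv i x sK bK intf.
Qed.

Lemma lebesgue_rV_ball_gt0 x (r : R) : 0 < r -> (0 < mu (ball x r))%E.
Proof.
move=> r0.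
pose a : E := \row_i (x ord0 i - r / 2); pose b : E := \row_i (x ord0 i + r / 2).
have ab i : a ord0 i <= b ord0 i by rewrite !mxE lerD2l; lra.
have B0 : (0 < mu [set x | forall i, (x ord0 i \in `]a ord0 i, b ord0 i])%R])%E.
  rewrite lebesgue_rV_box // lte_fin; apply: prodr_gt0 => i _; rewrite !mxE; lra.
apply: lt_le_trans B0 _.
apply: le_measure; rewrite ?inE; last first.
- move=> y h; apply/ball_rVP => // i; have := h i; rewrite !mxE in_itv /= => /andP[h1 h2].
  by rewrite ltr_norml; apply/andP; split; lra.
- exact: rV_ball_measurable.
- rewrite [X in measurable X](_ : _ = \bigcap_(i in [set: 'I_N]) ((fun x : E => x ord0 i) @^-1` `]a ord0 i, b ord0 i]%classic)).
    apply: fin_bigcap_measurable => // i _.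
    by rewrite -[X in measurable X]setTI; exact: measurable_coor.
  by apply/seteqP; split => y /= h i; [move=> _; exact: h | exact: (h i I)].
Qed.

Lemma exists_mollifier (e : R) : 0 < e -> exists K : E -> R,
  [/\ smooth K, forall x, 0 <= K x, forall x, e <= `|x| -> K x = 0 &
      \int[mu]_x K x = 1].
Proof.
move=> e0; pose c := \int[mu]_x bump (0 : E) e x.
have b0 x : e <= `|x| -> bump (0 : E) e x = 0.
  move=> ex; apply: bump_out => //; rewrite -ball_normE /= sub0r normrN.
  by move=> /lt_le_trans /(_ ex); rewrite ltxx.
have sb := smooth_bump (0 : E) e.
have intb : mu.-integrable setT (EFin \o bump (0 : E) e).
  by apply: bounded_support_integrable; [exact: smooth_continuous | exists e].
have mb := rV_ball_measurable (0 : E) (e / 2).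
have c0 : 0 < c.
  pose k : R := (flat 0 (e / 2) ^+ 2) ^+ N.
  have k0 : 0 < k by rewrite !exprn_gt0 // flat_gt0 // divr_gt0.
  rewrite -lte_fin /c /Rintegral fineK; last exact: integrable_fin_num.
  apply: (@lt_le_trans _ _ (\int[mu]_x (k * \1_(ball (0 : E) (e / 2)) x)%:E)%E); last first.
    apply: ge0_le_integral => //.
    - by move=> x _; rewrite lee_fin mulr_ge0 // ltW.
    - by apply/measurable_EFinP; apply: measurable_funM => //; exact: measurable_indic.
    - by apply: measurable_int intb.
    - move=> x _; rewrite lee_fin indicE; case: (boolP (x \in _)); last by rewrite mulr0 bump_ge0.
      by rewrite inE mulr1 => h; exact: bump_ge.
  under eq_integral do rewrite EFinM.
  rewrite ge0_integralZl //; last 2 first.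
  - by apply/measurable_EFinP; exact: measurable_indic.
  - by rewrite lee_fin ltW.
  rewrite integral_indic // setIT mule_gt0 // lebesgue_rV_ball_gt0 // divr_gt0 //.
exists (cst c^-1 * bump (0 : E) e); split.
- by apply: smoothM => //; exact: smooth_cst.
- by move=> x; rewrite /GRing.mul /= mulr_ge0 ?bump_ge0 // invr_ge0 ltW.
- by move=> x ex; rewrite /GRing.mul /= b0 // mulr0.
- rewrite (_ : \int[mu]_x _ = \int[mu]_x (c^-1 * bump (0 : E) e x)) //.
  by rewrite RintegralZl // mulVf // gt_eqF.
Qed.

Lemma measurable_fun_addE : measurable_fun setT (fun z : E * E => z.1 + z.2).
Proof.
apply: measurable_fun_rVP => i; under eq_fun do rewrite mxE.
apply: measurable_funD.
  by apply: (@measurableT_comp _ _ _ _ _ _ (fun y : E => y ord0 i)) => //; exact: measurable_coor.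
by apply: (@measurableT_comp _ _ _ _ _ _ (fun y : E => y ord0 i)) => //; exact: measurable_coor.
Qed.

Lemma integral_mollifier K : continuous K -> bounded_support K ->
  \int[mu]_x K x = 1 -> (\int[mu]_x (K x)%:E = 1)%E.
Proof.
move=> cK bK K1; rewrite -[LHS]fineK; first by rewrite -/(Rintegral _ _ _) K1.
by apply: integrable_fin_num => //; exact: bounded_support_integrable.
Qed.

Lemma convE K f x : smooth K -> bounded_support K ->
  mu.-integrable setT (EFin \o f) -> conv K f x = \int[mu]_h (K h * f (x + h)).
Proof.
move=> sK bK intf; rewrite /conv -(Rintegral_translate x).
  by apply: eq_Rintegral => y _; rewrite addrK addrC.
by apply: integrable_measurable; exact: integrable_conv.
Qed.

(** By Tonelli the integral over [x] is taken first; for fixed [h] it is [K h] times the distance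
    between [f] and its translate by [h], which is at most [e] on the support of [K], and [K] has
    mass 1. It serves both the L^1 and the L^p convergence of mollifications. *)
Lemma integral_average K f (d e : R) : continuous K -> (forall x, 0 <= K x) -> 0 < d ->
  (forall x, d <= `|x| -> K x = 0) -> \int[mu]_x K x = 1 ->
  measurable_fun setT f ->
  (forall h : E, `|h| < d -> (L1_dist (fun x => (f (x + h))%R) f <= e%:E)%E) ->
  let G := fun z : E * E => (K z.2 * `|f (z.1 + z.2) - f z.1|)%:E in
  measurable_fun setT G /\ (\int[mu]_x \int[mu]_h G (x, h) <= e%:E)%E.
Proof.
move=> cK K0 d0 Kd K1 mf fd G.
have bK : bounded_support K by exists d.
have mK := rV_continuous_measurable cK.
have mG : measurable_fun setT G.
  apply/measurable_EFinP; apply: measurable_funM; first exact: measurableT_comp.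
  apply: measurableT_comp => //; apply: measurable_funB.
    apply: (measurableT_comp mf); exact: measurable_fun_addE.
  exact: measurableT_comp.
have G0 z : (0 <= G z)%E by rewrite lee_fin mulr_ge0.
split => //; rewrite (fubini_tonelli _ mG G0).
apply: (@le_trans _ _ (\int[mu]_h (e%:E * (K h)%:E))%E); last first.
  have e0 : (0 <= e%:E)%E.
    apply: le_trans (fd 0 _); first by apply: integral_ge0.
    by rewrite normr0.
  rewrite ge0_integralZl //; first by rewrite integral_mollifier // mule1.
    exact/measurable_EFinP.
  by move=> h _; rewrite lee_fin.
apply: ge0_le_integral => //.
- by move=> h _; apply: integral_ge0.
- exact: (measurable_fun_fubini_tonelli_G G mG G0).
- by apply: emeasurable_funM => //; exact/measurable_EFinP.
move=> h _; rewrite /G /=.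
under eq_integral do rewrite EFinM.
have mfh := measurable_fun_translate h mf.
have mD := measurable_dist mfh mf.
have Kh : (0 <= (K h)%:E)%E by rewrite lee_fin.
rewrite (ge0_integralZl _ measurableT mD) //.
have [dh|hd] := leP d `|h|; first by rewrite Kd // mul0e mule0.
by rewrite muleC lee_wpmul2r ?lee_fin // fd.
Qed.

Lemma L1_dist_conv K f (d e : R) : smooth K -> (forall x, 0 <= K x) -> 0 < d ->
  (forall x, d <= `|x| -> K x = 0) -> \int[mu]_x K x = 1 ->
  mu.-integrable setT (EFin \o f) -> translation_continuous f ->
  (forall h : E, `|h| < d -> (L1_dist (fun x => (f (x + h))%R) f <= e%:E)%E) ->
  (L1_dist (conv K f) f <= e%:E)%E.
Proof.
move=> sK K0 d0 Kd K1 intf tf fd.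
have bK : bounded_support K by exists d.
have cK := smooth_continuous sK.
have mf := integrable_measurable intf.
have iK := bounded_support_integrable cK bK.
have [mG HG] := integral_average cK K0 d0 Kd K1 mf fd.
apply: le_trans HG; apply: ge0_le_integral => //.
- apply: measurable_dist => //; apply: rV_continuous_measurable; exact: continuous_conv.
- apply: (measurable_fun_fubini_tonelli_F _ mG) => z; by rewrite lee_fin mulr_ge0.
move=> x _; rewrite convE //.
have -> : f x = \int[mu]_h (K h * f x) by rewrite RintegralZr // K1 mul1r.
apply: le_trans (le_Rintegral_dist _ _) _.
- apply: (@integrable_bounded_mul K (fun h => f (x + h))) => //.
  by under eq_fun do rewrite addrC; exact: integrable_translate.
- rewrite (_ : EFin \o _ = (EFin \o K) \* cst (f x)%:E)%E; last by apply/funext => y /=; rewrite EFinM.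
  exact: integrableZr.
rewrite le_eqVlt; apply/orP; left; apply/eqP; apply: eq_integral => h _.
by rewrite /= RintegralZr // K1 mul1r -mulrBr normrM ger0_norm.
Qed.

End convolution.

(** * Weak gradients *)

Section weak_gradients.
Context {R : realType} {N : nat}.
Local Notation E := 'rV[R]_N.
Local Notation mu := (@lebesgue_rV R N).
Implicit Types (f g u phi : E -> R) (x : E) (i : 'I_N) (Omega : set E).

Lemma test_function_smooth Omega phi : test_function Omega phi -> smooth phi.
Proof. by case. Qed.

Lemma test_function_out Omega phi x : test_function Omega phi -> ~ Omega x ->
  \near x, phi x = 0.
Proof.
move=> [_ _ sO] nOx.
have : nbhs x (~` closure [set x | phi x != 0]).
  by apply: open_nbhs_nbhs; split; [exact/closed_openC/closed_closure | move=> /sO].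
apply: filterS => y /= ny; apply/eqP/negPn/negP => py; apply: ny.
exact: subset_closure.
Qed.

Lemma test_function_supp Omega phi x : test_function Omega phi ->
  ~ closure [set x | phi x != 0] x -> phi x = 0 /\ forall i, partial i phi x = 0.
Proof.
move=> [_ _ sO] nx; have n0 : \near x, phi x = 0.
  have : nbhs x (~` closure [set x | phi x != 0]).
    by apply: open_nbhs_nbhs; split => //; exact/closed_openC/closed_closure.
  apply: filterS => y /= ny; apply/eqP/negPn/negP => py; apply: ny.
  exact: subset_closure.
by split => [|i]; [exact: nbhs_singleton n0 | exact: partial_vanish].
Qed.

Lemma test_function_bounded_support Omega phi : test_function Omega phi ->
  bounded_support phi.
Proof.
move=> [_ /compact_bounded[M [_ HM]] _].
exists (`|M| + 2); first by rewrite ltr_pwDr.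
move=> x xM; apply/eqP/negPn/negP => px.
have /(_ (`|M| + 1)) := HM.
rewrite (le_lt_trans (ler_norm _)) ?ltrDl // => /(_ isT x).
have cx : closure [set x | phi x != 0] x by exact: subset_closure.
move=> /(_ cx) /= xM1.
have := le_trans xM xM1; lra.
Qed.

Lemma ball_test_function Omega phi x (r : R) : smooth phi ->
  (forall y, ~ closed_ball x r y -> phi y = 0) -> closed_ball x r `<=` Omega ->
  test_function Omega phi.
Proof.
move=> sphi phi0 rO.
have cr : closure [set y | phi y != 0] `<=` closed_ball x r.
  rewrite [X in _ `<=` X](closure_id _).1; last exact: closed_ball_closed.
  apply: closure_subset => y /= py; apply/not_notP => /phi0 /eqP.
  by rewrite (negbTE py).
split => //; last exact: subset_trans rO.
apply: subclosed_compact cr; first exact: closed_closure.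
exact: compact_closed_ball.
Qed.

Lemma L1loc_smooth Omega f : smooth f -> L1loc Omega f.
Proof.
move=> /smooth_continuous cf; split.
  by apply: measurable_funTS; exact: rV_continuous_measurable.
move=> K _ cK; apply: measurable_bounded_integrable.
- exact: rV_compact_measurable.
- exact: lebesgue_rV_compact_lty.
- by apply: measurable_funTS; exact: rV_continuous_measurable.
- have /compact_bounded[M [Mr HM]] : compact (f @` K).
    by apply: continuous_compact => //; exact: continuous_subspaceT.
  by exists M; split => // L /HM h x Kx; apply: h; exists x.
Qed.

Lemma integrable_mul_compact Omega (K : set E) f g : open Omega -> K `<=` Omega ->
  compact K -> L1loc Omega f -> continuous g -> (forall x, ~ K x -> g x = 0) ->
  mu.-integrable Omega (EFin \o (fun x => f x * g x)).
Proof.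
move=> oO KO cK [_ Lf] cg g0; have mK := rV_compact_measurable cK.
have mO := rV_open_measurable oO.
have intK : mu.-integrable K (EFin \o (fun x => f x * g x)).
  rewrite (_ : EFin \o _ = (EFin \o f) \* (EFin \o g))%E; last by apply/funext => y /=; rewrite EFinM.
  apply: integrableMl => //.
  - exact: Lf.
  - by apply: measurable_funTS; exact: rV_continuous_measurable.
  have /compact_bounded[M [Mr HM]] : compact (g @` K).
    by apply: continuous_compact => //; exact: continuous_subspaceT.
  by exists M; split => // L /HM h x Kx; apply: h; exists x.
move/(integrable_mkcond _ mK) : intK => intK.
have := integrableS measurableT mO (@subsetT _ _) intK.
apply: eq_integrable => // x _; rewrite patchE; case: ifPn => //.
by move=> /negP; rewrite inE => /g0 /= ->; rewrite mulr0.
Qed.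

Lemma integrable_mul_test Omega f phi : open Omega -> L1loc Omega f ->
  test_function Omega phi ->
  mu.-integrable Omega (EFin \o (fun x => f x * phi x)).
Proof.
move=> oO Lf tphi; have [sphi cphi supp] := tphi.
apply: (integrable_mul_compact oO supp) => //; first exact: smooth_continuous.
by move=> x /(test_function_supp tphi)[].
Qed.

Lemma integrable_mul_partial_test Omega f phi i : open Omega -> L1loc Omega f ->
  test_function Omega phi ->
  mu.-integrable Omega (EFin \o (fun x => f x * partial i phi x)).
Proof.
move=> oO Lf tphi; have [sphi cphi supp] := tphi.
apply: (integrable_mul_compact oO supp) => //.
  exact: smooth_continuous (smooth_partial i sphi).
by move=> x /(test_function_supp tphi)[].
Qed.

Lemma L1loc_restrict_ball Omega f x (r : R) : L1loc Omega f ->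
  closed_ball x r `<=` Omega ->
  mu.-integrable setT (EFin \o (f \_ (ball x r))) /\
  translation_continuous (f \_ (ball x r)).
Proof.
move=> [_ Lf] rO.
have mB := rV_ball_measurable x r.
have intB : mu.-integrable (ball x r) (EFin \o f).
  apply: (@integrableS _ _ _ mu (closed_ball x r)) => //.
  - by apply: rV_closed_measurable; exact: closed_ball_closed.
  - exact: subset_closed_ball.
  - by apply: Lf => //; exact: compact_closed_ball.
split.
  have /(integrable_mkcond _ mB) := intB; rewrite restrict_EFin //.
apply: translation_continuous_integrable => //; first exact: ball_open.
exact: lebesgue_rV_ball_lty.
Qed.

Lemma open_closed_ball Omega x : open Omega -> Omega x ->
  exists2 r : R, 0 < r & closed_ball x r `<=` Omega.
Proof.
move=> oO Ox; have /nbhs_ballP[e /= e0 eO] : nbhs x Omega by exact: open_nbhs_nbhs.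
exists (e / 2); first by rewrite divr_gt0.
apply: subset_trans eO => y; rewrite closed_ballE ?divr_gt0 // /closed_ball_ /= => xy.
by rewrite -ball_normE /= (le_lt_trans xy) // ltr_pdivrMr // ltr_pMr // ltr1n.
Qed.

(** Restricting [f] to the ball makes it integrable on the whole space. At points within [e] of the
    centre the restriction is invisible, because the kernel only reaches points within [e + e <= r]
    of the centre. *)
Lemma conv_restrict_ball Omega (K f : E -> R) x0 x (r e : R) : smooth K -> 0 < e ->
  (forall y, e <= `|y| -> K y = 0) -> e + e <= r -> ball x0 e x ->
  ball x0 r `<=` Omega ->
  conv K (f \_ (ball x0 r)) x = \int[mu]_(y in Omega) (f y * K (y - x)).
Proof.
move=> sK e0 Ke er xx0 rO; rewrite [RHS]Rintegral_mkcond; apply: eq_Rintegral => y _.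
rewrite !patchE; case: (boolP (y \in (ball x0 r : set E))) => yr.
  by rewrite ifT; [exact: mulrC|move: yr; rewrite !inE; exact: rO].
rewrite mulr0; case: ifP => // _; rewrite Ke ?mulr0 //.
rewrite leNgt; apply: contra yr => yx; rewrite inE -ball_normE /=.
rewrite (le_lt_trans (ler_distD x _ _)) // (lt_le_trans _ er) // ltrD //.
  by move: xx0; rewrite -ball_normE.
by rewrite distrC.
Qed.

Lemma ball_translate_test Omega (K : E -> R) x0 x (r e : R) : smooth K -> 0 < e ->
  (forall y, e <= `|y| -> K y = 0) -> e + e <= r -> ball x0 e x ->
  closed_ball x0 r `<=` Omega -> test_function Omega (fun y => K (y - x)).
Proof.
move=> sK e0 Ke er xx0 rO.
apply: (@ball_test_function _ _ x e); first exact: (smooth_translate (- x) sK).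
  move=> y; rewrite closed_ballE // /closed_ball_ /= => /negP; rewrite -ltNge => yx.
  by apply: Ke; rewrite distrC ltW.
have r0 : 0 < r by rewrite (lt_le_trans _ er) // addr_gt0.
apply: subset_trans rO => y; rewrite !closed_ballE // /closed_ball_ /= => yx.
rewrite (le_trans (ler_distD x _ _)) // (le_trans _ er) //.
by rewrite lerD // ltW //; move: xx0; rewrite -ball_normE.
Qed.

(* The convolution of [f] with a mollifier vanishes near each point, and
   converges to [f] in mean. *)
Lemma fundamental_lemma Omega f : open Omega -> L1loc Omega f ->
  (forall phi, test_function Omega phi -> \int[mu]_(x in Omega) (f x * phi x) = 0) ->
  mu.-negligible [set x | Omega x /\ f x != 0].
Proof.
move=> oO Lf Hf; apply: negligible_local => x0 [Ox0 _].
have [r r0 rO] := open_closed_ball oO Ox0.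
have [If tf] := L1loc_restrict_ball Lf rO.
have r2 : 0 < r / 2 by rewrite divr_gt0.
have mB := rV_ball_measurable x0 (r / 2).
have mf := integrable_measurable If.
set F := f \_ (ball x0 r) in If tf mf.
have mFa : measurable_fun setT (EFin \o F) by exact/measurable_EFinP.
suff F0 : (\int[mu]_(x in ball x0 (r / 2)) `|(EFin \o F) x| = 0)%E.
  have /(ae_eq_integral_abs _ mB) := F0.
  move=> /(_ (measurable_funTS mFa)) [Z [mZ Z0 HZ]].
  exists (r / 2) => //; exists Z; split => // x [[Ox fx] xb]; apply: HZ => /=.
  move=> /(_ xb); rewrite /= /F patchE ifT; last first.
    by rewrite inE; apply: le_ball xb; rewrite ler_pdivrMr // ler_pMr // ler1n.
  by move=> [] /eqP; rewrite (negbTE fx).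
apply/eqP; rewrite eq_le integral_ge0 ?andbT //; apply/lee_addgt0Pr => e e0.
rewrite add0e.
have [d d0 fd] := tf _ e0.
(* The bound [d] gives L^1 closeness; the bound [r / 2] ensures that at points of the half ball the
   convolution is the integral of [f] against a test function of [Omega], hence 0. *)
pose d' := Num.min d (r / 2).
have d'0 : 0 < d' by rewrite lt_min d0.
have [K [sK K0 Kd K1]] := @exists_mollifier R N _ d'0.
have H := L1_dist_conv sK K0 d'0 Kd K1 If tf.
have {}H : (L1_dist (conv K F) F <= e%:E)%E.
  by apply: H => h; rewrite lt_min => /andP[hd _]; exact: fd.
apply: le_trans H; rewrite /L1_dist.
apply: (@le_trans _ _ (\int[mu]_(x in ball x0 (r / 2)) `|conv K F x - F x|%:E)%E); last first.
  apply: ge0_subset_integral => //; apply: measurable_dist => //.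
  apply: rV_continuous_measurable; apply: continuous_conv => //; by exists d'.
rewrite le_eqVlt; apply/orP; left; apply/eqP; apply: eq_integral => x.
rewrite inE => xb.
have KK y : r / 2 <= `|y| -> K y = 0.
  by move=> ry; apply: Kd; rewrite (le_trans _ ry) // ge_min lexx orbT.
rewrite /F (@conv_restrict_ball Omega K f x0 x r (r / 2)) //; last 2 first.
- by rewrite -splitr.
- apply: subset_trans rO; exact: subset_closed_ball.
rewrite Hf ?sub0r ?normrN //.
by apply: (@ball_translate_test Omega K x0 x r (r / 2)) => //; rewrite -splitr.
Qed.

Lemma L1locD Omega f g : open Omega -> L1loc Omega f -> L1loc Omega g ->
  L1loc Omega (fun x => f x + g x).
Proof.
move=> oO [mf Lf] [mg Lg]; split; first exact: measurable_funD.
move=> K KO cK; rewrite (_ : EFin \o _ = (EFin \o f) \+ (EFin \o g))%E //.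
by apply: integrableD; [exact: rV_compact_measurable|exact: Lf|exact: Lg].
Qed.

Lemma L1locB Omega f g : open Omega -> L1loc Omega f -> L1loc Omega g ->
  L1loc Omega (fun x => f x - g x).
Proof.
move=> oO [mf Lf] [mg Lg]; split; first exact: measurable_funB.
move=> K KO cK; rewrite (_ : EFin \o _ = (EFin \o f) \- (EFin \o g))%E //.
by apply: integrableB; [exact: rV_compact_measurable|exact: Lf|exact: Lg].
Qed.

Lemma weak_gradient_unique Omega u (G H : E -> E) i : open Omega ->
  is_weak_gradient Omega u G -> is_weak_gradient Omega u H ->
  mu.-negligible [set x | Omega x /\ G x ord0 i != H x ord0 i].
Proof.
move=> oO [Lu HG] [_ HH]; have [LG IG] := HG i; have [LH IH] := HH i.
have mO := rV_open_measurable oO.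
have : mu.-negligible [set x | Omega x /\ G x ord0 i - H x ord0 i != 0].
  apply: (@fundamental_lemma Omega (fun x => G x ord0 i - H x ord0 i)) => //.
    exact: L1locB.
  move=> phi tphi; have := IG _ tphi; rewrite (IH _ tphi) => /oppr_inj e.
  under eq_Rintegral do rewrite mulrBl.
  by rewrite RintegralB ?e ?subrr //; exact: integrable_mul_test.
by apply: negligibleS => x [Ox GH]; split => //; rewrite subr_eq0.
Qed.

Lemma is_weak_gradient_weak_gradient Omega u G : is_weak_gradient Omega u G ->
  is_weak_gradient Omega u (weak_gradient Omega u).
Proof. by move=> HG; rewrite /weak_gradient; exact: (xgetPex (fun=> 0) (ex_intro _ G HG)). Qed.

Definition gradient f : E -> E := fun x => \row_i partial i f x.

Lemma smooth_is_weak_gradient Omega f : smooth f ->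
  is_weak_gradient Omega f (gradient f).
Proof.
move=> sf; split; first exact: L1loc_smooth.
move=> i; rewrite (_ : (fun x => gradient f x ord0 i) = partial i f); last first.
  by apply/funext => x; rewrite mxE.
split; first by apply: L1loc_smooth; exact: smooth_partial.
move=> phi tphi.
(* Both integrands vanish outside [Omega], so the identity reduces to integration by parts on the
   whole space. *)
have ext (h k : E -> R) : (forall x, ~ Omega x -> k x = 0) ->
    \int[mu]_(x in Omega) (h x * k x) = \int[mu]_x (h x * k x).
  move=> k0; rewrite Rintegral_mkcond; apply: eq_Rintegral => x _.
  by rewrite patchE; case: ifPn => // /negP; rewrite inE => /k0 ->; rewrite mulr0.
have [sphi _ _] := tphi.
rewrite ext; last by move=> x /(test_function_out tphi)/partial_vanish.
under [in RHS]eq_Rintegral do rewrite mxE.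
rewrite ext; last by move=> x /(test_function_out tphi)/nbhs_singleton.
by apply: integral_by_parts => //; exact: test_function_bounded_support tphi.
Qed.

Lemma is_weak_gradientD Omega u v (G H : E -> E) : open Omega ->
  is_weak_gradient Omega u G -> is_weak_gradient Omega v H ->
  is_weak_gradient Omega (fun x => u x + v x) (fun x => G x + H x).
Proof.
move=> oO [Lu HG] [Lv HH]; split; first exact: L1locD.
have mO := rV_open_measurable oO.
move=> i; have [LG IG] := HG i; have [LH IH] := HH i; split.
  by under eq_fun do rewrite mxE; exact: L1locD.
move=> phi tphi.
under eq_Rintegral do rewrite mulrDl.
rewrite RintegralD //; [|exact: integrable_mul_partial_test..].
rewrite IG // IH // -opprD; congr (- _).
under [in RHS]eq_Rintegral do rewrite mxE mulrDl.
by rewrite RintegralD //; exact: integrable_mul_test.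
Qed.

End weak_gradients.

(** * Inequalities for powers, norms and the potential *)

Section power_inequalities.
Context {R : realType}.
Implicit Types (a b c s t x y p gam : R).

(** This is the inequality between [t^p] and its tangent at [a], rearranged without subtractions; in
    that form it is Young's inequality for [x] and [a^(p-1)] with exponents [p] and
    [p / (p - 1)]. *)
Lemma young_tangent p x a : 1 < p -> 0 <= x -> 0 <= a ->
  p * (x * a `^ (p - 1)) <= x `^ p + (p - 1) * a `^ p.
Proof.
move=> p1 x0 a0; have p0 : 0 < p by exact: lt_trans p1.
have p10 : 0 < p - 1 by rewrite subr_gt0.
pose q := p / (p - 1).
have pq : p^-1 + q^-1 = 1 by rewrite /q; field; rewrite !gt_eqF.
have q0 : 0 < q by rewrite divr_gt0.
have := conjugate_powR x0 (powR_ge0 a (p - 1)) p0 q0 pq.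
rewrite -powRrM (_ : (p - 1) * q = p); last by rewrite /q mulrC divfK // gt_eqF.
move=> /(ler_wpM2l (ltW p0)) /le_trans; apply.
rewrite le_eqVlt; apply/orP; left; apply/eqP; rewrite /q; field.
by rewrite !gt_eqF.
Qed.

(** The tangent inequalities at the mean [c], for [a] and for [b], are averaged with weights [1 - s]
    and [s]; their left-hand sides add up to [p * c^p]. *)
Lemma powR_convex p s a b : 1 < p -> 0 <= s <= 1 -> 0 <= a -> 0 <= b ->
  ((1 - s) * a + s * b) `^ p <= (1 - s) * a `^ p + s * b `^ p.
Proof.
move=> p1 /andP[s0 s1] a0 b0; have p0 : 0 < p by exact: lt_trans p1.
have s10 : 0 <= 1 - s by rewrite subr_ge0.
set c := (1 - s) * a + s * b.
have c0 : 0 <= c by rewrite addr_ge0 // mulr_ge0.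
have Ha := young_tangent p1 a0 c0; have Hb := young_tangent p1 b0 c0.
have := lerD (ler_wpM2l s10 Ha) (ler_wpM2l s0 Hb).
have e : p * c `^ p = (1 - s) * (p * (a * c `^ (p - 1))) + s * (p * (b * c `^ (p - 1))).
  by rewrite -(mulr_powRB1 c0 p0) {1}/c; ring.
rewrite -e; lra.
Qed.

Lemma powR_add_le p a b : 0 <= p -> 0 <= a -> 0 <= b ->
  (a + b) `^ p <= 2 `^ p * (a `^ p + b `^ p).
Proof.
move=> p0.
wlog ab : a b / a <= b.
  move=> W a0 b0; case: (leP a b) => [ab|/ltW ba]; first exact: W.
  by rewrite addrC [X in _ * X]addrC; exact: W.
move=> a0 b0; apply: (@le_trans _ _ ((2 * b) `^ p)).
  by apply: ge0_ler_powR; rewrite ?nnegrE ?addr_ge0 ?mulr_ge0 //; lra.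
by rewrite powRM // ler_wpM2l ?powR_ge0 // lerDr powR_ge0.
Qed.

(** The summand [0 ^ p] covers the exponent 0, where [powR] takes the value 1 at 0; it vanishes for
    positive [p]. *)
Lemma powR_sum_le p (I : Type) (r : seq I) : 0 <= p ->
  exists2 C : R, 0 <= C & forall F : I -> R, (forall i, 0 <= F i) ->
    (\sum_(i <- r) F i) `^ p <= 0 `^ p + C * \sum_(i <- r) F i `^ p.
Proof.
move=> p0; elim: r => [|i r [C C0 IH]].
  by exists 0 => // F F0; rewrite !big_nil mulr0 addr0.
have [->|pn] := eqVneq p 0.
  exists 0 => // F _; rewrite mul0r addr0 !powRr0 //.
exists (2 `^ p * (1 + C)); first by rewrite mulr_ge0 ?powR_ge0 // addr_ge0.
move=> F F0; have := IH _ F0; rewrite !powR0 // !add0r => H.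
rewrite !big_cons.
have S0 : 0 <= \sum_(j <- r) F j by apply: sumr_ge0.
have S1 : 0 <= \sum_(j <- r) F j `^ p by apply: sumr_ge0 => j _; exact: powR_ge0.
rewrite (le_trans (powR_add_le p0 (F0 i) S0)) // -mulrA ler_wpM2l ?powR_ge0 //.
have := powR_ge0 (F i) p; nra.
Qed.

Lemma powR_frac_le p x y : 1 <= p -> 0 <= x -> x <= y -> 0 < y ->
  x `^ p <= x / y * y `^ p.
Proof.
move=> p1 x0 xy y0; have p0 : 0 < p by exact: lt_le_trans p1.
have yn : y != 0 by rewrite gt_eqF.
have -> : x `^ p = (x / y) `^ p * y `^ p by rewrite -powRM ?divr_ge0 ?divfK // ltW.
rewrite ler_wpM2r ?powR_ge0 //.
have [->|xn] := eqVneq x 0; first by rewrite mul0r powR0 // gt_eqF.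
apply: ge1r_powR => //; rewrite divr_gt0 //=; last by rewrite lt_neqAle eq_sym xn.
by rewrite ler_pdivrMr // mul1r.
Qed.

Lemma powR_superadditive p x y : 1 <= p -> 0 <= x -> 0 <= y ->
  x `^ p + y `^ p <= (x + y) `^ p.
Proof.
move=> p1 x0 y0; have p0 : 0 < p by exact: lt_le_trans p1.
have [s0|s0] := eqVneq (x + y) 0.
  have -> : x = 0 by lra.
  have -> : y = 0 by lra.
  by rewrite addr0 powR0 ?gt_eqF // addr0.
have {}s0 : 0 < x + y by rewrite lt_neqAle eq_sym s0 addr_ge0.
have H1 : x `^ p <= x / (x + y) * (x + y) `^ p by apply: powR_frac_le => //; lra.
have H2 : y `^ p <= y / (x + y) * (x + y) `^ p by apply: powR_frac_le => //; lra.
apply: le_trans (lerD H1 H2) _.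
by rewrite -mulrDl -mulrDl divff ?gt_eqF // mul1r.
Qed.

Lemma powR_frac_ge gam x y : 0 < gam <= 1 -> 0 <= x -> x <= y -> 0 < y ->
  x / y * y `^ gam <= x `^ gam.
Proof.
move=> /andP[g0 g1] x0 xy y0.
have yn : y != 0 by rewrite gt_eqF.
have -> : x `^ gam = (x / y) `^ gam * y `^ gam by rewrite -powRM ?divr_ge0 ?divfK // ltW.
rewrite ler_wpM2r ?powR_ge0 //.
have [->|xn] := eqVneq x 0; first by rewrite mul0r powR_ge0.
apply: ger1_powR => //; rewrite divr_gt0 //=; last by rewrite lt_neqAle eq_sym xn.
by rewrite ler_pdivrMr // mul1r.
Qed.

Lemma powR_subadditive gam x y : 0 < gam <= 1 -> 0 <= x -> 0 <= y ->
  (x + y) `^ gam <= x `^ gam + y `^ gam.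
Proof.
move=> g x0 y0; have /andP[g0 g1] := g.
have [s0|s0] := eqVneq (x + y) 0.
  have -> : x = 0 by lra.
  have -> : y = 0 by lra.
  by rewrite addr0 powR0 ?gt_eqF // addr0.
have {}s0 : 0 < x + y by rewrite lt_neqAle eq_sym s0 addr_ge0.
have H1 : x / (x + y) * (x + y) `^ gam <= x `^ gam by apply: powR_frac_ge => //; lra.
have H2 : y / (x + y) * (x + y) `^ gam <= y `^ gam by apply: powR_frac_ge => //; lra.
apply: le_trans (lerD H1 H2).
by rewrite -mulrDl -mulrDl divff ?gt_eqF // mul1r.
Qed.

Definition signed_power p t : R := `|t| `^ (p - 1) * t.

Lemma normr_signed_power p t : 0 < p -> `|signed_power p t| = `|t| `^ p.
Proof.
move=> p0; rewrite /signed_power normrM ger0_norm ?powR_ge0 // mulrC.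
by rewrite mulr_powRB1.
Qed.

(* Reduces convergence of mollifications in L^p to continuity of translations
   in L^1, applied to the signed power of the function. *)
Lemma dist_signed_power p a b : 1 <= p ->
  `|a - b| `^ p <= 2 `^ p * `|signed_power p a - signed_power p b|.
Proof.
move=> p1; have p0 : 0 < p by exact: lt_le_trans p1.
have two1 : 1 <= 2 `^ p :> R.
  by rewrite -[leLHS](powRr0 2) ler_powR ?ler1n // ltW.
have sN t : signed_power p (- t) = - signed_power p t.
  by rewrite /signed_power normrN mulrN.
have sP t : 0 <= t -> signed_power p t = t `^ p.
  by move=> t0; rewrite /signed_power ger0_norm // mulrC mulr_powRB1.
have same x y : 0 <= y -> y <= x -> `|x - y| `^ p <= 2 `^ p * `|signed_power p x - signed_power p y|.
  move=> y0 yx; have x0 := le_trans y0 yx.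
  have xy0 : 0 <= x - y by rewrite subr_ge0.
  rewrite !sP // (ger0_norm xy0).
  have := powR_superadditive p1 xy0 y0; rewrite subrK => H.
  have D : (x - y) `^ p <= x `^ p - y `^ p by lra.
  have D0 : 0 <= x `^ p - y `^ p by apply: le_trans D; exact: powR_ge0.
  rewrite (ger0_norm D0) (le_trans D) // ler_peMl //.
have opp x y : 0 <= x -> 0 <= y -> `|x - - y| `^ p <= 2 `^ p * `|signed_power p x - signed_power p (- y)|.
  move=> x0 y0; rewrite sN !opprK !sP // !ger0_norm ?addr_ge0 ?powR_ge0 //.
  exact: powR_add_le (ltW p0) x0 y0.
have [a0|a0] := leP 0 a; have [b0|b0] := leP 0 b.
- have [ab|ab] := leP a b; last exact: same (ltW ab).
  by rewrite distrC [X in _ * X]distrC; exact: same.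
- by rewrite -[b]opprK; apply: opp => //; rewrite oppr_ge0 ltW.
- rewrite distrC [X in _ * X]distrC -[a]opprK; apply: opp => //.
  by rewrite oppr_ge0 ltW.
- have a1 : 0 <= - a by rewrite oppr_ge0 ltW.
  have b1 : 0 <= - b by rewrite oppr_ge0 ltW.
  have -> : a - b = - b - - a by rewrite opprK addrC.
  have -> : signed_power p a - signed_power p b = signed_power p (- b) - signed_power p (- a).
    by rewrite !sN opprK addrC.
  have [ab|ab] := leP (- a) (- b); first exact: same.
  by rewrite distrC [X in _ * X]distrC; exact: same (ltW ab).
Qed.

(** The tangent of the concave power at [t]. After division by [t^gam] it reads
    [r^gam <= gam * r + (1 - gam)] with [r = (t - s) / t], which is Young's inequality for [r^gam]
    and 1 with exponents [1 / gam] and [1 / (1 - gam)]. *)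
Lemma powR_tangent_concave gam t s : 0 < gam < 1 -> 0 < t -> 0 <= s -> s <= t ->
  (t - s) `^ gam + s * (gam * t `^ (gam - 1)) <= t `^ gam.
Proof.
move=> /andP[g0 g1] t0 s0 st.
have g10 : 0 < 1 - gam by rewrite subr_gt0.
have tn : t != 0 by rewrite gt_eqF.
pose r := (t - s) / t.
have r0 : 0 <= r by rewrite divr_ge0 ?subr_ge0 // ltW.
have pq : gam^-1^-1 + (1 - gam)^-1^-1 = 1 by rewrite !invrK; ring.
have i1 : 0 < gam^-1 by rewrite invr_gt0.
have i2 : 0 < (1 - gam)^-1 by rewrite invr_gt0.
have := conjugate_powR (powR_ge0 r gam) (@ler01 R) i1 i2 pq.
rewrite mulr1 powR1 mul1r !invrK -powRrM mulfV ?gt_eqF // powRr1 // => H.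
have e1 : (t - s) `^ gam = r `^ gam * t `^ gam.
  by rewrite -powRM ?divfK //; exact: ltW.
have e2 : t `^ (gam - 1) = t `^ gam / t.
  by rewrite powRB ?powRr1 ?tn ?implybT // ltW.
rewrite e1 e2.
have T := powR_ge0 t gam.
have := ler_wpM2r T H.
have -> : s * (gam * (t `^ gam / t)) = gam * (s / t) * t `^ gam by field.
have -> : s / t = 1 - r by rewrite /r; field.
nra.
Qed.

(** The first summand suffices for [x <= t] and the second for [x > t]. With [t] small, this turns
    L^1 closeness of [u] and [v] into smallness of the integral of [|u - v|^gam] on a set of finite
    measure. *)
Lemma powR_le_affine gam t x : 0 < gam < 1 -> 0 < t -> 0 <= x ->
  x `^ gam <= t `^ gam + t `^ (gam - 1) * x.
Proof.
move=> /andP[g0 g1] t0 x0.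
have e2 : t `^ (gam - 1) = t `^ gam / t.
  by rewrite powRB ?powRr1 ?(ltW t0) // (gt_eqF t0) implybT.
have [xt|tx] := leP x t.
  rewrite (@le_trans _ _ (t `^ gam)) //.
    by apply: ge0_ler_powR; rewrite ?nnegrE // ltW.
  by rewrite lerDl mulr_ge0 // powR_ge0.
have xp : 0 < x by exact: lt_trans tx.
have := @powR_frac_ge gam t x; rewrite g0 (ltW g1) => /(_ isT (ltW t0) (ltW tx) xp) H.
have : x `^ gam <= t `^ (gam - 1) * x.
  have xt : 0 <= x / t by rewrite divr_ge0 // ltW.
  have := ler_wpM2r xt H; rewrite e2.
  have -> : t / x * x `^ gam * (x / t) = x `^ gam by field; rewrite !gt_eqF.
  by have -> : t `^ gam * (x / t) = t `^ gam / t * x by field; rewrite gt_eqF.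
have := powR_ge0 t gam; lra.
Qed.

Lemma powR_le_1D gam p x : 0 <= gam -> gam <= p -> 0 <= x ->
  x `^ gam <= 1 + x `^ p.
Proof.
move=> g0 gp x0; have [x1|x1] := leP x 1.
  rewrite (@le_trans _ _ 1) ?lerDl ?powR_ge0 //.
  have -> : (1 : R) = 1 `^ gam by rewrite powR1.
  by apply: ge0_ler_powR; rewrite ?nnegrE.
rewrite (@le_trans _ _ (x `^ p)) ?lerDr // ler_powR // ltW //.
Qed.

Lemma flat0_lipschitz x y : `|flat 0 x - flat 0 y| <= 4 * `|x - y|.
Proof.
wlog xy : x y / x < y.
  move=> W; have [xy|yx|->] := ltgtP x y; first exact: W.
    by rewrite distrC [X in _ * X]distrC; exact: W.
  by rewrite !subrr normr0 mulr0.
have D z : z \in `]x, y[ -> is_derive z 1 (flat 0 : R -> R) (flat 2 z).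
  by move=> _; apply: is_derive_eq (is_derive_flat 0 z) _; rewrite mul0r subr0.
have [|c _ e] := MVT xy D; first by apply: continuous_subspaceT; exact: continuous_flat.
rewrite distrC e normrM [X in _ <= _ * X]distrC ler_wpM2r //.
by rewrite ger0_norm ?flat_ge0 // flat2_le4.
Qed.

End power_inequalities.

Section euclidean_norm.
Context {R : realType} {N : nat}.
Local Notation E := 'rV[R]_N.
Implicit Types (v w : E).

Lemma enorm_ge0 v : 0 <= enorm v.
Proof. exact: sqrtr_ge0. Qed.

Lemma enorm_sqr v : enorm v ^+ 2 = \sum_i v ord0 i ^+ 2.
Proof. by rewrite sqr_sqrtr // sumr_ge0 // => i _; exact: sqr_ge0. Qed.

Lemma enorm_coor v i : `|v ord0 i| <= enorm v.
Proof.
rewrite -(@ler_pXn2r _ 2) ?nnegrE ?enorm_ge0 // enorm_sqr real_normK ?num_real //.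
by rewrite (bigD1 i) //= lerDl sumr_ge0 // => j _; exact: sqr_ge0.
Qed.

Lemma enorm_le_sum v : enorm v <= \sum_i `|v ord0 i|.
Proof.
have s0 : 0 <= \sum_i `|v ord0 i| by apply: sumr_ge0.
rewrite -(@ler_pXn2r _ 2) ?nnegrE ?enorm_ge0 // enorm_sqr expr2 mulr_suml.
apply: ler_sum => i _; rewrite -real_normK ?num_real // expr2 ler_wpM2l //.
by rewrite (bigD1 i) //= lerDl sumr_ge0.
Qed.

Lemma enormZ (c : R) v : enorm (c *: v) = `|c| * enorm v.
Proof.
have -> : enorm (c *: v) = Num.sqrt (c ^+ 2 * \sum_i v ord0 i ^+ 2).
  by rewrite mulr_sumr; congr Num.sqrt; apply: eq_bigr => i _; rewrite mxE exprMn.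
by rewrite sqrtrM ?sqr_ge0 // sqrtr_sqr.
Qed.

Lemma cauchy_schwarz v w : \sum_i v ord0 i * w ord0 i <= enorm v * enorm w.
Proof.
have [v0|vn] := eqVneq (enorm v) 0.
  rewrite v0 mul0r big1 // => i _.
  by have := enorm_coor v i; rewrite v0 normr_le0 => /eqP ->; rewrite mul0r.
have [w0|wn] := eqVneq (enorm w) 0.
  rewrite w0 mulr0 big1 // => i _.
  by have := enorm_coor w i; rewrite w0 normr_le0 => /eqP ->; rewrite mulr0.
have v0 : 0 < enorm v by rewrite lt_neqAle eq_sym vn enorm_ge0.
have w0 : 0 < enorm w by rewrite lt_neqAle eq_sym wn enorm_ge0.
set A := enorm v; set B := enorm w.
(* The weights are chosen so that, after summation, each of the two squares contributes
   [A * B / 2]. *)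
have key i : v ord0 i * w ord0 i <= B / (2 * A) * v ord0 i ^+ 2 + A / (2 * B) * w ord0 i ^+ 2.
  rewrite -subr_ge0.
  have -> : B / (2 * A) * v ord0 i ^+ 2 + A / (2 * B) * w ord0 i ^+ 2 - v ord0 i * w ord0 i
    = (2 * A * B)^-1 * (B * v ord0 i - A * w ord0 i) ^+ 2.
    by field; rewrite vn wn.
  by rewrite mulr_ge0 ?sqr_ge0 // invr_ge0 !mulr_ge0 // ltW.
apply: (@le_trans _ _ (\sum_i (B / (2 * A) * v ord0 i ^+ 2 + A / (2 * B) * w ord0 i ^+ 2))).
  exact: ler_sum.
rewrite big_split /= -!mulr_sumr -!enorm_sqr -/A -/B le_eqVlt; apply/orP; left; apply/eqP.
by field; rewrite vn wn.
Qed.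

Lemma enormD v w : enorm (v + w) <= enorm v + enorm w.
Proof.
rewrite -(@ler_pXn2r _ 2) ?nnegrE ?addr_ge0 ?enorm_ge0 //.
rewrite enorm_sqr sqrrD !enorm_sqr.
under eq_bigr do rewrite mxE sqrrD.
rewrite !big_split /= lerD2r lerD2l.
by rewrite mulr2n lerD // cauchy_schwarz.
Qed.

Lemma measurable_enorm (D : set E) (G : E -> E) :
  (forall i, measurable_fun D (fun x => G x ord0 i)) ->
  measurable_fun D (fun x => enorm (G x)).
Proof.
move=> mG; apply: (measurableT_comp (continuous_measurable_fun (@sqrt_continuous R))).
by apply: measurable_sum => i; apply: measurable_funX.
Qed.

End euclidean_norm.

(** * Jensen's inequality and mollification in L^p *)

Section jensen.
Context d (T : measurableType d) {R : realType} (mu : {measure set T -> \bar R}).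

(* Integrates against [k] the tangent inequality of [t `^ p] at the mean. *)
Lemma jensen_powR (p : R) (D : set T) (k h H : T -> R) : 1 < p -> measurable D ->
  (forall x, D x -> 0 <= k x) -> (forall x, D x -> 0 <= h x) ->
  (forall x, D x -> h x `^ p <= H x) ->
  mu.-integrable D (EFin \o k) -> mu.-integrable D (EFin \o (fun x => k x * h x)) ->
  mu.-integrable D (EFin \o (fun x => k x * H x)) ->
  \int[mu]_(x in D) k x = 1 ->
  (\int[mu]_(x in D) (k x * h x)) `^ p <= \int[mu]_(x in D) (k x * H x).
Proof.
move=> p1 mD k0 h0 hH ik ikh ikH k1; have p0 : 0 < p by exact: lt_trans p1.
set c := \int[mu]_(x in D) (k x * h x).
have c0 : 0 <= c by apply: Rintegral_ge0 => x Dx; rewrite mulr_ge0 // ?k0 ?h0.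
have ick (a : R) : mu.-integrable D (EFin \o (fun x => a * k x)).
  rewrite (_ : EFin \o _ = fun x => (a%:E * (EFin \o k) x)%E); first exact: integrableZl.
  by apply/funext => x /=; rewrite EFinM.
have ickh (a : R) : mu.-integrable D (EFin \o (fun x => a * (k x * h x))).
  rewrite (_ : EFin \o _ = fun x => (a%:E * (EFin \o (fun x => k x * h x)%R) x)%E); first exact: integrableZl.
  by apply/funext => x /=; rewrite EFinM.
have : \int[mu]_(x in D) (p * c `^ (p - 1) * (k x * h x)) <=
       \int[mu]_(x in D) (k x * H x + (p - 1) * c `^ p * k x).
  apply: le_Rintegral => //.
    rewrite (_ : EFin \o _ = (EFin \o (fun x => k x * H x)%R) \+ (EFin \o (fun x => (p - 1) * c `^ p * k x)%R))%E //.
    exact: integrableD.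
  move=> x Dx; have := young_tangent p1 (h0 _ Dx) c0.
  move=> /(ler_wpM2l (k0 _ Dx)) => Y.
  have := ler_wpM2l (k0 _ Dx) (hH _ Dx) => Z.
  have -> : p * c `^ (p - 1) * (k x * h x) = k x * (p * (h x * c `^ (p - 1))) by ring.
  rewrite (le_trans Y) // mulrDr lerD // le_eqVlt; apply/orP; left; apply/eqP; ring.
rewrite RintegralD // !RintegralZl // k1 -/c mulr1.
have -> : p * c `^ (p - 1) * c = p * c `^ p by rewrite -(mulr_powRB1 c0 p0); ring.
lra.
Qed.

End jensen.

Section Lp_mollification.
Context {R : realType} {N : nat}.
Local Notation E := 'rV[R]_N.
Local Notation mu := (@lebesgue_rV R N).
Implicit Types (K f : E -> R).

(** Jensen's inequality brings the p-th power inside the average over [h]; [dist_signed_power] then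
    replaces it by a first power of a difference of signed powers, to which [integral_average]
    applies. *)
Lemma Lp_dist_conv K f (p d e : R) : 1 < p -> smooth K -> (forall x, 0 <= K x) -> 0 < d ->
  (forall x, d <= `|x| -> K x = 0) -> \int[mu]_x K x = 1 ->
  mu.-integrable setT (EFin \o f) -> translation_continuous f ->
  mu.-integrable setT (EFin \o (signed_power p \o f)) ->
  (forall h : E, `|h| < d ->
     (L1_dist (fun x => signed_power p (f (x + h)%R)) (signed_power p \o f) <= e%:E)%E) ->
  (\int[mu]_x (`|conv K f x - f x| `^ p)%:E <= (2 `^ p * e)%:E)%E.
Proof.
move=> p1 sK K0 d0 Kd K1 intf tf intg gd; have p0 : 0 < p by exact: lt_trans p1.
set g := signed_power p \o f in intg gd *.
have bK : bounded_support K by exists d.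
have cK := smooth_continuous sK.
have mf := integrable_measurable intf.
have mg := integrable_measurable intg.
have iK := bounded_support_integrable cK bK.
have [mG HG] := integral_average cK K0 d0 Kd K1 mg gd.
set G := (fun z : E * E => _) in mG HG.
have G0 z : (0 <= G z)%E by rewrite lee_fin mulr_ge0.
have mF := measurable_fun_fubini_tonelli_F _ mG G0.
rewrite EFinM; apply: (@le_trans _ _ ((2 `^ p)%:E * \int[mu]_x \int[mu]_h G (x, h))%E); last first.
  by rewrite lee_wpmul2l // lee_fin powR_ge0.
rewrite -ge0_integralZl //; first last.
- by move=> x _; exact: integral_ge0.
- exact: mF.
apply: ge0_le_integral => //.
- apply/measurable_EFinP; apply: (measurableT_comp (measurable_powR p)).
  apply: measurableT_comp => //; apply: measurable_funB => //.
  by apply: rV_continuous_measurable; exact: continuous_conv.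
- by apply: emeasurable_funM => //; exact: mF.
move=> x _.
have ish (k : E -> R) : mu.-integrable setT (EFin \o k) ->
    mu.-integrable setT (EFin \o (fun h => K h * (k (x + h) - k x))).
  move=> ik.
  have i1 : mu.-integrable setT (EFin \o (fun h => K h * k (x + h))).
    apply: (@integrable_bounded_mul _ _ K (fun h => k (x + h))) => //.
    by under eq_fun do rewrite addrC; exact: integrable_translate.
  have i2 : mu.-integrable setT (EFin \o (fun h => K h * k x)).
    rewrite (_ : EFin \o _ = (EFin \o K) \* cst (k x)%:E)%E; last by apply/funext => y /=; rewrite EFinM.
    exact: integrableZr.
  rewrite (_ : EFin \o _ = (EFin \o (fun h => K h * k (x + h))%R) \- (EFin \o (fun h => K h * k x)%R))%E.
    exact: integrableB.
  by apply/funext => h /=; rewrite -EFinB mulrBr.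
have iabs (k : E -> R) : mu.-integrable setT (EFin \o k) ->
    mu.-integrable setT (EFin \o (fun h => K h * `|k (x + h) - k x|)).
  move=> /ish/integrable_norm; apply: eq_integrable => // h _ /=.
  by rewrite normrM ger0_norm.
have eC : `|conv K f x - f x| <= \int[mu]_h (K h * `|f (x + h) - f x|).
  rewrite convE //.
  have -> : f x = \int[mu]_h (K h * f x) by rewrite RintegralZr // K1 mul1r.
  rewrite RintegralZr // K1 mul1r.
  have -> : \int[mu]_h (K h * f (x + h)) - f x = \int[mu]_h (K h * (f (x + h) - f x)).
    under [RHS]eq_Rintegral do rewrite mulrBr.
    rewrite RintegralB //; first by rewrite RintegralZr // K1 mul1r.
      apply: (@integrable_bounded_mul _ _ K (fun h => f (x + h))) => //.
      by under eq_fun do rewrite addrC; exact: integrable_translate.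
    rewrite (_ : EFin \o _ = (EFin \o K) \* cst (f x)%:E)%E; last by apply/funext => y /=; rewrite EFinM.
    exact: integrableZr.
  apply: le_trans (le_normr_Rintegral _ _) _ => //; first exact: ish.
  rewrite le_eqVlt; apply/orP; left; apply/eqP; apply: eq_Rintegral => h _.
  by rewrite normrM ger0_norm.
have iG := iabs _ intg.
have J := @jensen_powR _ _ _ mu p setT K (fun h => `|f (x + h) - f x|)
  (fun h => 2 `^ p * `|g (x + h) - g x|) p1 measurableT.
have {}J : (\int[mu]_h (K h * `|f (x + h) - f x|)) `^ p <= \int[mu]_h (K h * (2 `^ p * `|g (x + h) - g x|)).
  apply: J => //; last 2 first.
  - exact: iabs.
  - rewrite (_ : EFin \o _ = (fun h => (2 `^ p)%:E * (EFin \o (fun h => K h * `|g (x + h) - g x|)%R) h)%E).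
      exact: integrableZl.
    by apply/funext => h /=; rewrite -EFinM mulrCA.
  by move=> h _; apply: dist_signed_power; exact: ltW.
apply: (@le_trans _ _ (\int[mu]_h (K h * (2 `^ p * `|g (x + h) - g x|)))%:E).
  rewrite lee_fin (le_trans _ J) //; apply: ge0_ler_powR; rewrite ?nnegrE ?(ltW p0) //.
  by apply: Rintegral_ge0 => h _; rewrite mulr_ge0.
under eq_Rintegral do rewrite mulrCA.
rewrite RintegralZl // EFinM /Rintegral fineK //.
by apply: integrable_fin_num => //.
Qed.

End Lp_mollification.

(** * The potential: Hölder bound, concavity and growth; the regularized sign *)

Section potential.
Context {R : realType}.
Implicit Types (gam lamp lamm s t p a b : R).

Lemma Fgamma_ge0 gam lamp lamm t : 0 <= lamp -> 0 <= lamm -> 0 <= Fgamma gam lamp lamm t.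
Proof. by move=> l1 l2; rewrite addr_ge0 // mulr_ge0 // powR_ge0. Qed.

Lemma Fgamma_le gam lamp lamm p t : 0 <= lamp -> 0 <= lamm -> 0 <= gam -> gam <= p ->
  Fgamma gam lamp lamm t <= (lamp + lamm) * (1 + `|t| `^ p).
Proof.
move=> l1 l2 g0 gp; rewrite mulrDl; apply: lerD; rewrite ler_wpM2l //.
  apply: le_trans (powR_le_1D g0 gp (normr_ge0 t)).
  apply: ge0_ler_powR; rewrite ?nnegrE //; first by rewrite le_max lexx orbT.
  by rewrite ge_max ler_norm normr_ge0.
apply: le_trans (powR_le_1D g0 gp (normr_ge0 t)).
apply: ge0_ler_powR; rewrite ?nnegrE //; first by rewrite le_max lexx orbT.
by rewrite ge_max normr_ge0 andbT -normrN ler_norm.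
Qed.

Lemma Fgamma_hoelder gam lamp lamm a b : 0 <= lamp -> 0 <= lamm -> 0 < gam <= 1 ->
  Fgamma gam lamp lamm a <= Fgamma gam lamp lamm b + (lamp + lamm) * `|a - b| `^ gam.
Proof.
move=> l1 l2 g; have /andP[g0 g1] := g.
have key x y : Num.max x 0 `^ gam <= Num.max y 0 `^ gam + `|x - y| `^ gam.
  have y0 : 0 <= Num.max y 0 by rewrite le_max lexx orbT.
  apply: le_trans (powR_subadditive g y0 (normr_ge0 _)).
  apply: ge0_ler_powR; rewrite ?nnegrE ?addr_ge0 ?(ltW g0) //.
    by rewrite le_max lexx orbT.
  rewrite ge_max addr_ge0 // andbT.
  have := ler_norm (x - y); have : y <= Num.max y 0 by rewrite le_max lexx.
  lra.
have H1 := ler_wpM2l l1 (key a b).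
have H2 := ler_wpM2l l2 (key (- a) (- b)).
have e : `|- a - - b| = `|a - b| by rewrite -opprD normrN.
rewrite e in H2; rewrite /Fgamma; nra.
Qed.

Lemma Fgamma'_gt0 gam lamp lamm t : 0 < t ->
  Fgamma' gam lamp lamm t = gam * (lamp * t `^ (gam - 1)).
Proof.
move=> t0; rewrite /Fgamma' !indicE mem_set // memNset /= ?mulr1 ?mulr0 ?subr0 //.
by apply/negP; rewrite -leNgt ltW.
Qed.

Lemma Fgamma'_lt0 gam lamp lamm t : t < 0 ->
  Fgamma' gam lamp lamm t = - (gam * (lamm * (- t) `^ (gam - 1))).
Proof.
move=> t0; rewrite /Fgamma' !indicE memNset /= ?mem_set // ?mulr1 ?mulr0 ?sub0r ?mulrN //.
by apply/negP; rewrite -leNgt ltW.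
Qed.

Lemma Fgamma'_0 gam lamp lamm : Fgamma' gam lamp lamm 0 = 0.
Proof. by rewrite /Fgamma' !indicE !memNset /= ?ltxx // !mulr0 subr0 mulr0. Qed.

Lemma FgammaN gam lamp lamm t : Fgamma gam lamp lamm (- t) = Fgamma gam lamm lamp t.
Proof. by rewrite /Fgamma opprK addrC. Qed.

Lemma Fgamma'N gam lamp lamm t : Fgamma' gam lamp lamm (- t) = - Fgamma' gam lamm lamp t.
Proof.
have [t0|t0|<-] := ltgtP 0 t; last by rewrite oppr0 !Fgamma'_0 oppr0.
  by rewrite [LHS]Fgamma'_lt0 ?oppr_lt0 // Fgamma'_gt0 // opprK.
by rewrite [LHS]Fgamma'_gt0 ?oppr_gt0 // Fgamma'_lt0 // opprK.
Qed.

(* It vanishes on [-d, d], since [flat] vanishes on the negative half-line. *)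
Definition soft_sign (d t : R) : R := flat 0 (t / d - 1) - flat 0 (- t / d - 1).

Lemma soft_sign_ge0E (d t : R) : 0 < d -> 0 <= t -> soft_sign d t = flat 0 (t / d - 1).
Proof.
move=> d0 t0; rewrite /soft_sign [X in _ - X]flat_le0E ?subr0 //.
by rewrite mulNr; have := divr_ge0 t0 (ltW d0); lra.
Qed.

Lemma soft_signN (d t : R) : soft_sign d (- t) = - soft_sign d t.
Proof. by rewrite /soft_sign opprK opprB. Qed.

Lemma normr_soft_sign_le1 (d t : R) : 0 < d -> `|soft_sign d t| <= 1.
Proof.
move=> d0; wlog t0 : t / 0 <= t.
  move=> W; have [/W//|t0] := leP 0 t.
  by rewrite -normrN -soft_signN; apply: W; rewrite oppr_ge0 ltW.
by rewrite soft_sign_ge0E // ger0_norm ?flat_ge0 // flat0_le1.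
Qed.

(** Each of the two [flat 0] terms contributes [4 / d]. *)
Lemma soft_sign_lipschitz (d a b : R) : 0 < d ->
  `|soft_sign d a - soft_sign d b| <= 8 / d * `|a - b|.
Proof.
move=> d0; rewrite /soft_sign.
have -> : flat 0 (a / d - 1) - flat 0 (- a / d - 1) - (flat 0 (b / d - 1) - flat 0 (- b / d - 1)) =
  (flat 0 (a / d - 1) - flat 0 (b / d - 1)) - (flat 0 (- a / d - 1) - flat 0 (- b / d - 1)) by ring.
apply: le_trans (ler_normB _ _) _.
have H1 := flat0_lipschitz (a / d - 1) (b / d - 1).
have H2 := flat0_lipschitz (- a / d - 1) (- b / d - 1).
have e1 : `|a / d - 1 - (b / d - 1)| = `|a - b| / d.
  rewrite (_ : a / d - 1 - (b / d - 1) = (a - b) / d); last by ring.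
  by rewrite normrM normfV (gtr0_norm d0).
have e2 : `|- a / d - 1 - (- b / d - 1)| = `|a - b| / d.
  rewrite (_ : - a / d - 1 - (- b / d - 1) = - ((a - b) / d)); last by ring.
  by rewrite normrN normrM normfV (gtr0_norm d0).
rewrite e1 in H1; rewrite e2 in H2; lra.
Qed.

(** Where [soft_sign d t] is not 0 one has [|t| > d]; since [s <= d] and [|soft_sign d t| <= 1], the
    displaced point does not cross 0, and the tangent inequality of the concave branch applies. The
    singularity of the derivative at 0 is never met. *)
Lemma Fgamma_concave gam lamp lamm (d s t : R) : 0 <= lamp -> 0 <= lamm ->
  0 < gam < 1 -> 0 < d -> 0 <= s -> s <= d ->
  Fgamma gam lamp lamm (t - s * soft_sign d t) +
    s * (`|soft_sign d t| * `|Fgamma' gam lamp lamm t|) <= Fgamma gam lamp lamm t.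
Proof.
move=> l1 l2 g d0 s0 sd; have /andP[g0 g1] := g.
(* Changing the sign of [t] exchanges [lamp] and [lamm], so both are generalized here. *)
wlog t0 : lamp lamm l1 l2 t / 0 <= t.
  move=> W; have [t0|t0] := leP 0 t; first exact: W.
  have := W lamm lamp l2 l1 (- t); rewrite oppr_ge0 (ltW t0) => /(_ isT).
  rewrite (_ : - t - s * soft_sign d (- t) = - (t - s * soft_sign d t)); last by rewrite soft_signN; ring.
  by rewrite !FgammaN soft_signN Fgamma'N !normrN.
have S0 : 0 <= soft_sign d t by rewrite soft_sign_ge0E // flat_ge0.
have [td|dt] := leP t d.
  have -> : soft_sign d t = 0.
    by rewrite soft_sign_ge0E // flat_le0E // subr_le0 ler_pdivrMr // mul1r.
  by rewrite mulr0 subr0 normr0 mul0r mulr0 addr0.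
have t1 : 0 < t by exact: lt_trans dt.
set z := s * soft_sign d t.
have z0 : 0 <= z by rewrite mulr_ge0.
have zt : z <= t.
  have : soft_sign d t <= 1 by apply: le_trans (ler_norm _) (normr_soft_sign_le1 _ d0).
  rewrite /z; nra.
have C := powR_tangent_concave g t1 z0 zt.
rewrite Fgamma'_gt0 // (ger0_norm S0) ger0_norm ?mulr_ge0 ?powR_ge0 ?(ltW g0) //.
have -> : s * (soft_sign d t * (gam * (lamp * t `^ (gam - 1)))) = lamp * (z * (gam * t `^ (gam - 1))) by rewrite /z; ring.
rewrite -/z /Fgamma.
have -> : Num.max (t - z) 0 = t - z by rewrite max_l // subr_ge0.
have -> : Num.max (- (t - z)) 0 = 0 by rewrite max_r // oppr_le0 subr_ge0.
have -> : Num.max t 0 = t by rewrite max_l.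
have -> : Num.max (- t) 0 = 0 by rewrite max_r // oppr_le0.
have := ler_wpM2l l1 C; rewrite mulrDr; lra.
Qed.

Lemma Fgamma'_bound gam lamp lamm p t : 0 <= lamp -> 0 <= lamm -> 1 <= gam -> gam < p ->
  `|Fgamma' gam lamp lamm t| <= gam * (lamp + lamm) * (1 + `|t| `^ p).
Proof.
move=> l1 l2 g1 gp.
have g0 : 0 <= gam by exact: le_trans g1.
wlog t0 : lamp lamm l1 l2 t / 0 <= t.
  move=> W; have [t0|t0] := leP 0 t; first exact: W.
  have := W lamm lamp l2 l1 (- t); rewrite oppr_ge0 (ltW t0) => /(_ isT).
  by rewrite Fgamma'N !normrN [lamm + _]addrC.
have A0 : 0 <= 1 + `|t| `^ p by rewrite addr_ge0 // powR_ge0.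
have [->|tn] := eqVneq t 0.
  by rewrite Fgamma'_0 normr0 mulr_ge0 // ?mulr_ge0 ?addr_ge0 ?powR_ge0.
have t1 : 0 < t by rewrite lt_neqAle eq_sym tn.
rewrite Fgamma'_gt0 // ger0_norm ?mulr_ge0 ?powR_ge0 // -mulrA ler_wpM2l //.
have g10 : 0 <= gam - 1 by rewrite subr_ge0.
have gp1 : gam - 1 <= p by lra.
have := powR_le_1D g10 gp1 t0; rewrite (ger0_norm t0) in A0 *.
nra.
Qed.

Lemma measurable_Fgamma gam lamp lamm : measurable_fun setT (Fgamma gam lamp lamm).
Proof.
apply: measurable_funD; apply: measurable_funM => //.
  apply: (measurableT_comp (measurable_powR gam)); exact: measurable_maxr.
apply: (measurableT_comp (measurable_powR gam)); apply: measurable_maxr => //.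
Qed.

Lemma measurable_Fgamma' gam lamp lamm : measurable_fun setT (Fgamma' gam lamp lamm).
Proof.
have m0 : measurable [set s : R | 0 < s].
  rewrite (_ : [set s : R | 0 < s] = `]0, +oo[%classic) //.
  by apply/seteqP; split => s /=; rewrite in_itv /= andbT.
have m1 : measurable [set s : R | s < 0].
  rewrite (_ : [set s : R | s < 0] = `]-oo, 0[%classic) //.
apply: measurable_funM => //; apply: measurable_funB.
  apply: measurable_funM; last exact: measurable_indic.
  by apply: measurable_funM => //; exact: measurable_powR.
apply: measurable_funM; last exact: measurable_indic.
apply: measurable_funM => //; apply: (measurableT_comp (measurable_powR (gam - 1))).
exact: oppr_measurable.
Qed.

End potential.

(** * Sobolev functions and the energy *)

Section sobolev_facts.
Context {R : realType} {N : nat}.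
Local Notation E := 'rV[R]_N.
Local Notation mu := (@lebesgue_rV R N).
Implicit Types (f g u phi : E -> R) (x : E) (i : 'I_N) (Omega D : set E) (p : R).

Lemma LpP Omega p f : measurable Omega -> 0 < p -> measurable_fun Omega f ->
  Lp Omega p f <-> (\int[mu]_(x in Omega) (`|f x| `^ p)%:E < +oo)%E.
Proof.
move=> mO p0 mf; rewrite /Lp /finite_norm unlock.
have -> : (\int[mu]_x `|(EFin \o f \_ Omega) x| `^ p = \int[mu]_(x in Omega) (`|f x| `^ p)%:E)%E.
  rewrite [RHS]integral_mkcond; apply: eq_integral => x _; rewrite /= !patchE.
  by case: ifP => // _; rewrite normr0 /= powR0 ?gt_eqF.
have pi : p^-1 != 0 by rewrite invr_eq0 gt_eqF.
split => [[_ /(lty_poweRy pi)//]|h]; split => //.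
exact: poweR_lty.
Qed.

Lemma Lp_bounded D p f (M : R) : measurable D -> (mu D < +oo)%E -> 0 < p ->
  measurable_fun D f -> (forall x, `|f x| <= M) -> Lp D p f.
Proof.
move=> mD Dfin p0 mf fM; apply/LpP => //.
apply: (@le_lt_trans _ _ (\int[mu]_(x in D) (M `^ p)%:E)%E).
  apply: ge0_le_integral => //.
  - apply/measurable_EFinP; apply: (measurableT_comp (measurable_powR p)).
    exact: measurableT_comp.
  - move=> x _; rewrite lee_fin; apply: ge0_ler_powR; rewrite ?nnegrE ?(ltW p0) //.
    by apply: le_trans (fM x).
by rewrite integral_cst // lte_mul_pinfty // ?lee_fin ?powR_ge0.
Qed.

Lemma weak_gradient_ae Omega u (G : E -> E) : open Omega -> is_weak_gradient Omega u G ->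
  {ae mu, forall x, Omega x -> weak_gradient Omega u x = G x}.
Proof.
move=> oO HG; have HW := is_weak_gradient_weak_gradient HG.
have : {ae mu, forall x, forall i, Omega x -> weak_gradient Omega u x ord0 i = G x ord0 i}.
  apply: filter_forall => i; apply: negligibleS (weak_gradient_unique i oO HW HG).
  move=> x /= /not_implyP[Ox /eqP GH]; split => //.
by apply: filterS => x H Ox; apply/rowP => i; exact: H.
Qed.

Lemma weak_gradient_measurable Omega u (G : E -> E) : is_weak_gradient Omega u G ->
  forall i, measurable_fun Omega (fun x => G x ord0 i).
Proof. by move=> [_ HG] i; have [[]] := HG i. Qed.

Lemma W1p_test Omega p phi : open Omega -> (mu Omega < +oo)%E -> 0 < p ->
  test_function Omega phi -> W1p Omega p phi.
Proof.
move=> oO Ofin p0 tphi; have sphi := test_function_smooth tphi.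
have bphi := test_function_bounded_support tphi.
have mO := rV_open_measurable oO.
have H f : smooth f -> bounded_support f -> Lp Omega p f.
  move=> sf bf; have [M _ fM] := bounded_support_bounded (smooth_continuous sf) bf.
  apply: Lp_bounded fM => //; apply: measurable_funTS.
  exact: rV_continuous_measurable (smooth_continuous sf).
split; first exact: H.
exists (gradient phi); split; first exact: smooth_is_weak_gradient.
move=> i; rewrite (_ : (fun x => _) = partial i phi); last by apply/funext => x; rewrite mxE.
by apply: H; [exact: smooth_partial | exact: bounded_support_partial].
Qed.

(** A test function approximates itself. It remains to see that the zero function has norm 0, which
    uses uniqueness, since its selected weak gradient is 0 only almost everywhere. *)
Lemma W1p0_test Omega p phi : open Omega -> (mu Omega < +oo)%E -> 0 < p ->
  test_function Omega phi -> W1p0 Omega p phi.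
Proof.
move=> oO Ofin p0 tphi; split; first exact: W1p_test.
move=> e e0; exists phi => //.
have mO := rV_open_measurable oO.
have -> : phi \- phi = cst 0 by apply/funext => x /=; rewrite subrr.
have HG : is_weak_gradient Omega (cst 0) (gradient (cst 0 : E -> R)).
  by apply: smooth_is_weak_gradient; exact: smooth_cst.
have HW := is_weak_gradient_weak_gradient HG.
have AE := weak_gradient_ae oO HG.
rewrite /W1p_norm (_ : integral _ _ _ = 0%E); first by rewrite poweR0r ?lte_fin // invr_eq0 gt_eqF.
rewrite -(integral0 mu Omega).
apply: ae_eq_integral => //.
  apply/measurable_EFinP; apply: measurable_funD.
    by apply: (measurableT_comp (measurable_powR p)); exact: measurableT_comp.
  apply: (measurableT_comp (measurable_powR p)).
  by apply: measurable_enorm; exact: weak_gradient_measurable HW.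
apply: filterS AE => x H Ox; rewrite H // normr0 powR0 ?gt_eqF // add0r.
rewrite (_ : enorm _ = 0) ?powR0 ?gt_eqF //.
rewrite /enorm big1 ?sqrtr0 // => i _.
by rewrite mxE /partial derive_cst expr0n.
Qed.

Lemma measurable_energy_density Omega p gam lamp lamm u (G : E -> E) :
  measurable_fun Omega u -> (forall i, measurable_fun Omega (fun x => G x ord0 i)) ->
  measurable_fun Omega (fun x => enorm (G x) `^ p / p + Fgamma gam lamp lamm (u x)).
Proof.
move=> mu_ mG; apply: measurable_funD.
  apply: measurable_funM => //; apply: (measurableT_comp (measurable_powR p)).
  exact: measurable_enorm.
exact: (measurableT_comp (measurable_Fgamma gam lamp lamm)).
Qed.

(** Frees the energy from the choice made by [weak_gradient]: the explicit gradient of the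
    competitor can be used. *)
Lemma energyE Omega p gam lamp lamm u (G : E -> E) : open Omega ->
  is_weak_gradient Omega u G ->
  energy Omega p gam lamp lamm u =
  (\int[mu]_(x in Omega) (enorm (G x) `^ p / p + Fgamma gam lamp lamm (u x))%:E)%E.
Proof.
move=> oO HG; have mO := rV_open_measurable oO.
have HW := is_weak_gradient_weak_gradient HG.
have [[mu_ _] _] := HG.
apply: ae_eq_integral => //.
- apply/measurable_EFinP; apply: measurable_energy_density => //.
  exact: weak_gradient_measurable HW.
- apply/measurable_EFinP; apply: measurable_energy_density => //.
  exact: weak_gradient_measurable HG.
by apply: filterS (weak_gradient_ae oO HG) => x H Ox; rewrite H.
Qed.

Lemma W1p_enorm_lty Omega p u : open Omega -> 0 < p -> W1p Omega p u ->
  let G := weak_gradient Omega u in is_weak_gradient Omega u G /\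
  (forall i, (\int[mu]_(x in Omega) (`|G x ord0 i| `^ p)%:E < +oo)%E) /\
  (\int[mu]_(x in Omega) (enorm (G x) `^ p)%:E < +oo)%E.
Proof.
move=> oO p0 [_ [H [HH LH]]] G; have mO := rV_open_measurable oO.
have HG := is_weak_gradient_weak_gradient HH.
have mG := weak_gradient_measurable HG; have mH := weak_gradient_measurable HH.
have mp (k : E -> R) : measurable_fun Omega k ->
    measurable_fun Omega (fun x => (`|k x| `^ p)%:E).
  move=> mk; apply/measurable_EFinP; apply: (measurableT_comp (measurable_powR p)).
  exact: measurableT_comp.
have fin i : (\int[mu]_(x in Omega) (`|G x ord0 i| `^ p)%:E < +oo)%E.
  rewrite (@ae_eq_integral _ _ _ mu Omega (fun x => (`|H x ord0 i| `^ p)%:E)) //.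
  - by apply/(LpP _ _ _).1.
  - exact: mp.
  - exact: mp.
  - by apply: filterS (weak_gradient_ae oO HH) => x e Ox; rewrite /G e.
split => //; split => //.
have [C C0 HC] := powR_sum_le (index_enum 'I_N) (ltW p0).
apply: (@le_lt_trans _ _ (\int[mu]_(x in Omega) (C%:E * \sum_i (`|G x ord0 i| `^ p)%:E))%E).
  apply: ge0_le_integral => //.
  - by move=> x _; rewrite lee_fin powR_ge0.
  - apply/measurable_EFinP; apply: (measurableT_comp (measurable_powR p)).
    exact: measurable_enorm.
  - by apply: emeasurable_funM => //; apply: emeasurable_sum => i; exact: mp.
  - move=> x _; rewrite sumEFin -EFinM lee_fin.
    have := HC (fun i => `|G x ord0 i|) (fun i => normr_ge0 _).
    rewrite powR0 ?gt_eqF // add0r; apply: le_trans.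
    by apply: ge0_ler_powR; rewrite ?nnegrE ?enorm_ge0 ?(ltW p0) ?enorm_le_sum // sumr_ge0.
rewrite ge0_integralZl //; last 2 first.
- by apply: emeasurable_sum => i; exact: mp.
- by move=> x _; apply: sume_ge0 => i _; rewrite lee_fin powR_ge0.
rewrite ge0_integral_sum //; last by move=> i; exact: mp.
rewrite lte_mul_pinfty //.
by apply: lte_sum_pinfty => i _; exact: fin.
Qed.

Lemma energy_lty Omega p gam lamp lamm u : open Omega -> (mu Omega < +oo)%E ->
  1 < p -> 0 < gam -> gam < p -> 0 < lamp -> 0 < lamm -> W1p Omega p u ->
  (energy Omega p gam lamp lamm u < +oo)%E.
Proof.
move=> oO Ofin p1 g0 gp l1 l2 Wu; have p0 : 0 < p by exact: lt_trans p1.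
have mO := rV_open_measurable oO.
have [HG [_ fG]] := W1p_enorm_lty oO p0 Wu.
have mG := weak_gradient_measurable HG.
have [Lu _] := Wu; have mu_ : measurable_fun Omega u by case: Lu.
have {}Lu := (LpP mO p0 mu_).1 Lu.
have mup : measurable_fun Omega (fun x => (`|u x| `^ p)%:E).
  apply/measurable_EFinP; apply: (measurableT_comp (measurable_powR p)).
  exact: measurableT_comp.
have mGp : measurable_fun Omega (fun x => (enorm (weak_gradient Omega u x) `^ p)%:E).
  apply/measurable_EFinP; apply: (measurableT_comp (measurable_powR p)).
  exact: measurable_enorm.
have l0 : 0 <= lamp + lamm by rewrite addr_ge0 // ltW.
apply: (@le_lt_trans _ _ (\int[mu]_(x in Omega)
   ((enorm (weak_gradient Omega u x) `^ p)%:E + (lamp + lamm)%:E * (1 + (`|u x| `^ p)%:E)))%E).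
  apply: ge0_le_integral => //.
  - by move=> x _; rewrite lee_fin addr_ge0 ?Fgamma_ge0 ?(ltW l1) ?(ltW l2) // divr_ge0 ?powR_ge0 // ltW.
  - by apply/measurable_EFinP; exact: measurable_energy_density.
  - apply: emeasurable_funD => //; apply: emeasurable_funM => //.
    exact: emeasurable_funD.
  - move=> x _.
    have h : enorm (weak_gradient Omega u x) `^ p / p + Fgamma gam lamp lamm (u x) <=
        enorm (weak_gradient Omega u x) `^ p + (lamp + lamm) * (1 + `|u x| `^ p).
      apply: lerD; last by apply: Fgamma_le => //; exact: ltW.
      by rewrite ler_pdivrMr // ler_peMr ?powR_ge0 // ltW.
    by move: h; rewrite -lee_fin [leRHS]EFinD EFinM EFinD.
rewrite ge0_integralD //; first last.
- by apply: emeasurable_funM => //; exact: emeasurable_funD.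
- by move=> x _; rewrite mule_ge0 // ?lee_fin // adde_ge0 // lee_fin powR_ge0.
- by move=> x _; rewrite lee_fin powR_ge0.
rewrite lte_add_pinfty // ge0_integralZl //; first last.
- by move=> x _; rewrite adde_ge0 // lee_fin powR_ge0.
- exact: emeasurable_funD.
rewrite ge0_integralD // lte_mul_pinfty //.
by rewrite lte_add_pinfty // integral_cst // mul1e.
Qed.

End sobolev_facts.

(** * Comparison with the competitor *)

Section local_approximation.
Context {R : realType} {N : nat}.
Local Notation E := 'rV[R]_N.
Local Notation mu := (@lebesgue_rV R N).
Implicit Types (f g u v phi : E -> R) (x : E) (i : 'I_N) (Omega D : set E) (p : R).

(** The derivative of the kernel is a derivative of the test function [fun y => K (y - x)], and the
    definition of the weak gradient transfers it to [u]; the two minus signs cancel. *)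
Lemma partial_conv_restrict Omega u (G : E -> E) (K : E -> R) x0 x (r d : R) i :
  open Omega -> is_weak_gradient Omega u G -> closed_ball x0 r `<=` Omega ->
  smooth K -> 0 < d -> d + d <= r -> (forall y, d / 2 <= `|y| -> K y = 0) ->
  ball x0 d x ->
  partial i (conv K (u \_ (ball x0 r))) x = conv K ((fun y => G y ord0 i) \_ (ball x0 r)) x.
Proof.
move=> oO HG rO sK d0 dr Kd xd.
have mO := rV_open_measurable oO.
have [Lu HGi] := HG; have [LG IG] := HGi i.
have [iu tu] := L1loc_restrict_ball Lu rO.
have d20 : 0 < d / 2 by rewrite divr_gt0.
have bK : bounded_support K by exists (d / 2).
have Kd' y : d <= `|y| -> K y = 0.
  by move=> dy; apply: Kd; apply: le_trans dy; rewrite ler_pdivrMr // ler_pMr // ler1n.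
(* [K] vanishes from radius [d / 2] on, hence on a whole ball around such a [y], as the vanishing of
   a derivative requires. *)
have pKd y : d <= `|y| -> (- partial i K) y = 0.
  move=> dy; rewrite /GRing.opp /= partial_vanish ?oppr0 //.
  have : nbhs y (ball y (d / 2)) by exact: nbhsx_ballx.
  apply: filterS => z; rewrite -ball_normE /= => yz; apply: Kd.
  have := ler_distD z y 0; rewrite !subr0 => h; lra.
have sub : ball x0 r `<=` Omega by apply: subset_trans rO; exact: subset_closed_ball.
have spK : smooth (- partial i K) by apply: smoothN; exact: smooth_partial.
rewrite {1}/partial; have [_ ->] := is_derive_conv i x sK bK iu.
rewrite (conv_restrict_ball u spK d0 pKd dr xd sub).
rewrite (conv_restrict_ball (fun y => G y ord0 i) sK d0 Kd' dr xd sub).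
have tK := ball_translate_test sK d0 Kd' dr xd rO.
have ip := integrable_mul_partial_test i oO Lu tK.
have e y : partial i (fun y => K (y - x)) y = partial i K (y - x) by exact: partial_translate.
have E1 : \int[mu]_(y in Omega) (u y * (- partial i K) (y - x)) =
    \int[mu]_(y in Omega) (-1 * (u y * partial i (fun y => K (y - x)) y)).
  by apply: eq_Rintegral => y _; rewrite e /GRing.opp /= mulrN mulN1r.
by rewrite E1 RintegralZl // (IG _ tK) mulN1r opprK.
Qed.

Lemma exists_common_radius (P : 'I_N -> R -> Prop) (c : R) : 0 < c ->
  (forall i (d d' : R), d' <= d -> P i d -> P i d') ->
  (forall i, exists2 d : R, 0 < d & P i d) ->
  exists2 d : R, 0 < d & d <= c /\ forall i, P i d.
Proof.
move=> c0 Pm HP.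
have /choice[dd Hd] : forall i, exists d : R, 0 < d /\ P i d.
  by move=> i; have [d d0 Pd] := HP i; exists d.
exists (\big[Num.min/c]_i dd i).
  by apply: lt_bigmin => // i _; have [] := Hd i.
split; first exact: bigmin_le_id.
by move=> i; apply: (Pm i (dd i)); [exact: bigmin_le | have [] := Hd i].
Qed.

(** The gradient is controlled on the half ball only: closer to the sphere the derivative of [v]
    sees the jump created by restricting [u] to the ball, while [v] itself stays close to [u] in
    L^1. *)
Lemma mollify_sobolev Omega u (G : E -> E) x0 (r p e : R) :
  open Omega -> is_weak_gradient Omega u G -> 1 < p ->
  (forall i, (\int[mu]_(x in Omega) (`|G x ord0 i| `^ p)%:E < +oo)%E) ->
  0 < r -> closed_ball x0 r `<=` Omega -> 0 < e ->
  exists v : E -> R, [/\ smooth v,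
    (\int[mu]_(x in ball x0 r) `|u x - v x|%:E <= e%:E)%E &
    forall i, (\int[mu]_(x in ball x0 (r / 2)) (`|G x ord0 i - partial i v x| `^ p)%:E <= e%:E)%E].
Proof.
move=> oO HG p1 fG r0 rO e0; have p0 : 0 < p by exact: lt_trans p1.
have mO := rV_open_measurable oO.
have [Lu HGi] := HG.
have [iu tu] := L1loc_restrict_ball Lu rO.
have sub : ball x0 r `<=` Omega by apply: subset_trans rO; exact: subset_closed_ball.
have mQ := rV_ball_measurable x0 r; have mB := rV_ball_measurable x0 (r / 2).
have LG i := (HGi i).1.
have iG i := (L1loc_restrict_ball (LG i) rO).1.
have tG i := (L1loc_restrict_ball (LG i) rO).2.
pose g i : E -> R := signed_power p \o ((fun y => G y ord0 i) \_ (ball x0 r)).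
have sp0 : signed_power p 0 = 0 :> R by rewrite /signed_power mulr0.
have gE i : g i = (fun y => signed_power p (G y ord0 i)) \_ (ball x0 r).
  by apply/funext => y; rewrite /g /= !patchE; case: ifP.
have msp : measurable_fun setT (signed_power p : R -> R).
  apply: measurable_funM => //; apply: (measurableT_comp (measurable_powR (p - 1))).
  exact: normr_measurable.
have isQ i : mu.-integrable (ball x0 r) (EFin \o (fun y => signed_power p (G y ord0 i))).
  apply: (@integrableS _ _ _ mu Omega) => //; apply/integrableP; split.
    apply/measurable_EFinP; apply: (measurableT_comp msp); exact: (LG i).1.
  apply: le_lt_trans (fG i); rewrite le_eqVlt; apply/orP; left; apply/eqP.
  by apply: eq_integral => y _; rewrite /= normr_signed_power.
have ig i : mu.-integrable setT (EFin \o g i).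
  by rewrite gE -restrict_EFin; apply/(integrable_mkcond _ mQ).
have tg i : translation_continuous (g i).
  rewrite gE; apply: translation_continuous_integrable => //; first exact: ball_open.
  exact: lebesgue_rV_ball_lty.
(* The divisor compensates the factor [2 ^ p] lost in [Lp_dist_conv]. *)
have e2 : 0 < e / 2 `^ p by rewrite divr_gt0 // powR_gt0.
have [d1 d10 hd1] := tu _ e0.
pose P i (d : R) := forall h : E, `|h| < d -> (L1_dist (fun x => (g i (x + h))%R) (g i) <= (e / 2 `^ p)%:E)%E.
have c0 : 0 < Num.min d1 (r / 2) by rewrite lt_min d10 divr_gt0.
have [||d d0 [dc Pd]] := @exists_common_radius P _ c0.
- by move=> i d d' dd' Pd h hd'; apply: Pd; exact: lt_le_trans dd'.
- by move=> i; have [d d0 hd] := tg i _ e2; exists d.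
move: dc; rewrite le_min => /andP[dd1 dr2].
have dr : r / 2 + r / 2 <= r by rewrite -splitr.
have d20 : 0 < d / 2 by rewrite divr_gt0.
have [K [sK K0 Kd K1]] := @exists_mollifier R N _ d20.
have dd2 : d / 2 <= d by rewrite ler_pdivrMr // ler_pMr // ler1n.
have Kd' y : d <= `|y| -> K y = 0 by move=> dy; apply: Kd; exact: le_trans dy.
exists (conv K (u \_ (ball x0 r))); split.
- by apply: smooth_conv => //; exists (d / 2).
- have sv : smooth (conv K (u \_ (ball x0 r))) by apply: smooth_conv => //; exists (d / 2).
  have mv := rV_continuous_measurable (smooth_continuous sv).
  have mu' := integrable_measurable iu.
  have := L1_dist_conv sK K0 d0 Kd' K1 iu tu.
  move=> /(_ e) H; apply: le_trans (H _); last first.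
    by move=> h hd; apply: hd1; exact: lt_le_trans dd1.
  apply: (@le_trans _ _ (\int[mu]_(x in ball x0 r) `|conv K (u \_ (ball x0 r)) x - (u \_ (ball x0 r)) x|%:E)%E).
    rewrite le_eqVlt; apply/orP; left; apply/eqP; apply: eq_integral => x xb.
    by rewrite distrC patchE xb.
  by apply: ge0_subset_integral => //; exact: measurable_dist.
move=> i.
have sv : smooth (conv K ((fun y => G y ord0 i) \_ (ball x0 r))) by apply: smooth_conv => //; exists (d / 2).
have mv := rV_continuous_measurable (smooth_continuous sv).
have mg := integrable_measurable (iG i).
have := @Lp_dist_conv _ _ K ((fun y => G y ord0 i) \_ (ball x0 r)) p d (e / 2 `^ p) p1 sK K0 d0 Kd' K1 (iG i) (tG i) (ig i) (Pd i).
rewrite [X in (_ <= X%:E)%E](_ : _ = e); last by rewrite mulrC divfK // gt_eqF // powR_gt0.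
apply: le_trans.
apply: (@le_trans _ _ (\int[mu]_(x in ball x0 (r / 2)) (`|conv K ((fun y => G y ord0 i) \_ (ball x0 r)) x - ((fun y => G y ord0 i) \_ (ball x0 r)) x| `^ p)%:E)%E); last first.
  apply: ge0_subset_integral => //.
  apply/measurable_EFinP; apply: (measurableT_comp (measurable_powR p)).
  by apply: measurableT_comp => //; exact: measurable_funB.
rewrite le_eqVlt; apply/orP; left; apply/eqP; apply: eq_integral => x xb.
have xb' : ball x0 (r / 2) x by move: xb; rewrite inE.
have xr : (x \in (ball x0 r : set E)).
  by rewrite inE; apply: le_ball xb'; rewrite ler_pdivrMr // ler_pMr // ler1n.
rewrite distrC patchE xr; congr ((`|_ - _| `^ p)%:E).
apply: (@partial_conv_restrict Omega _ _ _ _ _ _ (r / 2)) => //; first by rewrite divr_gt0.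
by move=> y ry; apply: Kd; apply: le_trans ry; rewrite ler_wpM2r.
Qed.

(* [G - (s V + B)] is the convex combination [(1 - s) G + s (G - V)], up to the
   small term [B]. *)
Lemma gradient_estimate (p s eps M : R) (G V B : E) : 1 < p -> 0 <= s <= 1 ->
  0 < eps <= 1 -> 0 <= M -> enorm B <= eps * M ->
  s * (2 `^ p * (eps * M) `^ p) <= eps ->
  enorm (G - (s *: V + B)) `^ p <=
    enorm G `^ p + eps * ((enorm G + M) `^ p + 1) + 2 `^ p * enorm (G - V) `^ p.
Proof.
move=> p1 s01 e01 M0 hB hs; have p0 : 0 < p by exact: lt_trans p1.
have /andP[s0 s1] := s01; have /andP[e0 e1] := e01.
have eM : 0 <= eps * M by rewrite mulr_ge0 // ltW.
set g := enorm G; set w := enorm (G - V).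
have g0 : 0 <= g by exact: enorm_ge0.
have w0 : 0 <= w by exact: enorm_ge0.
have le1 : enorm (G - (s *: V + B)) <= (1 - s) * (g + eps * M) + s * (w + eps * M).
  have -> : G - (s *: V + B) = ((1 - s) *: G + s *: (G - V)) + (-1) *: B.
    by rewrite scalerBl scale1r scalerBr scaleN1r opprD !addrA subrK.
  apply: le_trans (enormD _ _) _; rewrite enormZ normrN1 mul1r.
  have := enormD ((1 - s) *: G) (s *: (G - V)); rewrite !enormZ !ger0_norm ?subr_ge0 //.
  rewrite -/g -/w => h; apply: le_trans (lerD h hB) _; rewrite le_eqVlt; apply/orP; left; apply/eqP; ring.
have a0 : 0 <= g + eps * M by rewrite addr_ge0.
have b0 : 0 <= w + eps * M by rewrite addr_ge0.
have le2 : enorm (G - (s *: V + B)) `^ p <= (1 - s) * (g + eps * M) `^ p + s * (w + eps * M) `^ p.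
  apply: le_trans (powR_convex p1 s01 a0 b0).
  apply: ge0_ler_powR; rewrite ?nnegrE ?(ltW p0) ?enorm_ge0 //.
  by rewrite addr_ge0 // mulr_ge0 // subr_ge0.
(* Convexity once more, with [g + eps * M] between [g] and [g + M]: the error is linear in [eps], so
   it survives division by [eps]. *)
have le3 : (g + eps * M) `^ p <= g `^ p + eps * (g + M) `^ p.
  have e01' : 0 <= eps <= 1 by rewrite (ltW e0).
  have := powR_convex p1 e01' g0 (addr_ge0 g0 M0).
  have -> : (1 - eps) * g + eps * (g + M) = g + eps * M by ring.
  move/le_trans; apply; rewrite lerD2r mulrBl mul1r gerBl.
  by rewrite mulr_ge0 ?powR_ge0 // ltW.
have le4 := powR_add_le (ltW p0) w0 eM.
have le5 : s * (w + eps * M) `^ p <= 2 `^ p * w `^ p + eps.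
  apply: (@le_trans _ _ (s * (2 `^ p * (w `^ p + (eps * M) `^ p)))); first exact: ler_wpM2l.
  rewrite mulrDr mulrDr lerD //.
  by rewrite ler_piMl // mulr_ge0 // powR_ge0.
apply: le_trans le2 _; rewrite mulrDr mulr1 -addrA -addrA -[eps + _]addrC.
rewrite [X in _ <= X]addrA; apply: lerD le5; apply: le_trans le3.
by rewrite mulrBl mul1r gerBl mulr_ge0 ?powR_ge0.
Qed.

Lemma is_derive_soft_sign (d t : R) : is_derive t 1 (soft_sign d)
  ((flat 2 (t / d - 1) + flat 2 (- t / d - 1)) / d).
Proof.
have D1 : is_derive t 1 (fun s : R => s / d - 1) d^-1.
  rewrite (_ : (fun s : R => s / d - 1) = d^-1 \*: id + cst (- 1)); last first.
    by apply/funext => s; rewrite /GRing.add /GRing.scale /= mulrC.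
  apply: is_derive_eq (is_deriveD (is_deriveZ d^-1 (is_derive_id t 1)) (is_derive_cst _ _ _)) _.
  by rewrite addr0 /GRing.scale /= mulr1.
have D2 : is_derive t 1 (fun s : R => - s / d - 1) (- d^-1).
  rewrite (_ : (fun s : R => - s / d - 1) = (- d^-1) \*: id + cst (- 1)); last first.
    by apply/funext => s; change (- s / d - 1 = - d^-1 * s + - 1); ring.
  apply: is_derive_eq (is_deriveD (is_deriveZ (- d^-1) (is_derive_id t 1)) (is_derive_cst _ _ _)) _.
  by rewrite addr0 /GRing.scale /= mulr1.
have F1 := @is_derive1_comp R (flat 0) (fun s : R => s / d - 1) t _ _ (is_derive_flat 0 _) D1.
have F2 := @is_derive1_comp R (flat 0) (fun s : R => - s / d - 1) t _ _ (is_derive_flat 0 _) D2.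
apply: is_derive_eq (is_deriveB F1 F2) _.
by rewrite !mul0r !subr0 mulrN opprK -mulrDl.
Qed.

Lemma measurable_soft_sign (d : R) : measurable_fun setT (soft_sign d).
Proof.
apply: continuous_measurable_fun => t; apply: differentiable_continuous.
by apply/derivable1_diffP; case: (is_derive_soft_sign d t).
Qed.

Lemma smooth_soft_sign (d : R) v : smooth v -> smooth (soft_sign d \o v).
Proof.
move=> sv.
have s1 : smooth (fun x => v x / d - 1).
  by apply: smoothD; [apply: smoothM => //|]; exact: smooth_cst.
have s2 : smooth (fun x => - v x / d - 1).
  exact: smoothD (smoothM (smoothN sv) (smooth_cst _)) (smooth_cst _).
by apply: smoothD; [exact: (smooth_flat 0 s1)|apply: smoothN; exact: (smooth_flat 0 s2)].
Qed.

Lemma gradient_competitor (d eps : R) phi v x : smooth phi -> smooth v ->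
  gradient (fun x => - (eps * phi x * soft_sign d (v x))) x =
  - ((eps * phi x * ((flat 2 (v x / d - 1) + flat 2 (- v x / d - 1)) / d)) *: gradient v x
     + (eps * soft_sign d (v x)) *: gradient phi x).
Proof.
move=> sphi sv; apply/rowP => i; rewrite !mxE.
have sS := smooth_soft_sign d sv.
have -> : (fun x => - (eps * phi x * soft_sign d (v x))) = (cst (- eps)) * (phi * (soft_sign d \o v)).
  by apply/funext => y; rewrite /GRing.mul /= mulrA mulNr mulNr.
have sc : smooth (cst (- eps) : E -> R) by exact: smooth_cst.
rewrite (partialM i x sc (smoothM sphi sS)) (partialM i x sphi sS) [partial i (cst _) x]derive_cst mulr0 addr0.
rewrite [partial i (soft_sign d \o v) x](_ : _ = (flat 2 (v x / d - 1) + flat 2 (- v x / d - 1)) / d * partial i v x); last first.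
  rewrite /partial; have [_ ->//] := is_derive_comp1 (is_derive_soft_sign d (v x)) (derivableP (smooth_derivable (i := i) (x := x) sv)).
set A := (_ + _) / d; set P := partial i v x; set Q := partial i phi x.
rewrite /=; move: (soft_sign d (v x)) (phi x) => S f; clear; ring.
Qed.

End local_approximation.

(** * The estimate uniform in the regularization parameter *)

Section local_estimate.
Context {R : realType} {N : nat}.
Local Notation E := 'rV[R]_N.
Local Notation mu := (@lebesgue_rV R N).
Implicit Types (f g u v phi : E -> R) (x : E) (i : 'I_N) (Omega D : set E) (p : R).

(** The comparison at one point: [f], [a], [b] stand for the values of the cutoff, [u] and [v], and
    [G], [V], [P] for the gradients of [u], [v] and the cutoff. The errors on the right are of three
    kinds: [eps] times a quantity free of [d], a constant made small by [tau], and differences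
    between [u] and [v]. *)
Lemma competitor_density p gam lamp lamm (d eps M tau f a b : R) (G V P : E) :
  1 < p -> 0 < gam < 1 -> 0 <= lamp -> 0 <= lamm -> 0 < d -> 0 < eps -> eps <= 1 -> eps <= d ->
  eps * (8 / d) <= 1 -> eps * (8 / d) * (2 `^ p * (eps * M) `^ p) <= eps ->
  0 < tau -> 0 <= f <= 1 -> 0 <= M -> enorm P <= M ->
  enorm (G - ((eps * f * ((flat 2 (b / d - 1) + flat 2 (- b / d - 1)) / d)) *: V
     + (eps * soft_sign d b) *: P)) `^ p / p +
    Fgamma gam lamp lamm (a - eps * f * soft_sign d b) +
    eps * (f * (`|soft_sign d a| * `|Fgamma' gam lamp lamm a|)) <=
  enorm G `^ p / p + Fgamma gam lamp lamm a +
    (eps * ((enorm G + M) `^ p + 1) + (lamp + lamm) * (tau `^ gam + tau `^ (gam - 1) * `|a - b|)) +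
    2 `^ p * enorm (G - V) `^ p.
Proof.
move=> p1 g l1 l2 d0 e0 e1 ed e8 e2 t0 /andP[f0 f1] M0 PM.
have /andP[g0 g1] := g; have p0 : 0 < p by exact: lt_trans p1.
have ef0 : 0 <= eps * f by rewrite mulr_ge0 // ltW.
set Z := (_ + _) / d; set s := eps * f * Z.
have Z0 : 0 <= Z by rewrite divr_ge0 ?addr_ge0 ?flat_ge0 // ltW.
have Z8 : Z <= 8 / d.
  rewrite ler_wpM2r ?invr_ge0 ?(ltW d0) //.
  have := flat2_le4 (b / d - 1); have := flat2_le4 (- b / d - 1); lra.
have s0 : 0 <= s by rewrite mulr_ge0.
have s8 : s <= eps * (8 / d).
  apply: le_trans (ler_wpM2l ef0 Z8) _; rewrite ler_wpM2r ?divr_ge0 ?(ltW d0) //.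
  by rewrite ler_piMr // ltW.
have H1 : enorm (G - (s *: V + (eps * soft_sign d b) *: P)) `^ p <=
    enorm G `^ p + eps * ((enorm G + M) `^ p + 1) + 2 `^ p * enorm (G - V) `^ p.
  apply: gradient_estimate => //.
  - by rewrite s0 (le_trans s8).
  - by rewrite e0 e1.
  - rewrite enormZ normrM (gtr0_norm e0) -mulrA ler_wpM2l ?(ltW e0) //.
    apply: le_trans PM; rewrite ler_piMl ?enorm_ge0 //; exact: normr_soft_sign_le1.
  - by apply: le_trans e2; rewrite ler_wpM2r // mulr_ge0 // powR_ge0.
have pV : p^-1 <= 1 by rewrite invf_le1 // ltW.
have H2 : enorm (G - (s *: V + (eps * soft_sign d b) *: P)) `^ p / p <=
    enorm G `^ p / p + eps * ((enorm G + M) `^ p + 1) + 2 `^ p * enorm (G - V) `^ p.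
  have pV0 : 0 <= p^-1 by rewrite invr_ge0 ltW.
  apply: le_trans (ler_wpM2r pV0 H1) _; rewrite !mulrDl -!addrA lerD2l.
  by apply: lerD; rewrite ler_piMr // mulr_ge0 ?addr_ge0 ?powR_ge0 // ltW.
have H3 := Fgamma_concave a l1 l2 g d0 ef0 (le_trans (ler_piMr (ltW e0) f1) ed).
have g01 : 0 < gam <= 1 by rewrite g0 ltW.
have H4 := Fgamma_hoelder (a - eps * f * soft_sign d b) (a - eps * f * soft_sign d a) l1 l2 g01.
(* The Lipschitz constant [8 / d] of the regularized sign is absorbed by [eps]. *)
have H5 : `|a - eps * f * soft_sign d b - (a - eps * f * soft_sign d a)| <= `|a - b|.
  have -> : a - eps * f * soft_sign d b - (a - eps * f * soft_sign d a) =
    (eps * f) * (soft_sign d a - soft_sign d b) by ring.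
  rewrite normrM (ger0_norm ef0); apply: le_trans (ler_wpM2l ef0 (soft_sign_lipschitz a b d0)) _.
  rewrite mulrA ler_piMl //; apply: le_trans e8; rewrite ler_wpM2r ?divr_ge0 ?(ltW d0) //.
  by rewrite ler_piMr // ltW.
have H6 : `|a - eps * f * soft_sign d b - (a - eps * f * soft_sign d a)| `^ gam <=
    tau `^ gam + tau `^ (gam - 1) * `|a - b|.
  apply: le_trans (powR_le_affine g t0 (normr_ge0 (a - b))).
  by apply: ge0_ler_powR; rewrite ?nnegrE ?normr_ge0 // ltW.
have l0 : 0 <= lamp + lamm by rewrite addr_ge0.
have H7 := le_trans H4 (lerD (lexx _) (ler_wpM2l l0 H6)).
rewrite [eps * (f * _)]mulrA.
apply: le_trans (lerD (lerD H2 H7) (lexx _)) _.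
move: H3; clear; set A := eps * f * (_ * _); move: A => A.
set F1 := Fgamma _ _ _ _; set F2 := Fgamma _ _ _ _; move: F1 F2 => F1 F2.
set T := (lamp + lamm) * _; move: T => T; set T1 := eps * _; move: T1 => T1.
set T2 := 2 `^ p * _; move: T2 => T2; set T3 := _ / p; move: T3 => T3.
lra.
Qed.

Lemma enorm_gradient_bounded phi : smooth phi -> bounded_support phi ->
  exists2 M : R, 0 <= M & forall x, enorm (gradient phi x) <= M.
Proof.
move=> sphi bphi.
have /choice[m Hm] : forall i, exists m : R, forall x, `|partial i phi x| <= m.
  move=> i; have [m _ h] := bounded_support_bounded
    (smooth_continuous (smooth_partial i sphi)) (bounded_support_partial i bphi).
  by exists m.
exists (\sum_i m i); first by apply: sumr_ge0 => i _; apply: le_trans (normr_ge0 _) (Hm i 0).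
by move=> x; apply: le_trans (enorm_le_sum _) _; apply: ler_sum => i _; rewrite mxE.
Qed.

(** [eps] is the inverse of a sum [S] having every quantity to be absorbed as a summand. For the
    last condition, [eps * M <= 1] and [p > 1] give [(eps * M)^p <= eps * M], so that absorbing
    [k * c * M] suffices. *)
Lemma exists_eps p (d M : R) : 1 < p -> 0 < d -> 0 <= M ->
  exists2 eps : R, 0 < eps & [/\ eps <= 1, eps <= d, eps * (8 / d) <= 1 &
    eps * (8 / d) * (2 `^ p * (eps * M) `^ p) <= eps].
Proof.
move=> p1 d0 M0; have p0 : 0 < p by exact: lt_trans p1.
set k := 8 / d; have k0 : 0 <= k by rewrite divr_ge0 // ltW.
set c := 2 `^ p; have c0 : 0 <= c by exact: powR_ge0.
have kcM : 0 <= k * c * M by rewrite mulr_ge0 // mulr_ge0.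
have dV : 0 < d^-1 by rewrite invr_gt0.
set S := 1 + d^-1 + k + M + k * c * M.
have S1 : 1 <= S by rewrite /S; lra.
have S0 : 0 < S by exact: lt_le_trans S1.
have le (y : R) : y <= S -> S^-1 * y <= 1 by move=> yS; rewrite mulrC ler_pdivrMr // mul1r.
have e0 : 0 < S^-1 by rewrite invr_gt0.
exists S^-1 => //; split.
- by rewrite invf_le1.
- have := le d^-1; rewrite ler_pdivrMr // mul1r; apply; rewrite /S; lra.
- by apply: le; rewrite /S; lra.
have eM0 : 0 <= S^-1 * M by rewrite mulr_ge0 // ltW.
have eM1 : S^-1 * M <= 1 by apply: le; rewrite /S; lra.
have h : (S^-1 * M) `^ p <= S^-1 * M.
  have [->|n0] := eqVneq (S^-1 * M) 0; first by rewrite powR0 // gt_eqF.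
  have := @ger_powR R (S^-1 * M); rewrite lt_neqAle eq_sym n0 eM0 eM1 => /(_ isT 1 p (ltW p1)).
  by rewrite powRr1.
have -> : S^-1 * k * (c * (S^-1 * M) `^ p) = S^-1 * (k * c * (S^-1 * M) `^ p) by ring.
rewrite ler_piMr ?(ltW e0) //.
apply: le_trans (ler_wpM2l _ h) _; first by rewrite mulr_ge0.
rewrite mulrCA; apply: le; rewrite /S; lra.
Qed.

Lemma restrict_ge0 f D x : 0 <= f x -> 0 <= (f \_ D) x.
Proof. by rewrite patchE; case: ifP. Qed.

Lemma integral_linear_combination D (a b : R) f g : measurable D -> 0 <= a -> 0 <= b ->
  (forall x, 0 <= f x) -> (forall x, 0 <= g x) -> measurable_fun D f -> measurable_fun D g ->
  (\int[mu]_(x in D) (a * f x + b * g x)%:E =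
   a%:E * \int[mu]_(x in D) (f x)%:E + b%:E * \int[mu]_(x in D) (g x)%:E)%E.
Proof.
move=> mD a0 b0 f0 g0 mf mg.
under eq_integral do rewrite EFinD.
rewrite ge0_integralD //; first last.
- by apply/measurable_EFinP; exact: measurable_funM.
- by move=> x _; rewrite lee_fin mulr_ge0.
- by apply/measurable_EFinP; exact: measurable_funM.
- by move=> x _; rewrite lee_fin mulr_ge0.
under eq_integral do rewrite EFinM.
under [X in (_ + X)%E]eq_integral do rewrite EFinM.
rewrite !ge0_integralZl //; try exact/measurable_EFinP; by move=> x _; rewrite lee_fin.
Qed.

Lemma integral_restrict (D Q : set E) f : Q `<=` D ->
  (\int[mu]_(x in D) ((f \_ Q) x)%:E = \int[mu]_(x in Q) (f x)%:E)%E.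
Proof.
move=> QD; rewrite -[in RHS](setIidr QD) integral_mkcondr.
by apply: eq_integral => x _; rewrite !patchE; case: ifP.
Qed.

(** Minimality compares two integrals, and the common term must be cancelled: this is where
    finiteness of the energy of the minimizer enters. That of the competitor may be infinite. *)
Lemma integral_le_absorb D (D0 D1 T W : E -> R) : measurable D ->
  measurable_fun D D0 -> measurable_fun D D1 -> measurable_fun D T -> measurable_fun D W ->
  (forall x, 0 <= D0 x) -> (forall x, 0 <= D1 x) -> (forall x, 0 <= T x) -> (forall x, 0 <= W x) ->
  (forall x, D x -> D1 x + T x <= D0 x + W x) ->
  (\int[mu]_(x in D) (D0 x)%:E <= \int[mu]_(x in D) (D1 x)%:E)%E ->
  (\int[mu]_(x in D) (D0 x)%:E < +oo)%E ->
  (\int[mu]_(x in D) (T x)%:E <= \int[mu]_(x in D) (W x)%:E)%E.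
Proof.
move=> mD /measurable_EFinP m0 /measurable_EFinP m1 /measurable_EFinP mT /measurable_EFinP mW.
move=> p0 p1 pT pW h le01 fin0.
have f0 : (\int[mu]_(x in D) (D0 x)%:E \is a fin_num)%E.
  by rewrite ge0_fin_numE // integral_ge0 // => x _; rewrite lee_fin.
rewrite -(leeD2lE _ _ f0).
apply: (@le_trans _ _ (\int[mu]_(x in D) (D1 x)%:E + \int[mu]_(x in D) (T x)%:E)%E).
  exact: leeD2r.
rewrite -!ge0_integralD //; try by move=> x _; rewrite lee_fin.
apply: ge0_le_integral => //.
- by move=> x _; rewrite -EFinD lee_fin addr_ge0.
- exact: emeasurable_funD.
- exact: emeasurable_funD.
Qed.

Lemma integral_enormD_lty D (G : E -> E) (M p : R) : 0 <= M -> 1 < p -> measurable D ->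
  (mu D < +oo)%E -> (forall i, measurable_fun D (fun x => G x ord0 i)) ->
  (\int[mu]_(x in D) (enorm (G x) `^ p)%:E < +oo)%E ->
  (\int[mu]_(x in D) ((enorm (G x) + M) `^ p + 1)%:E < +oo)%E.
Proof.
move=> M0 p1 mD Dfin mG fG; have p0 : 0 < p by exact: lt_trans p1.
have mGp : measurable_fun D (fun x => (enorm (G x) `^ p)%:E).
  apply/measurable_EFinP; apply: (measurableT_comp (measurable_powR p)).
  exact: measurable_enorm.
apply: (@le_lt_trans _ _ (\int[mu]_(x in D) ((2 `^ p)%:E * (enorm (G x) `^ p)%:E + (2 `^ p * M `^ p + 1)%:E))%E).
  apply: ge0_le_integral => //.
  - by move=> x _; rewrite lee_fin addr_ge0 // powR_ge0.
  - apply/measurable_EFinP; apply: measurable_funD => //.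
    apply: (measurableT_comp (measurable_powR p)); apply: measurable_funD => //.
    exact: measurable_enorm.
  - by apply: emeasurable_funD => //; exact: emeasurable_funM.
  - move=> x _; rewrite -EFinM -EFinD lee_fin addrA lerD2r -mulrDr.
    by apply: powR_add_le => //; rewrite ?enorm_ge0 // ltW.
have c0 : 0 <= 2 `^ p * M `^ p + 1 by rewrite addr_ge0 ?mulr_ge0 ?powR_ge0.
rewrite ge0_integralD //; first last.
- exact: emeasurable_funM.
- by move=> x _; rewrite -EFinM lee_fin mulr_ge0 ?powR_ge0.
rewrite lte_add_pinfty //; last first.
  by rewrite integral_cst // lte_mul_pinfty.
rewrite ge0_integralZl //; first by rewrite lte_mul_pinfty // lee_fin powR_ge0.
by move=> x _; rewrite lee_fin powR_ge0.
Qed.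

Lemma measurable_soft_sign_density D phi u (d gam lamp lamm : R) :
  measurable_fun D phi -> measurable_fun D u ->
  measurable_fun D (fun x => phi x * (`|soft_sign d (u x)| * `|Fgamma' gam lamp lamm (u x)|)).
Proof.
move=> mphi mu_; apply: measurable_funM => //.
apply: measurable_funM; apply: measurableT_comp => //.
  exact: measurableT_comp (measurable_soft_sign d) mu_.
exact: (measurableT_comp (measurable_Fgamma' gam lamp lamm)).
Qed.

(* The point is that [C] does not depend on [d]: the mollification [v] and the
   size [eps] of the perturbation are chosen after [d]. *)
Lemma soft_sign_estimate Omega p gam lamp lamm u x0 (r : R) phi :
  open Omega -> (mu Omega < +oo)%E -> 1 < p -> 0 < gam < 1 -> 0 < lamp -> 0 < lamm ->
  local_minimizer Omega p gam lamp lamm u ->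
  0 < r -> closed_ball x0 r `<=` Omega ->
  smooth phi -> (forall x, 0 <= phi x <= 1) ->
  (forall x, ~ closed_ball x0 (r / 4) x -> phi x = 0) ->
  exists C : R, forall d, 0 < d ->
    (\int[mu]_(x in Omega)
      (phi x * (`|soft_sign d (u x)| * `|Fgamma' gam lamp lamm (u x)|))%:E <= C%:E)%E.
Proof.
move=> oO Ofin p1 g l1 l2 [Wu minu] r0 rO sphi phi01 phi0.
have p0 : 0 < p by exact: lt_trans p1.
have /andP[g0 g1] := g.
have mO := rV_open_measurable oO.
(* Three concentric balls: the cutoff lives in the closed ball of radius [r / 4], the gradient of
   [v] is controlled on radius [r / 2], and the perturbation is admissible in the ball of radius
   [r]. *)
have mQ := rV_ball_measurable x0 r; have mB := rV_ball_measurable x0 (r / 2).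
have QO : ball x0 r `<=` Omega by apply: subset_trans rO; exact: subset_closed_ball.
have BQ : ball x0 (r / 2) `<=` ball x0 r by apply: le_ball; rewrite ler_pdivrMr // ler_pMr // ler1n.
have cb4 (k : R) : r / 4 < k -> closed_ball x0 (r / 4) `<=` ball x0 k.
  by move=> rk; rewrite closed_ballE ?divr_gt0 // => y /=; rewrite -ball_normE /=; move/le_lt_trans; apply.
have tphi : test_function (ball x0 (r / 2)) phi.
  apply: (@ball_test_function _ _ _ _ x0 (r / 4)) => //; apply: cb4; lra.
have bphi := test_function_bounded_support tphi.
have [M M0 hM] := enorm_gradient_bounded sphi bphi.
have [HG [fGi fG]] := W1p_enorm_lty oO p0 Wu.
set G := weak_gradient Omega u in HG fGi fG.
have mG := weak_gradient_measurable HG.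
have [Lu _] := HG; have mu_ : measurable_fun Omega u by case: Lu.
have [CN CN0 HCN] := powR_sum_le (index_enum 'I_N) (ltW p0).
set A1 : E -> R := fun x => (enorm (G x) + M) `^ p + 1.
have A10 x : 0 <= A1 x by rewrite addr_ge0 // powR_ge0.
have mA1 : measurable_fun Omega A1.
  apply: measurable_funD => //; apply: (measurableT_comp (measurable_powR p)).
  by apply: measurable_funD => //; exact: measurable_enorm.
have fA1 : (\int[mu]_(x in ball x0 r) (A1 x)%:E < +oo)%E.
  apply: le_lt_trans (integral_enormD_lty M0 p1 mO Ofin mG fG).
  apply: ge0_subset_integral => //; first exact/measurable_EFinP.
  by move=> x _; rewrite lee_fin.
set C1 := fine (\int[mu]_(x in ball x0 r) (A1 x)%:E).
have C1E : (\int[mu]_(x in ball x0 r) (A1 x)%:E = C1%:E)%E.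
  by rewrite fineK // ge0_fin_numE // integral_ge0 // => x _; rewrite lee_fin.
(* [C1] bounds the gradient error divided by [eps]; one unit pays for the [tau] term and one for the
   distance between [u] and [v]. *)
exists (C1 + 1 + 1) => d d0.
have [eps e0 [e1 ed e8 e2]] := exists_eps p1 d0 M0.
set L := lamp + lamm; have L0 : 0 < L by rewrite addr_gt0.
set q := fine (mu (ball x0 r)).
have qE : mu (ball x0 r) = q%:E by rewrite fineK // ge0_fin_numE // lebesgue_rV_ball_lty.
have q0 : 0 <= q by rewrite fine_ge0.
have Lq1 : 0 < L * q + 1 by rewrite ltr_wpDl // mulr_ge0 // ltW.
(* Makes the constant term of the affine bound, integrated over the ball of measure [q], at most
   [eps]; the [+ 1] avoids a zero denominator. *)
pose tau := (eps / (L * q + 1)) `^ gam^-1.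
have tau0 : 0 < tau by rewrite powR_gt0 // divr_gt0.
have htau : L * q * tau `^ gam <= eps.
  rewrite /tau -powRrM mulVf ?gt_eqF // powRr1 ?divr_ge0 ?(ltW e0) ?(ltW Lq1) //.
  rewrite mulrA ler_pdivrMr // [_ * eps]mulrC ler_wpM2l ?(ltW e0) //; lra.
set k1 := L * tau `^ (gam - 1); have k10 : 0 <= k1 by rewrite mulr_ge0 ?powR_ge0 // ltW.
set k2 := 2 `^ p * CN; have k20 : 0 <= k2 by rewrite mulr_ge0 ?powR_ge0.
have k3 : 0 < k1 + k2 * N%:R + 1 by rewrite ltr_wpDl // addr_ge0 // mulr_ge0.
(* The accuracy of [v] is fixed last: [k1] is the slope of the affine bound and depends on [tau],
   while [k2] is paid once for each of the [N] partial derivatives. *)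
pose e' := eps / (k1 + k2 * N%:R + 1).
have e'0 : 0 < e' by rewrite divr_gt0.
have he' : k1 * e' + k2 * (N%:R * e') <= eps.
  rewrite mulrA -mulrDl /e' mulrA ler_pdivrMr // [_ * eps]mulrC ler_wpM2l ?(ltW e0) //; lra.
have [v [sv hv hGv]] := mollify_sobolev oO HG p1 fGi r0 rO e'0.
pose eta x := - (eps * phi x * soft_sign d (v x)).
have sS := smooth_soft_sign d sv.
have seta : smooth eta.
  have sc : smooth (cst (- eps) : E -> R) by exact: smooth_cst.
  rewrite (_ : eta = cst (- eps) * (phi * (soft_sign d \o v))).
    exact: smoothM sc (smoothM sphi sS).
  by apply/funext => x; rewrite /eta /GRing.mul /= mulrA mulNr mulNr.
have eta0 x : ~ closed_ball x0 (r / 4) x -> eta x = 0.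
  by move=> h; rewrite /eta phi0 // mulr0 mul0r oppr0.
have r4r : r / 4 < r by lra.
have teta : test_function (ball x0 r) eta.
  exact: ball_test_function seta eta0 (cb4 _ r4r).
have etaE : eta \_ (ball x0 r) = eta.
  apply/funext => x; rewrite patchE; case: ifPn => // /negP xr.
  rewrite eta0 // => /(cb4 _ r4r) h; apply: xr; exact: mem_set.
have HGe : is_weak_gradient Omega (fun x => u x + eta x) (fun x => G x + gradient eta x).
  by apply: is_weak_gradientD => //; exact: smooth_is_weak_gradient.
have oQ : open (ball x0 r : set E) by exact: ball_open.
have cQ : compactly_contained (ball x0 r) Omega.
  by split => //; exact: compact_closed_ball.
have := minu (ball x0 r) eta oQ cQ (W1p0_test oQ (lebesgue_rV_ball_lty _ _) p0 teta).
rewrite etaE (energyE p gam lamp lamm oO HG) (energyE p gam lamp lamm oO HGe).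
set D0 := fun x => enorm (G x) `^ p / p + Fgamma gam lamp lamm (u x).
set D1 := fun x => enorm (G x + gradient eta x) `^ p / p + Fgamma gam lamp lamm (u x + eta x).
pose T x := phi x * (`|soft_sign d (u x)| * `|Fgamma' gam lamp lamm (u x)|).
pose A x := eps * A1 x + L * (tau `^ gam + tau `^ (gam - 1) * `|u x - v x|).
pose B x := k2 * \sum_i `|G x ord0 i - partial i v x| `^ p.
have A0 x : 0 <= A x.
  by rewrite addr_ge0 ?mulr_ge0 ?addr_ge0 ?mulr_ge0 ?powR_ge0 // ltW.
have B0 x : 0 <= B x by rewrite mulr_ge0 // sumr_ge0 // => i _; rewrite powR_ge0.
have T0 x : 0 <= T x by rewrite mulr_ge0 ?mulr_ge0 //; case/andP: (phi01 x).
have AQ0 x : 0 <= (A \_ (ball x0 r)) x by exact: restrict_ge0.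
have BB0 x : 0 <= (B \_ (ball x0 (r / 2))) x by exact: restrict_ge0.
have ptw x : D1 x + eps * T x <= D0 x + (A \_ (ball x0 r)) x + (B \_ (ball x0 (r / 2))) x.
  have GE : G x + gradient eta x = G x - ((eps * phi x * ((flat 2 (v x / d - 1) + flat 2 (- v x / d - 1)) / d)) *: gradient v x
     + (eps * soft_sign d (v x)) *: gradient phi x).
    by rewrite (gradient_competitor d eps x sphi sv).
  (* Outside the half ball the cutoff and its gradient vanish, so the competitor coincides with [u]
     to first order and both error terms are merely nonnegative. *)
  have [xB|xB] := pselect (ball x0 (r / 2) x); last first.
    have nphi := test_function_out tphi xB.
    have f0 : phi x = 0 by exact: nbhs_singleton nphi.
    have gf : gradient phi x = 0 by apply/rowP => i; rewrite !mxE; exact: partial_vanish nphi.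
    have -> : D1 x = D0 x.
      by rewrite /D1 GE /D0 /eta f0 gf scaler0 addr0 !mulr0 !mul0r scale0r subr0 oppr0 addr0.
    have -> : T x = 0 by rewrite /T f0 mul0r.
    by rewrite mulr0 addr0 -addrA lerDl addr_ge0.
  rewrite !patchE mem_set; last exact: BQ.
  rewrite mem_set //.
  have H := @competitor_density p gam lamp lamm d eps M tau (phi x) (u x) (v x) (G x) (gradient v x) (gradient phi x)
    p1 g (ltW l1) (ltW l2) d0 e0 e1 ed e8 e2 tau0 (phi01 x) M0 (hM x).
  rewrite /D1 GE; apply: le_trans H _; rewrite lerD2l /B -mulrA ler_wpM2l ?powR_ge0 //.
  have := HCN (fun i => `|G x ord0 i - partial i v x|) (fun i => normr_ge0 _).
  rewrite powR0 ?gt_eqF // add0r; apply: le_trans.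
  apply: ge0_ler_powR; rewrite ?nnegrE ?enorm_ge0 ?(ltW p0) ?sumr_ge0 //.
  apply: le_trans (enorm_le_sum _) _; apply: ler_sum => i _.
  by rewrite !mxE.
have F1 : (\int[mu]_(x in Omega) (D0 x)%:E < +oo)%E.
  have := energy_lty oO Ofin p1 g0 (lt_trans g1 p1) l1 l2 Wu.
  by rewrite (energyE p gam lamp lamm oO HG).
have mv := rV_continuous_measurable (smooth_continuous sv).
have mphi := rV_continuous_measurable (smooth_continuous sphi).
have meta := rV_continuous_measurable (smooth_continuous seta).
have mT : measurable_fun Omega T.
  by apply: measurable_soft_sign_density => //; exact: measurable_funTS.
have mge : forall i, measurable_fun Omega (fun x => (G x + gradient eta x) ord0 i).
  move=> i; apply: weak_gradient_measurable HGe i.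
have mD0 : measurable_fun Omega D0 by exact: measurable_energy_density.
have mD1 : measurable_fun Omega D1.
  apply: measurable_energy_density => //; apply: measurable_funD => //.
  exact: measurable_funTS.
have mA : measurable_fun Omega A.
  apply: measurable_funD; apply: measurable_funM => //; apply: measurable_funD => //.
  apply: measurable_funM => //; apply: measurableT_comp => //; apply: measurable_funB => //.
  exact: measurable_funTS.
have mpv i := rV_continuous_measurable (smooth_continuous (smooth_partial i sv)).
have mBi i : measurable_fun Omega (fun x => `|G x ord0 i - partial i v x| `^ p).
  apply: (measurableT_comp (measurable_powR p)); apply: measurableT_comp => //.
  by apply: measurable_funB => //; exact: measurable_funTS.
have mBf : measurable_fun Omega B.
  by apply: measurable_funM => //; apply: measurable_sum => i.
have mAQ : measurable_fun Omega (A \_ (ball x0 r)).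
  by apply/(measurable_restrict _ mQ mO); apply: measurable_funS mA => //; exact: subIsetl.
have mBB : measurable_fun Omega (B \_ (ball x0 (r / 2))).
  by apply/(measurable_restrict _ mB mO); apply: measurable_funS mBf => //; exact: subIsetl.
have F00 x : 0 <= D0 x.
  by rewrite addr_ge0 ?divr_ge0 ?powR_ge0 ?Fgamma_ge0 // ltW.
have F10 x : 0 <= D1 x.
  by rewrite addr_ge0 ?divr_ge0 ?powR_ge0 ?Fgamma_ge0 // ltW.
move=> le01.
have := @integral_le_absorb Omega D0 D1 (fun x => eps * T x) (fun x => (A \_ (ball x0 r)) x + (B \_ (ball x0 (r / 2))) x)
  mO mD0 mD1 (measurable_funM (measurable_cst _) mT) (measurable_funD mAQ mBB) F00 F10
  (fun x => mulr_ge0 (ltW e0) (T0 x)) (fun x => addr_ge0 (AQ0 x) (BB0 x)) _ le01 F1.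
move=> /(_ _)/wrap[]; first by move=> x _; rewrite addrA; exact: ptw.
have le2 : (\int[mu]_(x in Omega) ((A \_ (ball x0 r)) x + (B \_ (ball x0 (r / 2))) x)%:E <=
    (eps * C1 + L * (tau `^ gam * q + tau `^ (gam - 1) * e') + k2 * (N%:R * e'))%:E)%E.
  have EA : (\int[mu]_(x in Omega) ((A \_ (ball x0 r)) x)%:E = \int[mu]_(x in ball x0 r) (A x)%:E)%E.
    exact: integral_restrict.
  have EB : (\int[mu]_(x in Omega) ((B \_ (ball x0 (r / 2))) x)%:E = \int[mu]_(x in ball x0 (r / 2)) (B x)%:E)%E.
    exact: integral_restrict (subset_trans BQ QO).
  under eq_integral do rewrite EFinD.
  rewrite ge0_integralD //; try exact/measurable_EFinP; try by move=> x _; rewrite lee_fin.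
  rewrite EA EB [leRHS]EFinD; apply: leeD.
    have muv : measurable_fun (ball x0 r) (fun x => `|u x - v x|).
      apply: measurableT_comp => //; apply: measurable_funB; last exact: measurable_funTS.
      exact: measurable_funS mu_.
    have mA1Q : measurable_fun (ball x0 r) A1 by exact: measurable_funS mA1.
    rewrite (integral_linear_combination mQ (ltW e0) (ltW L0) A10 _ mA1Q) //; first last.
    - apply: measurable_funD => //; exact: measurable_funM.
    - by move=> x; rewrite addr_ge0 ?mulr_ge0 ?powR_ge0.
    rewrite C1E.
    have -> : (eps * C1 + L * (tau `^ gam * q + tau `^ (gam - 1) * e'))%:E =
      (eps%:E * C1%:E + L%:E * (tau `^ gam * q + tau `^ (gam - 1) * e')%:E)%E by rewrite -!EFinM -EFinD.
    apply: leeD => //; apply: lee_wpmul2l; first by rewrite lee_fin ltW.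
    rewrite [X in (X <= _)%E](_ : _ = (\int[mu]_(x in ball x0 r) (tau `^ gam * 1 + tau `^ (gam - 1) * `|u x - v x|)%:E)%E); last first.
      by apply: eq_integral => x _; rewrite mulr1.
    rewrite (@integral_linear_combination _ _ _ (cst 1) (fun x => `|u x - v x|) mQ (powR_ge0 _ _) (powR_ge0 _ _)) //.
    have -> : (\int[mu]_(x in ball x0 r) (cst 1 x)%:E = q%:E)%E.
      transitivity (\int[mu]_(x in ball x0 r) cst 1%E x)%E => //.
      by rewrite integral_cst // mul1e.
    have -> : (tau `^ gam * q + tau `^ (gam - 1) * e')%:E =
      ((tau `^ gam)%:E * q%:E + (tau `^ (gam - 1))%:E * e'%:E)%E by rewrite -!EFinM -EFinD.
    apply: leeD => //; by apply: lee_wpmul2l => //; rewrite lee_fin powR_ge0.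
  have mBr i : measurable_fun (ball x0 (r / 2)) (fun x => `|G x ord0 i - partial i v x| `^ p).
    apply: measurable_funS (mBi i) => //; exact: subset_trans QO.
  under eq_integral do rewrite EFinM -sumEFin.
  rewrite ge0_integralZl //; first last.
  - by move=> x _; apply: sume_ge0 => i _; rewrite lee_fin powR_ge0.
  - by apply: emeasurable_sum => i; exact/measurable_EFinP.
  rewrite [leRHS](EFinM k2); apply: lee_wpmul2l; first by rewrite lee_fin.
  rewrite ge0_integral_sum //; last by move=> i; exact/measurable_EFinP.
  apply: (@le_trans _ _ (\sum_(i < N) e'%:E)%E); first by apply: lee_sum => i _; exact: hGv.
  by rewrite sumEFin sumr_const card_ord mulr_natl.
have e3 : eps * C1 + L * (tau `^ gam * q + tau `^ (gam - 1) * e') + k2 * (N%:R * e') <= eps * (C1 + 1 + 1).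
  have -> : eps * C1 + L * (tau `^ gam * q + tau `^ (gam - 1) * e') + k2 * (N%:R * e') =
    eps * C1 + (L * q * tau `^ gam + (k1 * e' + k2 * (N%:R * e'))) by rewrite /k1; ring.
  have -> : eps * (C1 + 1 + 1) = eps * C1 + (eps + eps) by ring.
  by rewrite lerD2l; exact: lerD.
move=> H; have := le_trans H (le_trans le2 _).
move=> /(_ (eps * (C1 + 1 + 1))%:E); rewrite lee_fin => /(_ e3).
under eq_integral do rewrite EFinM.
rewrite ge0_integralZl //; first last.
- by rewrite lee_fin ltW.
- by move=> x _; rewrite lee_fin.
- exact/measurable_EFinP.
by rewrite EFinM lee_pmul2l // lte_fin.
Qed.

End local_estimate.

(** * Passage to the limit and covering of compact sets *)

Section local_integrability.
Context {R : realType} {N : nat}.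
Local Notation E := 'rV[R]_N.
Local Notation mu := (@lebesgue_rV R N).
Implicit Types (f g u v phi : E -> R) (x : E) (i : 'I_N) (Omega D : set E) (p : R).

Lemma normr_soft_sign (d t : R) : 0 < d -> `|soft_sign d t| = flat 0 (`|t| / d - 1).
Proof.
move=> d0; wlog t0 : t / 0 <= t.
  move=> W; have [/W//|t0] := leP 0 t.
  by rewrite -normrN -soft_signN -[X in flat 0 (X / d - 1)]normrN; apply: W; rewrite oppr_ge0 ltW.
by rewrite soft_sign_ge0E // (ger0_norm t0) ger0_norm ?flat_ge0.
Qed.

(** The limit of the regularized sign need not be identified: a positive lower bound at points where
    [u] is not 0 is enough, and [flat 0 1] is one as soon as [|u x| >= 2 * d]. Where [u] is 0 the
    integrand is 0 by convention. *)
Lemma integral_soft_sign_bound D gam lamp lamm (c C : R) u phi : measurable D -> 0 < c ->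
  measurable_fun D u -> measurable_fun D phi -> (forall x, D x -> c <= phi x) ->
  (forall d, 0 < d -> (\int[mu]_(x in D)
      (phi x * (`|soft_sign d (u x)| * `|Fgamma' gam lamp lamm (u x)|))%:E <= C%:E)%E) ->
  (\int[mu]_(x in D) `|Fgamma' gam lamp lamm (u x)|%:E < +oo)%E.
Proof.
move=> mD c0 mu_ mphi cphi HC.
pose d n : R := n.+1%:R^-1.
have d0 n : 0 < d n by rewrite invr_gt0.
pose h n x := (phi x * (`|soft_sign (d n) (u x)| * `|Fgamma' gam lamp lamm (u x)|))%:E.
have mF : measurable_fun D (fun x => `|Fgamma' gam lamp lamm (u x)|).
  by apply: measurableT_comp => //; exact: (measurableT_comp (measurable_Fgamma' gam lamp lamm)).
have mh n : measurable_fun D (h n).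
  by apply/measurable_EFinP; exact: measurable_soft_sign_density.
have phi0 x : D x -> 0 <= phi x by move=> /cphi; apply: le_trans; exact: ltW.
have h0 n x : D x -> (0 <= h n x)%E.
  by move=> Dx; rewrite lee_fin mulr_ge0 ?mulr_ge0 //; exact: phi0.
have hm x : D x -> {homo h ^~ x : n m / (n <= m)%N >-> (n <= m)%E}.
  move=> Dx n m nm; rewrite lee_fin ler_wpM2l ?phi0 // ler_wpM2r // !normr_soft_sign //.
  by apply: flat0_homo; rewrite lerD2r ler_wpM2l // /d !invrK ler_nat.
set e := flat 0 1 : R.
have e0 : 0 < e by exact: flat_gt0.
have lb x : D x -> ((c * e * `|Fgamma' gam lamp lamm (u x)|)%:E <= limn (h ^~ x))%E.
  move=> Dx.
  have [u0|u0] := eqVneq (u x) 0.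
    rewrite u0 Fgamma'_0 normr0 mulr0; apply: lime_ge; first exact/ereal_nondecreasing_is_cvgn/hm.
    by apply: nearW => n; exact: h0.
  (* Then [n + 1 > 2 / |u x|], so the argument of [flat 0] exceeds 1 for [d n] and, by monotonicity,
     the bound persists for all later indices. *)
  pose n := Num.truncn (2 / `|u x|).
  apply: (@le_trans _ _ (h n x)); last first.
    apply: lime_ge; first exact/ereal_nondecreasing_is_cvgn/hm.
    by exists n => // m nm; exact: hm.
  rewrite lee_fin -mulrA ler_pM ?(ltW c0) ?mulr_ge0 ?(ltW e0) ?cphi //.
  rewrite ler_wpM2r // normr_soft_sign //; apply: flat0_homo.
  have : 2 / `|u x| < n.+1%:R by rewrite truncnS_gt // divr_ge0.
  by rewrite ltr_pdivrMr ?normr_gt0 // /d invrK mulrC; lra.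
have ce : 0 < c * e by rewrite mulr_gt0.
have : (\int[mu]_(x in D) (c * e * `|Fgamma' gam lamp lamm (u x)|)%:E <= C%:E)%E.
  apply: (@le_trans _ _ (\int[mu]_(x in D) limn (h ^~ x))%E).
    apply: ge0_le_integral => //.
    - by move=> x _; rewrite lee_fin mulr_ge0 // ltW.
    - by apply/measurable_EFinP; exact: measurable_funM.
    - apply: emeasurable_fun_cvg mh _ => x Dx; exact/ereal_nondecreasing_is_cvgn/hm.
  rewrite monotone_convergence //; apply: lime_le.
    apply: ereal_nondecreasing_is_cvgn => n m nm; apply: ge0_le_integral => //.
    - by move=> x Dx; exact: h0.
    - by move=> x Dx; exact: hm.
  by apply: nearW => n; exact: HC.
under eq_integral do rewrite EFinM.
rewrite ge0_integralZl //; [|exact/measurable_EFinP|by rewrite lee_fin ltW].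
rewrite muleC -lee_pdivlMr // => h1; apply: le_lt_trans h1 _.
by rewrite -EFinM ltry.
Qed.

(** A compact set is covered by finitely many of the given balls, and the integral over a finite
    union is finite by induction on the list of centres. *)
Lemma L1loc_local Omega f : measurable Omega -> measurable_fun Omega f ->
  (forall x, Omega x -> exists r : R, [/\ 0 < r, ball x r `<=` Omega &
    (\int[mu]_(y in ball x r) `|f y|%:E < +oo)%E]) ->
  L1loc Omega f.
Proof.
move=> mO mf Hf; split => // K KO cK.
have mK := rV_compact_measurable cK.
have /choice[r Hr] : forall x, exists r : R, Omega x -> [/\ 0 < r, ball x r `<=` Omega &
    (\int[mu]_(y in ball x r) `|f y|%:E < +oo)%E].
  move=> x; have [Ox|nO] := pselect (Omega x); last by exists 0.
  by have [r Hr] := Hf x Ox; exists r.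
have uni (s : seq E) : (forall x, x \in s -> Omega x) ->
  let S := \big[setU/set0]_(x <- s) ball x (r x) in
  [/\ measurable S, S `<=` Omega & (\int[mu]_(y in S) `|f y|%:E < +oo)%E].
  elim: s => [|x s IH] sO /=; first by rewrite big_nil integral_set0; split => //; exact: measurable0.
  rewrite big_cons.
  have [|mS SO fS] := IH; first by move=> y ys; apply: sO; rewrite inE ys orbT.
  have [rx bO fB] := Hr x (sO _ (mem_head _ _)).
  have mB := rV_ball_measurable x (r x).
  set S := \big[setU/set0]_(x <- s) ball x (r x) in mS SO fS *.
  split; [exact: measurableU | by move=> y [/bO|/SO] |].
  have mfn A : A `<=` Omega -> measurable A -> measurable_fun A (fun y => `|f y|%:E).
    by move=> AO mA; apply/measurable_EFinP; apply: measurableT_comp => //; exact: measurable_funS mf.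
  (* The union is made disjoint so that the integral splits additively. *)
  have -> : ball x (r x) `|` S = ball x (r x) `|` (S `\` (ball x (r x) : set E)).
    apply/seteqP; split => y [By|]; [by left| |by left|by case; right].
    by move=> Sy; have [By|nB] := pselect (ball x (r x) y); [left|right].
  have mSB := measurableD mS mB.
  rewrite ge0_integral_setU //; first last.
  - by apply/disj_setPS => y [? []].
  - apply: mfn; last exact: measurableU.
    by move=> y [/bO//|[/SO]].
  apply: lte_add_pinfty => //; apply: le_lt_trans fS.
  by apply: ge0_subset_integral => //; exact: mfn.
have := cK; rewrite compact_cover => /(_ _ K (fun x => ball x (r x)))[].
- by move=> x Kx; exact: ball_open.
- by move=> x Kx; exists x => //; apply: ballxx; have [] := Hr x (KO _ Kx).
move=> D' DK KD.
have [|mS SO fS] := uni (finmap.enum_fset D').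
  by move=> x /DK; rewrite inE => /KO.
apply: (@integrableS _ _ _ mu (\big[setU/set0]_(x <- finmap.enum_fset D') ball x (r x))) => //.
  by move=> x /KD[y yD yx]; rewrite -bigcup_seq; exists y.
apply/integrableP; split; first by apply/measurable_EFinP; exact: measurable_funS mf.
by apply: le_lt_trans fS.
Qed.

End local_integrability.

Unset Implicit Arguments.

Theorem proposition3p3 (R : realType) (N : nat) (hN : (0 < N)%N)
    (Omega : set 'rV[R]_N) (hopen : open Omega) (hbounded : bounded_set Omega)
    (hlipschitz : lipschitz_boundary Omega)
    (p gam lamp lamm : R) (hp : 1 < p) (hgam0 : 0 < gam) (hgamp : gam < p)
    (hlamp : 0 < lamp) (hlamm : 0 < lamm)
    (u : 'rV[R]_N -> R) (hu : local_minimizer Omega p gam lamp lamm u) :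
  L1loc Omega (fun x => Fgamma' gam lamp lamm (u x)).
Proof.
have p0 : 0 < p by exact: lt_trans hp.
have mO := rV_open_measurable hopen.
have Ofin := lebesgue_rV_bounded_lty hbounded mO.
have [Wu _] := hu.
have [[mu_ Lu] _] := Wu.
have mF : measurable_fun Omega (fun x => Fgamma' gam lamp lamm (u x)).
  exact: (measurableT_comp (measurable_Fgamma' gam lamp lamm)).
have [gam1|gam1] := ltP gam 1.
  have g : 0 < gam < 1 by rewrite hgam0.
  apply: L1loc_local => // x0 Ox0.
  have [r r0 rO] := open_closed_ball hopen Ox0.
  have r4 : 0 < r / 4 by rewrite divr_gt0.
  (* The cutoff is the bump of radius [r / 4], bounded below by a positive constant only on the ball
     of half that radius; integrability is proved there. *)
  have r8 : 0 < r / 4 / 2 by rewrite divr_gt0.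
  have sub : ball x0 (r / 4 / 2) `<=` Omega.
    apply: subset_trans (subset_trans (@subset_closed_ball _ _ x0 r) rO).
    by apply: le_ball; lra.
  have mB := rV_ball_measurable x0 (r / 4 / 2).
  exists (r / 4 / 2); split => //.
  have mphi := rV_continuous_measurable (smooth_continuous (smooth_bump x0 (r / 4))).
  have [||C HC] := soft_sign_estimate (phi := bump x0 (r / 4)) hopen Ofin hp g hlamp hlamm hu r0 rO (smooth_bump _ _).
  - by move=> x; rewrite bump_ge0 bump_le1.
  - by move=> x nx; apply: bump_out => // bx; apply: nx; exact: subset_closed_ball.
  apply: (@integral_soft_sign_bound _ _ _ gam lamp lamm ((flat 0 (r / 4 / 2) ^+ 2) ^+ N) C u (bump x0 (r / 4))) => //.
  - by rewrite !exprn_gt0 // flat_gt0.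
  - exact: measurable_funS mu_.
  - exact: measurable_funTS.
  - by move=> x; exact: bump_ge.
  - move=> d d0; apply: le_trans (HC d d0); apply: ge0_subset_integral => //.
      apply/measurable_EFinP; apply: measurable_soft_sign_density => //.
      exact: measurable_funTS.
    by move=> x _; rewrite lee_fin mulr_ge0 ?mulr_ge0 ?bump_ge0.
(* From here on [gam >= 1]: the growth bound makes the function integrable on all of [Omega], which
   has finite measure. *)
split => // K KO cK.
have mK := rV_compact_measurable cK.
apply: (@integrableS _ _ _ (@lebesgue_rV R N) Omega) => //.
apply/integrableP; split; first exact/measurable_EFinP.
have mup : measurable_fun Omega (fun x => (`|u x| `^ p)%:E).
  apply/measurable_EFinP; apply: (measurableT_comp (measurable_powR p)).
  exact: measurableT_comp.
have c0 : 0 <= gam * (lamp + lamm) by rewrite mulr_ge0 ?addr_ge0 // ltW.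
apply: (@le_lt_trans _ _ (\int[lebesgue_rV N]_(x in Omega)
   ((gam * (lamp + lamm))%:E * (1 + (`|u x| `^ p)%:E)))%E).
  apply: ge0_le_integral => //.
  - by apply/measurable_EFinP; exact: measurableT_comp.
  - by apply: emeasurable_funM => //; exact: emeasurable_funD.
  - move=> x _; rewrite -EFinD -EFinM lee_fin; apply: Fgamma'_bound => //; exact: ltW.
rewrite ge0_integralZl //; first last.
- by move=> x _; rewrite adde_ge0 // lee_fin powR_ge0.
- exact: emeasurable_funD.
rewrite ge0_integralD // lte_mul_pinfty //.
rewrite lte_add_pinfty // ?integral_cst // ?mul1e //.
exact: (LpP mO p0 mu_).1.
Qed.
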